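(* For every $\nu>0$ there exist a probability space and a $\mu^\nu$-stationary process $\tilde v^\nu=\{\tilde v^\nu(t)\}_{t\in\mathbb R}$ on it whose paths almost surely solve the inviscid unforced shell model $$\frac{du}{dt}(t)+B(u(t),u(t))=0,\qquad t\in\mathbb R$$ (in the sense that $u(t)-u(s)=-\int_s^tB(u(r),u(r))dr$ for all $s<t$), and whose paths belong to $C^\gamma(\mathbb R;H^{-1-\alpha})$ (locally $\gamma$-Hölder) for every $\gamma\in[0,1)$ and every $\alpha>0$.
   Context: Fix $k_0>0$, $\lambda>1$, $a,b\in\mathbb R$, $k_n=k_0\lambda^n$. Sequences $u=(u_n)_{n\ge1}$, $u_n\in\mathbb R^2\cong\mathbb C$; $H^\alpha=\{u:\sum_nk_n^{2\alpha}|u_n|^2<\infty\}$ with norm $(\sum_nk_n^{2\alpha}|u_n|^2)^{1/2}$. $B(u,v)=(B_n(u,v))_{n\ge1}$ with $B_n(u,v)=-i\big(a k_{n+1}\bar u_{n+1}v_{n+2}+bk_n\bar u_{n-1}v_{n+1}+ak_{n-1}u_{n-1}v_{n-2}+bk_{n-1}u_{n-2}v_{n-1}\big)$ ($u_j=v_j=0$ for $j\le0$; SABRA shell model). $\mu^\nu=\bigotimes_n\mu^\nu_n$ on $(\mathbb R^2)^{\mathbb N}$, $\mu^\nu_n(du_n)=\frac\nu{2\pi}e^{-\frac\nu2|u_n|^2}du_n$. A process is $\mu^\nu$-stationary if it is stationary and its law at each time is $\mu^\nu$. *)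

(* Defs.v *)
From HB Require Import structures.
From mathcomp Require Import all_boot all_order all_algebra.
From mathcomp Require Import all_classical all_reals all_analysis.
Set Implicit Arguments. Unset Strict Implicit. Unset Printing Implicit Defensive.
Import Order.TTheory GRing.Theory Num.Theory.
Import numFieldNormedType.Exports.
Local Open Scope classical_set_scope.
Local Open Scope ring_scope.

Section Shell.
Variable R : realType.

Definition cplx := (R * R)%type.
Definition c0 : cplx := (0, 0).
Definition cadd (z w : cplx) : cplx := (z.1 + w.1, z.2 + w.2).
Definition csub (z w : cplx) : cplx := (z.1 - w.1, z.2 - w.2).
Definition cmul (z w : cplx) : cplx :=
  (z.1 * w.1 - z.2 * w.2, z.1 * w.2 + z.2 * w.1).
Definition cconj (z : cplx) : cplx := (z.1, - z.2).
Definition cscale (r : R) (z : cplx) : cplx := (r * z.1, r * z.2).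
(* multiplication by -i : -i (x + i y) = y - i x *)
Definition cmulmI (z : cplx) : cplx := (z.2, - z.1).
Definition cnorm2 (z : cplx) : R := z.1 ^+ 2 + z.2 ^+ 2.

(* A shell velocity u = (u_n)_{n>=1} is stored as u : nat -> cplx with
   u m = u_{m+1}.  [coord u j] is the paper's u_j, with u_j = 0 for j <= 0
   (here j : nat, and j = 0 gives 0; truncated subtraction n - 2 for n = 1
   also yields index 0, hence value 0, as required). *)
Definition coord (u : nat -> cplx) (j : nat) : cplx :=
  if j is j'.+1 then u j' else c0.

Definition kn (k0 lam : R) (j : nat) : R := k0 * lam ^+ j.

Definition Bn (k0 lam a b : R) (u v : nat -> cplx) (n : nat) : cplx :=
  let k := kn k0 lam in
  cmulmI
   (cadd (cadd (cscale (a * k n.+1) (cmul (cconj (coord u n.+1)) (coord v n.+2)))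
               (cscale (b * k n) (cmul (cconj (coord u (n - 1)%N)) (coord v n.+1))))
         (cadd (cscale (a * k (n - 1)%N) (cmul (coord u (n - 1)%N) (coord v (n - 2)%N)))
               (cscale (b * k (n - 1)%N) (cmul (coord u (n - 2)%N) (coord v (n - 1)%N))))).

Definition Bseq (k0 lam a b : R) (u v : nat -> cplx) : nat -> cplx :=
  fun m => Bn k0 lam a b u v m.+1.

Definition Hnorm2 (k0 lam s : R) (u : nat -> cplx) : \bar R :=
  (\sum_(0 <= m <oo) ((kn k0 lam m.+1) `^ (2 * s) * cnorm2 (u m))%:E)%E.

Definition inH (k0 lam s : R) (u : nat -> cplx) : Prop :=
  (Hnorm2 k0 lam s u < +oo)%E.

Definition holder_loc (k0 lam s gamma : R) (u : R -> nat -> cplx) : Prop :=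
  (forall t, inH k0 lam s (u t)) /\
  forall T : R, 0 < T -> exists C : R, 0 <= C /\
    forall t1 t2 : R, -T <= t1 -> t1 < t2 -> t2 <= T ->
      (Hnorm2 k0 lam s (fun m => csub (u t2 m) (u t1 m))
        <= ((C * (t2 - t1) `^ gamma) ^+ 2)%:E)%E.

Definition solves_inviscid (k0 lam a b : R) (u : R -> nat -> cplx) : Prop :=
  forall (s t : R), s < t -> forall m : nat,
    (u t m).1 - (u s m).1 =
      - (\int[lebesgue_measure]_(r in `[s, t]) (Bseq k0 lam a b (u r) (u r) m).1) /\
    (u t m).2 - (u s m).2 =
      - (\int[lebesgue_measure]_(r in `[s, t]) (Bseq k0 lam a b (u r) (u r) m).2).

Definition gauss_density (nu : R) (x : cplx) : R :=
  nu / (2 * pi) * expR (- (nu / 2) * cnorm2 x).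

Definition gauss2 (nu : R) (A : set cplx) : \bar R :=
  (\int[(@lebesgue_measure R \x @lebesgue_measure R)%E]_(x in A)
      (gauss_density nu x)%:E)%E.

End Shell.

(* Main.v *)
(* The truncated vector field is a sum of triads x_i' = c x_k x_j, x_j' = - c x_k x_i with
   k different from i and j. Freezing x_k, a triad rotates (x_i, x_j), so the splitting scheme
   that lets the triads act one after the other preserves i.i.d. centred Gaussian coordinates
   exactly. Started from them at time - N, with N triad blocks and time step 1 / (N + 1), it is
   stationary under shifts by one time step, and the moments of the invariant law bound, uniformly
   in N, the expectation of the supremum of a coordinate over a time window.

   Instead of proving tightness, the limit N -> oo is taken pathwise along a free ultrafilter, on
   the Loeb space of the probability spaces carrying the N-th scheme. Almost surely all
   coordinates stay bounded on bounded time windows, hence converge at every time; joint laws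
   pass to the limit, which gives the Gaussian law and stationarity. The consistency of the scheme
   becomes |v(y) - v(x) + (y - x) B(v(x), v(x))| = O((y - x)^2) coordinatewise, so that the limit
   is a C^1 solution. High moments give |v_n(t)| <= C lambda^(eps n), and therefore
   |v_n(t) - v_n(s)| <= C |t - s| lambda^((1 + 2 eps) n): the paths are locally Lipschitz with
   values in H^(- 1 - alpha). *)
Require Import Defs.
From HB Require Import structures.
From mathcomp Require Import all_boot all_order all_algebra.
From mathcomp Require Import all_classical all_reals all_analysis.
From mathcomp Require Import measurable_realfun zify ring lra.
Import Order.TTheory GRing.Theory Num.Theory.
Import numFieldNormedType.Exports.
Local Open Scope classical_set_scope.
Local Open Scope ring_scope.
Set Implicit Arguments. Unset Strict Implicit. Unset Printing Implicit Defensive.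

(** * Limits along a free ultrafilter *)

(** Each rotation is a Cayley transform with [h * c * x_k / 2] as tangent of half the angle: it is
    rational in the coordinates, exactly orthogonal, and agrees with the Euler step of the triad up
    to O(h^2). Exact orthogonality makes the law invariant under every single rotation, so the state
    after any number of rotations has the same moments, uniformly in N.

    The obstacle is the supremum over a window that contains about N^2 rotations. In one rotation
    |x_n|^(m+1) varies by at most h |c| times a polynomial of bounded mean, and only triads with mu
    <= n / 2 touch the real coordinate n; their rates sum to O(lambda^(n/2)) per time step, whatever
    N is. Hence already the total variation over the window has bounded mean. The weights
    lambda^(-2n) gather all coordinates into one variable, so that one application of Markov's
    inequality for each window and each power bounds them simultaneously. Taking the root of order m
    + 1 turns the weight into a growth lambda^(2n/(m+1)), which is how every lambda^(eps n) is
    reached. *)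

Definition hyper_sig := cid (@ultraFilterLemma nat \oo _).
Definition hyper : set_system nat := projT1 hyper_sig.
Lemma hyper_ultra : UltraFilter hyper. Proof. exact: (projT2 hyper_sig).1. Qed.
Lemma hyper_ge : \oo `<=` hyper. Proof. exact: (projT2 hyper_sig).2. Qed.
#[global] Instance hyper_proper : ProperFilter hyper.
Proof. exact: (@ultra_proper _ _ hyper_ultra). Qed.

Lemma hyperVN (A : set nat) : hyper A \/ hyper (~` A).
Proof. exact: in_ultra_setVsetC hyper_ultra. Qed.

Lemma hyperN (A : set nat) : ~ hyper A -> \forall n \near hyper, ~ A n.
Proof. by case: (hyperVN A). Qed.

Lemma hyper_gt (n : nat) : \forall N \near hyper, (n < N)%N.
Proof. by apply: hyper_ge; exists n.+1. Qed.

Section ulim.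
Context {R : realType}.
Implicit Types (f g : nat -> R).

(** Being a supremum, it is total: the limit along [hyper] if [f] is bounded there, and the default
    0 of [sup] otherwise; [measurable_hlim] has to account for this default. *)
Definition ulim f : R := sup [set c | \forall n \near hyper, c <= f n].

Definition ubounded f := exists K : R, \forall n \near hyper, `|f n| <= K.

(** A number above the supremum is not eventually a lower bound, and for an ultrafilter this means
    that [f] is eventually below it. *)
Lemma ulimP f : ubounded f -> f @ hyper --> ulim f.
Proof.
move=> [K fK]; set S := [set c | \forall n \near hyper, c <= f n].
have hS : has_sup S.
  split; first by exists (- K); near=> n; rewrite lerNl (le_trans (ler_norm _))// normrN; near: n.
  exists K => c cf; have [n [cn fn]] : exists n, c <= f n /\ `|f n| <= K.
    by apply: (@filter_ex _ hyper); near=> n; split; near: n.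
  by rewrite (le_trans cn)// (le_trans (ler_norm _)).
apply/cvgrPdist_lt => e e0.
have [c Sc cs] := sup_adherent e0 hS.
have e2 : 0 < e / 2 by rewrite divr_gt0.
have : ~ S (ulim f + e / 2).
  by move=> /(ub_le_sup hS.2); apply/negP; rewrite -ltNge ltrDl.
move=> /hyperN nS; rewrite /ulim -/S.
near=> n; rewrite ltr_distlC; apply/andP; split.
- by apply: lt_le_trans cs _; near: n.
- have : ~ (ulim f + e / 2 <= f n) by near: n.
  by move/negP; rewrite -ltNge => /lt_le_trans; apply; rewrite lerD2l; lra.
Unshelve. all: by end_near. Qed.

Lemma cvg_ubounded f (l : R) : f @ hyper --> l -> ubounded f.
Proof.
move=> /cvgrPdist_lt /(_ 1 ltr01) h; exists (`|l| + 1); near=> n.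
have : `|l - f n| < 1 by near: n.
move=> /ltW h1; rewrite -(subKr l (f n)) (le_trans (ler_normB _ _))//.
by rewrite lerD2l.
Unshelve. all: by end_near. Qed.

Lemma ulim_eq f (l : R) : f @ hyper --> l -> ulim f = l.
Proof.
move=> fl; have fu := ulimP (cvg_ubounded fl).
exact: (cvg_unique (@norm_hausdorff _ R) fu fl).
Qed.

Lemma ulim_le f g (l k : R) : f @ hyper --> l -> g @ hyper --> k ->
  (\forall n \near hyper, f n <= g n) -> l <= k.
Proof. by move=> fl gk h; exact: (ler_cvg_to fl gk h). Qed.

Lemma ulim_near_eq f g : (\forall n \near hyper, f n = g n) -> ulim f = ulim g.
Proof.
move=> fg; congr sup; apply/seteqP; split=> c /= cf; near=> n.
  have <- : f n = g n by near: n.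
  by near: n.
have -> : f n = g n by near: n.
by near: n.
Unshelve. all: by end_near. Qed.

Lemma ulim_cst (c : R) : ulim (fun=> c) = c.
Proof. by apply: ulim_eq; exact: cvg_cst. Qed.

End ulim.

(** * Loeb spaces *)

Section internal.
Context d (X : measurableType d).

(** Points are plain sequences rather than their classes modulo [hyper]; the sets [istar A] depend
    on the class only, so they still form the algebra of internal sets. *)
Definition hyperprod : Type := nat -> X.

HB.instance Definition _ := Pointed.on hyperprod.

Definition istar (A : nat -> set X) : set hyperprod :=
  [set w | \forall N \near hyper, A N (w N)].

Definition internal : set (set hyperprod) :=
  [set istar A | A in [set A | forall N, measurable (A N)]].

Lemma istarI A B : istar A `&` istar B = istar (fun N => A N `&` B N).
Proof.
apply/seteqP; split=> w /=.
  by move=> [Aw Bw]; near=> N; split; near: N.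
by move=> h; split; apply: filterS h => N [].
Unshelve. all: by end_near. Qed.

Lemma istarC A : ~` istar A = istar (fun N => ~` A N).
Proof.
apply/seteqP; split=> w /=; first exact: hyperN.
move=> nA Aw; have [N []//] : exists N, ~ A N (w N) /\ A N (w N).
by apply: (@filter_ex _ hyper); near=> N; split; near: N.
Unshelve. all: by end_near. Qed.

Lemma istarU A B : istar A `|` istar B = istar (fun N => A N `|` B N).
Proof.
apply: setC_inj; rewrite setCU !istarC istarI.
by congr istar; apply/funext => N; rewrite setCU.
Qed.

Lemma istar0 : istar (fun=> set0) = set0.
Proof. by apply/seteqP; split=> w //= /(@filter_ex _ hyper)[]. Qed.

Lemma istarT : istar (fun=> setT) = setT.
Proof. by apply/seteqP; split=> w //= _; near=> N.
Unshelve. all: by end_near. Qed.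

(** Where the inclusion fails, pick a point of [A N] outside [B N]; if this happened for
    [hyper]-almost all indices, the resulting sequence would lie in [istar A] but not in [istar B].
    Thus an internal set determines its components at almost all indices. *)
Lemma istar_sub A B : istar A `<=` istar B -> \forall N \near hyper, A N `<=` B N.
Proof.
move=> AB; have [//|nAB] := hyperVN [set N | A N `<=` B N].
have /choice[w hw] : forall N, exists x, ~ A N `<=` B N -> A N x /\ ~ B N x.
  move=> N; have [AB'|] := pselect (A N `<=` B N); first by exists point.
  by move=> /existsNP[x /not_implyP[Ax Bx]]; exists x.
have Aw : istar A w by apply: filterS nAB => N /hw[].
have Bw := AB _ Aw.
have [N []] : exists N, B N (w N) /\ ~ B N (w N).
  apply: (@filter_ex _ hyper); near=> N; split; first by near: N.
  suff [] : A N (w N) /\ ~ B N (w N) by [].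
  by apply: hw; near: N.
by [].
Unshelve. all: by end_near. Qed.

Lemma internal0 : internal set0.
Proof. by exists (fun=> set0) => //; exact: istar0. Qed.

Lemma internalC : setC_closed internal.
Proof.
move=> _ [A mA <-]; exists (fun N => ~` A N); last by rewrite istarC.
by move=> N; apply: measurableC; exact: mA.
Qed.

Lemma internalU : setU_closed internal.
Proof.
move=> _ _ [A mA <-] [B mB <-]; exists (fun N => A N `|` B N); last by rewrite istarU.
by move=> N; apply: measurableU; [exact: mA|exact: mB].
Qed.

Fact internal_display : measure_display. Proof. exact: default_measure_display. Qed.

HB.instance Definition _ := @isAlgebraOfSets.Build internal_display hyperprod
  internal internal0 internalU internalC.

(** Countable saturation. Otherwise every remainder [C K] is nonempty at almost all indices, and a
    diagonal sequence lies in all of them, contradicting the cover. *)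
Lemma istar_saturation (A : nat -> set X) (B : nat -> nat -> set X) :
  istar A `<=` \bigcup_k istar (B k) ->
  exists K, istar A `<=` \big[setU/set0]_(k < K) istar (B k).
Proof.
move=> AB; apply: contrapT => /forallNP nK.
pose C K N := A N `\` \big[setU/set0]_(k < K) B k N.
have istar_big K : \big[setU/set0]_(k < K) istar (B k) =
    istar (fun N => \big[setU/set0]_(k < K) B k N).
  elim: K => [|K IH].
    by rewrite big_ord0 -istar0; congr istar; apply/funext => N; rewrite big_ord0.
  rewrite big_ord_recr/= IH istarU; congr istar; apply/funext => N.
  by rewrite big_ord_recr.
have C0 K : \forall N \near hyper, C K N !=set0.
  have := nK K; rewrite istar_big => /existsNP[w /not_implyP[Aw]].
  move=> /hyperN nB; near=> N; exists (w N); split; near: N => //.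
have Cdec K K' N : (K <= K')%N -> C K' N `<=` C K N.
  move=> KK' x [Ax nB]; split=> //; apply: contra_not nB => Bx.
  exact: (@subset_bigsetU _ (fun k => B k N) _ _ KK' x Bx).
(* Since [C K N] decreases in [K], a point of the last nonempty one with [K <= M] lies in all the
   earlier ones. *)
have hM M N : exists x, forall K, (K <= M)%N -> C K N !=set0 -> C K N x.
  elim: M => [|M [x hx]].
    have [[x Cx]|n0] := pselect (C 0%N N !=set0).
      by exists x => K; rewrite leqn0 => /eqP ->.
    by exists point => K; rewrite leqn0 => /eqP ->.
  have [[y Cy]|n0] := pselect (C M.+1 N !=set0).
    by exists y => K' K'K _; exact: Cdec Cy.
  exists x => K'; rewrite leq_eqVlt => /orP[/eqP->//|]; exact: hx.
(* The diagonal choice [M = N]: the point [w N] takes care of [K] as soon as [K <= N]. *)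
have /choice[w hw] := fun N => hM N N.
have Cw K : istar (C K) w.
  near=> N; apply: (hw N K); last by near: N; exact: C0.
  by apply: ltnW; near: N; exact: hyper_gt.
have Aw : istar A w by apply: filterS (Cw 0%N) => N [].
have [k _ Bw] := AB _ Aw.
have [N []] : exists N, B k N (w N) /\ C k.+1 N (w N).
  by apply: (@filter_ex _ hyper); near=> N; split; near: N => //; exact: Cw.
by move=> Bk [_]; apply; rewrite big_ord_recr; right.
Unshelve. all: by end_near. Qed.

End internal.

(** * The Loeb probability as the extension of an ultralimit of contents *)

Section loeb.
Context d (X : measurableType d) (R : realType).
Variable P : nat -> probability X R.

Definition irep (S : set (hyperprod X)) : nat -> set X :=
  if pselect (internal S) is left h then projT1 (cid2 h) else fun=> set0.

Lemma irepP S : internal S ->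
  (forall N, measurable (irep S N)) /\ istar (irep S) = S.
Proof.
rewrite /irep; case: pselect => // h _.
by split; [exact: (projT2 (cid2 h)).1|exact: (projT2 (cid2 h)).2].
Qed.

Definition loeb_content (S : set (hyperprod X)) : \bar R :=
  (ulim (fun N => fine (P N (irep S N))))%:E.

Lemma ubounded_proba (A : nat -> set X) : (forall N, measurable (A N)) ->
  ubounded (fun N => fine (P N (A N))).
Proof.
move=> mA; exists 1; near=> N; rewrite ger0_norm ?fine_ge0//.
by rewrite -lee_fin fineK ?fin_num_measure// probability_le1.
Unshelve. all: by end_near. Qed.

(** By [istar_sub], two sequences that represent the same internal set agree at almost all indices,
    so the choice made in [irep] does not affect the content. *)
Lemma loeb_content_istar (A : nat -> set X) : (forall N, measurable (A N)) ->
  loeb_content (istar A) = (ulim (fun N => fine (P N (A N))))%:E.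
Proof.
move=> mA; have [_ rE] : (forall N, measurable (irep (istar A) N)) /\
    istar (irep (istar A)) = istar A by apply: irepP; exists A.
congr EFin; apply: ulim_near_eq.
have AI : istar (irep (istar A)) `<=` istar A by rewrite rE.
have IA : istar A `<=` istar (irep (istar A)) by rewrite rE.
apply: filterS2 (istar_sub AI) (istar_sub IA) => N h1 h2.
by congr (fine (P N _)); apply/seteqP.
Qed.

Lemma loeb_content_ge0 S : (0 <= loeb_content S)%E.
Proof.
rewrite lee_fin; have [[A mA <-]|h] := pselect (internal S).
  have := ulimP (ubounded_proba (irepP (ex_intro2 _ _ A mA erefl)).1).
  have c0 : (fun=> 0 : R) @ hyper --> (0 : R) by exact: cvg_cst.
  move=> /(ulim_le c0); apply.
  by near=> n; exact: fine_ge0.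
rewrite (_ : (fun _ => _) = fun=> 0).
  by rewrite ulim_cst.
by apply/funext => N; rewrite /irep; case: pselect => //= _; rewrite measure0.
Unshelve. all: by end_near. Qed.

(** Disjointness of internal sets passes to their components at almost all indices, where [P N] is
    additive. *)
Lemma loeb_content_additive : measure_function.semi_additive loeb_content.
Proof.
have m0 N : @measurable _ X ((fun=> set0) N : set X) by exact: measurable0.
apply/additive2P.
  rewrite -{1}(istar0 X) loeb_content_istar//.
  rewrite (_ : (fun _ => _) = fun=> 0).
    by rewrite ulim_cst.
  by apply/funext => N; rewrite measure0.
move=> _ _ [A mA <-] [B mB <-] AB.
have mAB N : measurable (A N `|` B N) by apply: measurableU; [exact: mA|exact: mB].
rewrite istarU !loeb_content_istar// -EFinD; congr EFin.
have cA := ulimP (ubounded_proba mA); have cB := ulimP (ubounded_proba mB).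
rewrite -(ulim_eq (cvgD cA cB)); apply: ulim_near_eq.
rewrite istarI -{1}(istar0 X) in AB.
have AB0 : istar (fun N => A N `&` B N) `<=` istar (fun=> set0) by rewrite AB istar0.
apply: filterS (istar_sub AB0) => N; rewrite subset0 => AB0N.
by rewrite measureU// fineD// fin_num_measure//.
Qed.

HB.instance Definition _ := isContent.Build _ _ _ loeb_content
  loeb_content_ge0 loeb_content_additive.

Lemma loeb_content_sigma_subadditive :
  measurable_subset_sigma_subadditive loeb_content.
Proof.
move=> _ F mF [A mA <-] AF.
have /choice[B hB] n : exists B, (forall N, measurable (B N)) /\ istar B = F n.
  by have [B mB <-] := mF n; exists B.
have FE : F = fun k => istar (B k) by apply/funext => k; rewrite (hB k).2.
(* By saturation, an internal set covered by countably many internal sets is covered by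
   finitely many of them, so that additivity is enough. *)
have [K AK] : exists K, istar A `<=` \big[setU/set0]_(k < K) istar (B k).
  by apply: istar_saturation; rewrite -FE.
apply: (@le_trans _ _ (\sum_(k < K) loeb_content (F k))%E).
  apply: (@content_subadditive _ _ _ loeb_content) => //.
  - by exists A.
  - by rewrite FE.
rewrite -(big_mkord xpredT (fun k => loeb_content (F k))).
exact: nneseries_lim_ge.
Qed.

HB.instance Definition _ := @Content_SigmaSubAdditive_isMeasure.Build _ _ _
  loeb_content loeb_content_sigma_subadditive.

Definition loeb_space := g_sigma_algebraType (@measurable _ (hyperprod X)).
Definition loeb : set loeb_space -> \bar R := measure_extension loeb_content.
HB.instance Definition _ := Measure.on loeb.

Lemma internal_measurable (A : nat -> set X) : (forall N, measurable (A N)) ->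
  measurable (istar A : set loeb_space).
Proof. by move=> mA; apply: sub_sigma_algebra; exists A. Qed.

Lemma loeb_istar (A : nat -> set X) : (forall N, measurable (A N)) ->
  loeb (istar A) = (ulim (fun N => fine (P N (A N))))%:E.
Proof.
move=> mA; rewrite -loeb_content_istar//.
by apply: measurable_mu_extE; exists A.
Qed.

Lemma loebT : loeb setT = 1%E.
Proof.
rewrite -(istarT X) loeb_istar; last by move=> N; exact: measurableT.
rewrite (_ : (fun _ => _) = fun=> 1).
  by rewrite ulim_cst.
by apply/funext => N; rewrite probability_setT.
Qed.

HB.instance Definition _ := Measure_isProbability.Build _ _ _ loeb loebT.

End loeb.

(** * Joint laws of finite families *)

Definition updset (I : eqType) T (A : I -> set T) (i : I) (B : set T) : I -> set T :=
  fun j => if j == i then B else A j.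

Section finite_pi_lambda.
Context d (T : measurableType d) (R : realType) (I : finType).
Variables (G : set (set T)) (g : nat -> set T).
Hypotheses (mG : @measurable _ T = <<s G >>) (GI : setI_closed G)
  (Gg : forall k, G (g k)) (gT : \bigcup_k g k = setT).

(** Common feature of joint laws and of products of measures: with all sets but one fixed, the value
    is a finite measure of the remaining set. It lets both be compared directly on boxes. *)
Definition multimeasure (F : (I -> set T) -> \bar R) :=
  forall A i, (forall j, measurable (A j)) ->
    exists m : {measure set T -> \bar R}, (m setT < +oo)%E /\
      forall B, measurable B -> F (updset A i B) = m B.

(** The equality is extended from [G] to all measurable sets one index at a time, each time by
    uniqueness of a finite measure on a pi-system. *)
Lemma multimeasure_unique (F1 F2 : (I -> set T) -> \bar R) :
  multimeasure F1 -> multimeasure F2 ->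
  (forall A, (forall i, G (A i)) -> F1 A = F2 A) ->
  forall A, (forall i, measurable (A i)) -> F1 A = F2 A.
Proof.
move=> mF1 mF2 F12.
have Gm B : G B -> measurable B by move=> GB; rewrite mG; exact: sub_sigma_algebra.
(* [s] lists the indices whose set may lie outside [G]. *)
suff H (s : seq I) : forall A, (forall i, measurable (A i)) ->
    (forall i, i \notin s -> G (A i)) -> F1 A = F2 A.
  by move=> A mA; apply: (H (enum I)) => // i; rewrite mem_enum.
elim: s => [|i s IH] A mA sA; first by apply: F12 => i; exact: sA.
have [m1 [m1oo m1E]] := mF1 A i mA; have [m2 [m2oo m2E]] := mF2 A i mA.
have AE : updset A i (A i) = A.
  by apply/funext => j; rewrite /updset; case: eqP => [->|].
rewrite -AE m1E// m2E//; apply: (measure_unique G g) => //; last first.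
  by move=> k; apply: le_lt_trans m1oo; apply: le_measure; rewrite ?inE//; exact: Gm.
move=> B GB; have mB := Gm _ GB; rewrite -m1E// -m2E//; apply: IH => j.
  by rewrite /updset; case: ifP.
rewrite /updset; case: eqP => // /eqP ji js; apply: sA.
by rewrite in_cons negb_or ji.
Qed.

(** With the other sets fixed, the measure is the law of [f i] under [P] restricted to the event [D]
    prescribed by those sets. *)
Lemma multimeasure_law d' (Om : measurableType d') (P : probability Om R)
    (f : I -> Om -> T) : (forall i, measurable_fun setT (f i)) ->
  multimeasure (fun A => P [set w | forall i, A i (f i w)]).
Proof.
move=> mf A i mA.
pose D := \bigcap_(j in [set j | j != i]) (f j @^-1` A j).
have mD : measurable D.
  apply: fin_bigcap_measurable => [|j _]; first exact: finite_finset.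
  by rewrite -[X in measurable X]setTI; exact: mf.
exists (pushforward (mrestr P mD) (f i)); split.
  rewrite /= /pushforward /mrestr/=.
  rewrite setTI; apply: le_lt_trans (probability_le1 _ mD) _; exact: ltry.
move=> B mB; rewrite /pushforward /mrestr; congr (P _).
apply/seteqP; split=> w /=.
  move=> h; split; first by have := h i; rewrite /updset eqxx.
  by move=> j /= /negbTE ji; have := h j; rewrite /updset ji.
move=> [Bi Dw] j; rewrite /updset; case: eqP => [->//|/eqP ji].
exact: Dw.
Unshelve. all: exact: mf. Qed.

End finite_pi_lambda.

Section rays.
Context {R : realType}.

Definition rays := [set A : set R | exists x, A = `]-oo, x]%classic].

Lemma measurable_rays : @measurable _ R = <<s rays >>.
Proof.
transitivity (@RGenOInfty.G R).-sigma.-measurable.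
  by rewrite -RGenOInfty.measurableE.
rewrite eqEsubset; split => A.
  apply: smallest_sub; first exact: smallest_sigma_algebra.
  move=> _ [x ->]; rewrite -setCitvl.
  apply: (@measurableC _ (g_sigma_algebraType rays)).
  by apply: sub_sigma_algebra; exists x.
apply: smallest_sub; first exact: smallest_sigma_algebra.
move=> _ [x ->]; rewrite -setCitvr.
apply: (@measurableC _ (g_sigma_algebraType (@RGenOInfty.G R))).
by apply: sub_sigma_algebra; exists x.
Qed.

Lemma raysI : setI_closed rays.
Proof.
move=> _ _ [x ->] [y ->]; exists (Num.min x y); rewrite predeqE => z /=.
rewrite !in_itv/= le_min; split => [[-> ->]//|/andP[-> ->]//].
Qed.

Lemma rays_cover : \bigcup_k `]-oo, (k%:R : R)]%classic = setT.
Proof.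
apply/seteqP; split=> x // _; exists (Num.bound `|x|) => //=.
by rewrite in_itv/= ltW// (le_lt_trans (ler_norm _))// archi_boundP.
Qed.

End rays.

Section law_real.
Context (R : realType) (I : finType) d1 d2 (Om1 : measurableType d1)
  (Om2 : measurableType d2) (P1 : probability Om1 R) (P2 : probability Om2 R).

Lemma law_rays (f1 : I -> Om1 -> R) (f2 : I -> Om2 -> R) :
  (forall i, measurable_fun setT (f1 i)) -> (forall i, measurable_fun setT (f2 i)) ->
  (forall c : I -> R, P1 [set w | forall i, f1 i w <= c i] =
                      P2 [set w | forall i, f2 i w <= c i]) ->
  forall A : I -> set R, (forall i, measurable (A i)) ->
  P1 [set w | forall i, A i (f1 i w)] = P2 [set w | forall i, A i (f2 i w)].
Proof.
move=> mf1 mf2 H A mA.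
have Gg k : rays `]-oo, (k%:R : R)]%classic by eexists.
apply: (multimeasure_unique (@measurable_rays R) raysI Gg rays_cover
  (multimeasure_law P1 mf1) (multimeasure_law P2 mf2) _ mA).
move=> {mA}A /choice[c cA].
transitivity (P1 [set w | forall i, f1 i w <= c i]).
  by congr (P1 _); apply/seteqP; split=> w /= h i; have := h i; rewrite cA/= in_itv.
rewrite H.
by congr (P2 _); apply/seteqP; split=> w /= h i; have := h i; rewrite cA/= in_itv.
Qed.

End law_real.

Section law_pair.
Context (R : realType) (I : finType) d1 d2 (Om1 : measurableType d1)
  (Om2 : measurableType d2) (P1 : probability Om1 R) (P2 : probability Om2 R).

Lemma rect_setI_closed :
  setI_closed [set A `*` B | A in @measurable _ R &
                             B in @measurable _ R].
Proof.
move=> _ _ [X1 mX1 [X2 mX2 <-]] [Y1 mY1 [Y2 mY2 <-]].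
exists (X1 `&` Y1); first exact: measurableI.
by exists (X2 `&` Y2); [exact: measurableI|rewrite setXI].
Qed.

(** A family of pairs is unfolded into a real family over [I * bool], with [true] for the first
    component; a box of rectangles is a box of that real family. *)
Lemma law_rect (f1 : I -> Om1 -> R * R) (f2 : I -> Om2 -> R * R) :
  (forall i, measurable_fun setT (f1 i)) -> (forall i, measurable_fun setT (f2 i)) ->
  (forall c : I * bool -> set R, (forall i, measurable (c i)) ->
     P1 [set w | forall i, c i (if i.2 then (f1 i.1 w).1 else (f1 i.1 w).2)] =
     P2 [set w | forall i, c i (if i.2 then (f2 i.1 w).1 else (f2 i.1 w).2)]) ->
  forall A : I -> set (R * R), (forall i, measurable (A i)) ->
  P1 [set w | forall i, A i (f1 i w)] = P2 [set w | forall i, A i (f2 i w)].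
Proof.
move=> mf1 mf2 H A mA.
set G := [set A `*` B | A in @measurable _ R &
                        B in @measurable _ R].
have Gg (k : nat) : G setT by exists setT => //; exists setT => //; rewrite setXTT.
have gT : \bigcup_(k : nat) [set: R * R] = setT.
  by apply/seteqP; split=> // x _; exists 0%N.
apply: (multimeasure_unique (@measurable_prod_measurableType _ _ R R) rect_setI_closed Gg gT
  (multimeasure_law P1 mf1) (multimeasure_law P2 mf2) _ mA).
move=> {mA}A GA.
have /choice[cc cA] i : exists p : set R * set R,
    [/\ measurable p.1, measurable p.2 & A i = p.1 `*` p.2].
  by have [B1 m1 [B2 m2 <-]] := GA i; exists (B1, B2).
pose c (i : I * bool) := if i.2 then (cc i.1).1 else (cc i.1).2.
have mc i : measurable (c i).
  by rewrite /c; case: ifP => _; have [] := cA i.1.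
transitivity (P1 [set w | forall i, c i (if i.2 then (f1 i.1 w).1 else (f1 i.1 w).2)]).
  congr (P1 _); apply/seteqP; split=> w /= h.
    by move=> [i []]; have := h i; have [_ _ ->] := cA i => -[].
  move=> i; have [_ _ ->] := cA i.
  by split; [exact: (h (i, true))|exact: (h (i, false))].
rewrite H//.
congr (P2 _); apply/seteqP; split=> w /= h.
  move=> i; have [_ _ ->] := cA i.
  by split; [exact: (h (i, true))|exact: (h (i, false))].
by move=> [i []]; have := h i; have [_ _ ->] := cA i => -[].
Qed.

End law_pair.

(** * Random variables on Loeb spaces *)

Section ulim_more.
Context {R : realType}.
Implicit Types (f g : nat -> R).

Lemma ulim_unbounded f : ~ ubounded f -> ulim f = 0.
Proof.
move=> nb; apply: sup_out => -[[c0 Sc0] [u Su]]; apply: nb.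
exists (Num.max `|c0| `|u + 1|).
have [Su1|/hyperN nSu1] := pselect (\forall n \near hyper, u + 1 <= f n).
  by have := Su _ Su1; rewrite gerDl ler10.
near=> n; rewrite ler_norml le_max.
have h1 : c0 <= f n by near: n.
have /negP : ~ (u + 1 <= f n) by near: n.
rewrite -ltNge => /ltW h2; apply/andP; split.
  rewrite lerNl (@le_trans _ _ `|c0|) ?le_max ?lexx//.
  by rewrite (@le_trans _ _ (- c0)) ?lerN2// -normrN ler_norm.
by apply/orP; right; rewrite (le_trans h2)// ler_norm.
Unshelve. all: by end_near. Qed.

(** The strict inequalities with slack are internal conditions, so the event that an ultralimit is
    at most [c] becomes a countable intersection of internal events. *)
Lemma ulim_leP f (c : R) : ubounded f ->
  (ulim f <= c) <-> (forall k, \forall N \near hyper, f N < c + k.+1%:R^-1).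
Proof.
move=> /ulimP fl; split=> [lc k|H].
  move/cvgrPdist_lt : fl => /(_ k.+1%:R^-1); rewrite invr_gt0 ltr0n => /(_ isT) h.
  near=> N; have : `|ulim f - f N| < k.+1%:R^-1 by near: N.
  rewrite ltr_distlC => /andP[_ /lt_le_trans]; apply.
  by rewrite lerD2r.
apply/ler_addgt0Pr => e e0.
have [k ke] : exists k, k.+1%:R^-1 < e.
  exists (Num.bound e^-1); rewrite invf_plt ?posrE ?ltr0n//.
  by apply: lt_trans (archi_boundP _) _; rewrite ?invr_ge0 ?ltW// ltr_nat.
apply: (ulim_le fl (cvg_cst (c + e))).
near=> N; apply/ltW/(@lt_trans _ _ (c + k.+1%:R^-1)); last by rewrite ltrD2l.
by near: N.
Unshelve. all: by end_near. Qed.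

End ulim_more.

Lemma ae_le_measure d (T : measurableType d) (R : realType)
    (mu : {measure set T -> \bar R}) (Q : T -> Prop) (A B : set T) :
  measurable A -> measurable B -> {ae mu, forall w, Q w} ->
  (forall w, Q w -> A w -> B w) -> (mu A <= mu B)%E.
Proof.
move=> mA mB [N [mN N0 QN]] AB.
have AN : A `<=` B `|` N.
  move=> w Aw; have [Qw|nQ] := pselect (Q w); first by left; exact: AB.
  by right; exact: QN.
apply: (@le_trans _ _ (mu (B `|` N))).
  by apply: le_measure; rewrite ?inE//; exact: measurableU.
by rewrite measureU0.
Qed.

Lemma ae_eq_measure d (T : measurableType d) (R : realType)
    (mu : {measure set T -> \bar R}) (Q : T -> Prop) (A B : set T) :
  measurable A -> measurable B -> {ae mu, forall w, Q w} ->
  (forall w, Q w -> A w <-> B w) -> mu A = mu B.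
Proof.
move=> mA mB aQ AB; apply/eqP; rewrite eq_le; apply/andP.
by split; apply: ae_le_measure aQ _ => // w /AB[].
Qed.

Lemma ae_forall_countable d (T : measurableType d) (R : realType)
    (mu : {measure set T -> \bar R}) (Q : nat -> T -> Prop) :
  (forall k, {ae mu, forall w, Q k w}) -> {ae mu, forall w, forall k, Q k w}.
Proof.
move=> aQ.
apply: (@negligibleS _ _ _ _ (\bigcup_k ~` [set w | Q k w])); last exact: negligible_bigcup.
by move=> w /existsNP[k nQ]; exists k.
Qed.

Lemma ae_forall_fin d (T : measurableType d) (R : realType) (I : finType)
    (mu : {measure set T -> \bar R}) (Q : I -> T -> Prop) :
  (forall k, {ae mu, forall w, Q k w}) -> {ae mu, forall w, forall k, Q k w}.
Proof.
exact: filter_forall.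
Qed.

Lemma ae_sub d (T : measurableType d) (R : realType) (mu : {measure set T -> \bar R})
    (Q1 Q2 : T -> Prop) : (forall w, Q1 w -> Q2 w) ->
  {ae mu, forall w, Q1 w} -> {ae mu, forall w, Q2 w}.
Proof. by move=> Q12; apply: filterS => w; exact: Q12. Qed.

Lemma measurable_forall d (Om : measurableType d) d' (Y : measurableType d') (I : finType)
    (f : I -> Om -> Y) (A : I -> set Y) : (forall i, measurable_fun setT (f i)) ->
  (forall i, measurable (A i)) -> measurable [set w | forall i, A i (f i w)].
Proof.
move=> mf mA; rewrite (_ : [set w | _] = \bigcap_(i in setT) (f i @^-1` A i)).
  apply: fin_bigcap_measurable => [|i _]; first exact: finite_finset.
  by rewrite -[X in measurable X]setTI; exact: mf.
by apply/seteqP; split=> w h i; [move=> _|]; exact: h.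
Qed.

Section loeb_variables.
Context d (X : measurableType d) (R : realType) (P : nat -> probability X R).

Definition hlim (f : nat -> X -> R) (w : loeb_space X) : R := ulim (fun N => f N (w N)).
Definition hbounded (f : nat -> X -> R) (w : loeb_space X) :=
  ubounded (fun N => f N (w N)).

Lemma measurable_hbounded f : (forall N, measurable_fun setT (f N)) ->
  measurable [set w | hbounded f w].
Proof.
move=> mf.
rewrite (_ : [set w | _] = \bigcup_k istar (fun N => [set x | `|f N x| <= k%:R])).
  apply: bigcupT_measurable => k; apply: internal_measurable => N.
  rewrite -[X in measurable X]setTI.
  have mn : measurable_fun setT (fun x => `|f N x|) by apply: measurableT_comp.
  have := mn measurableT `]-oo, k%:R]%classic (measurable_itv _).
  by congr measurable; apply/seteqP; split=> x /=; rewrite in_itv/=.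
apply/seteqP; split=> w.
  move=> [K HK]; exists (Num.bound `|K|) => //; apply: filterS HK => N /le_trans; apply.
  by rewrite ltW// (le_lt_trans (ler_norm _))// archi_boundP.
by move=> [k _ Hk]; exists k%:R.
Qed.

Lemma measurable_lt_add (f : X -> R) (c : R) : measurable_fun setT f ->
  measurable [set x | f x < c].
Proof.
move=> mf; rewrite -[X in measurable X]setTI.
have := mf measurableT `]-oo, c[%classic (measurable_itv _).
by congr measurable; apply/seteqP; split=> x /=; rewrite in_itv/=.
Qed.

Lemma measurable_hlim f : (forall N, measurable_fun setT (f N)) ->
  measurable_fun setT (hlim f).
Proof.
move=> mf; refine (@measurability _ _ (loeb_space X) R setT (hlim f) _ (@measurable_rays R) _).
move=> _ [_ [c ->] <-].
rewrite setTI.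
(* On the unbounded part [hlim f] has the default value 0, so there the event amounts to
   [0 <= c]. *)
rewrite (_ : _ @^-1` _ = ([set w | hbounded f w] `&`
    \bigcap_k istar (fun N => [set x | f N x < c + k.+1%:R^-1])) `|`
   (~` [set w | hbounded f w] `&` [set w | 0 <= c])).
  apply: measurableU; apply: measurableI.
  - exact: measurable_hbounded.
  - apply: bigcapT_measurable => k; apply: internal_measurable => N.
    exact: measurable_lt_add.
  - by apply: measurableC; exact: measurable_hbounded.
  - have [c0|c0] := leP 0 c.
      by rewrite (_ : [set _ | _] = setT)//; apply/seteqP; split.
    by rewrite (_ : [set _ | _] = set0)//; apply/seteqP; split.
apply/seteqP; split=> w /=; rewrite in_itv/=.
  move=> wc; have [bw|nb] := pselect (hbounded f w).
    by left; split=> // k _; exact: (ulim_leP c bw).1.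
  by right; split=> //; rewrite -(ulim_unbounded nb).
move=> [[bw H]|[nb c0]]; last by rewrite /hlim ulim_unbounded.
by apply/(ulim_leP c bw) => k; exact: H.
Qed.

(** If [G] is unbounded along [hyper], then [G > K] at almost all indices, for every [K]; this
    internal event has Loeb measure at most [C / K]. Uniform moments thus become almost sure
    finiteness. *)
Lemma loeb_markov (G : nat -> X -> R) (C : R) : (forall N, measurable_fun setT (G N)) ->
  (forall N x, 0 <= G N x) ->
  (\forall N \near hyper, \int[P N]_x (G N x)%:E <= C%:E)%E ->
  {ae loeb P, forall w, hbounded G w}.
Proof.
move=> mG G0 GC.
exists (~` [set w | hbounded G w]); split => //.
  by apply: measurableC; exact: measurable_hbounded.
apply/eqP; rewrite -measure_le0; apply/lee_addgt0Pr => e e0; rewrite add0e.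
have C0 : 0 <= C.
  have [N] := @filter_ex _ hyper _ _ GC; rewrite -lee_fin; apply: le_trans.
  by apply: integral_ge0 => x _; rewrite lee_fin.
(* The summand 1 keeps [K] positive even if [C = 0], and still [C / K <= e]. *)
pose K := (C + 1) / e; have K0 : 0 < K by rewrite divr_gt0// ltr_wpDl.
pose A N := [set x | K < G N x].
have mA N : measurable (A N).
  rewrite -[X in measurable X]setTI.
  have := mG N measurableT `]K, +oo[%classic (measurable_itv _).
  by congr measurable; apply/seteqP; split=> x /=; rewrite in_itv/= andbT.
apply: (@le_trans _ _ (loeb P (istar A))).
  apply: le_measure; rewrite ?inE.
  - by apply: measurableC; exact: measurable_hbounded.
  - exact: internal_measurable.
  move=> w /= nb; have [//|/hyperN nA] := pselect (istar A w).
  exfalso; apply: nb; exists K; apply: filterS nA => N /negP.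
  by rewrite ger0_norm// leNgt.
rewrite loeb_istar// lee_fin.
apply: (ulim_le (ulimP (ubounded_proba P mA)) (cvg_cst e)).
apply: filterS GC => N GNC.
have : (K%:E * P N (A N) <= C%:E)%E.
  apply: le_trans GNC; rewrite -integral_cst//.
  apply: (@le_trans _ _ (\int[P N]_(x in A N) (G N x)%:E)%E).
    apply: ge0_le_integral => //.
    - by move=> x _; rewrite lee_fin ltW.
    - by apply/measurable_EFinP; apply: measurable_funTS; exact: mG.
    - by move=> x; rewrite lee_fin => /ltW.
  apply: ge0_subset_integral => //; first by apply/measurable_EFinP; exact: mG.
  by move=> x _; rewrite lee_fin.
move=> KC; have : K * fine (P N (A N)) <= C.
  by rewrite -lee_fin EFinM fineK ?fin_num_measure//; exact: KC.
rewrite mulrC -ler_pdivlMr// => /le_trans; apply.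
rewrite /K invf_div mulrA ler_pdivrMr ?ltr_wpDl//.
by rewrite mulrC ler_pM2l// lerDl.
Qed.

Section law.
Variables (I : finType) (f : I -> nat -> X -> R).
Hypothesis mf : forall i N, measurable_fun setT (f i N).
Hypothesis bf : forall i, {ae loeb P, forall w, hbounded (f i) w}.

Definition rayset (c : I -> R) (k N : nat) :=
  [set x : X | forall i, f i N x < c i + k.+1%:R^-1].

Lemma measurable_rayset c k N : measurable (rayset c k N).
Proof.
rewrite (_ : rayset c k N = [set x | forall i, `]-oo, c i + k.+1%:R^-1[%classic (f i N x)]).
  by apply: (measurable_forall (f := f ^~ N) (A := fun i => `]-oo, c i + k.+1%:R^-1[%classic)).
by apply/seteqP; split=> x h i; have := h i; rewrite /= in_itv.
Qed.

(** Up to a null set the event is the decreasing intersection of the internal events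
    [istar (rayset c k)], and continuity from above applies. The slack is there because a limit
    equal to [c] may be approached from above. *)
Lemma loeb_hlim_le (c : I -> R) :
  (fun k => loeb P (istar (rayset c k))) @ \oo -->
  loeb P [set w | forall i, hlim (f i) w <= c i].
Proof.
have mS k : measurable (istar (rayset c k) : set (loeb_space X)).
  by apply: internal_measurable => N; exact: measurable_rayset.
rewrite (_ : loeb P [set w | _] = loeb P (\bigcap_k istar (rayset c k))); last first.
  apply: (@ae_eq_measure _ _ _ _ (fun w => forall i, hbounded (f i) w)).
  - rewrite (_ : [set w | _] = [set w | forall i, `]-oo, c i]%classic (hlim (f i) w)]).
      apply: (measurable_forall (f := fun i => hlim (f i))
        (A := fun i => `]-oo, c i]%classic)) => i.
        exact: measurable_hlim.
      exact: measurable_itv.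
    by apply/seteqP; split=> x h i; have := h i; rewrite /= in_itv.
  - exact: bigcapT_measurable.
  - exact: ae_forall_fin.
  move=> w bw; split=> [H k _|H i].
    have : \forall N \near hyper, forall i, f i N (w N) < c i + k.+1%:R^-1.
      by apply: filter_forall => i; exact: ((ulim_leP (c i) (bw i)).1 (H i) k).
    exact.
  apply/(ulim_leP (c i) (bw i)) => k.
  have Hk : \forall N \near hyper, forall i, f i N (w N) < c i + k.+1%:R^-1.
    exact: (H k Logic.I).
  by apply: filterS Hk => N; apply.
apply: nonincreasing_cvg_mu => //.
- by rewrite (le_lt_trans (probability_le1 _ _))// ltry.
- exact: bigcapT_measurable.
move=> m n mn; apply/subsetPset => w; apply: filterS => N h i.
apply: lt_le_trans (h i) _; rewrite lerD2l lef_pV2 ?posrE ?ltr0n//.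
by rewrite ler_nat ltnS.
Qed.

End law.

Lemma proba_le_cvg d' (Y : measurableType d') (Q : probability Y R) (I : finType)
    (g : I -> Y -> R) (c : I -> R) : (forall i, measurable_fun setT (g i)) ->
  (fun k => Q [set y | forall i, g i y < c i + k.+1%:R^-1]) @ \oo -->
  Q [set y | forall i, g i y <= c i].
Proof.
move=> mg.
have mS (k : nat) : measurable [set y | forall i, g i y < c i + k.+1%:R^-1].
  rewrite (_ : [set y | _] = [set y | forall i, `]-oo, c i + k.+1%:R^-1[%classic (g i y)]).
    by apply: (measurable_forall (f := g) (A := fun i => `]-oo, c i + k.+1%:R^-1[%classic)).
  by apply/seteqP; split=> y h i; have := h i; rewrite /= in_itv.
rewrite (_ : [set y | _] = \bigcap_k [set y | forall i, g i y < c i + k.+1%:R^-1]).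
  apply: nonincreasing_cvg_mu => //.
  - by rewrite (le_lt_trans (probability_le1 _ _))// ltry.
  - exact: bigcapT_measurable.
  move=> m n mn; apply/subsetPset => w h i.
  apply: lt_le_trans (h i) _; rewrite lerD2l lef_pV2 ?posrE ?ltr0n//.
  by rewrite ler_nat ltnS.
apply/seteqP; split=> y /= H.
  by move=> k _ i; rewrite (le_lt_trans (H i))// ltrDl invr_gt0 ltr0n.
move=> i; apply/ler_addgt0Pr => e e0.
have [k ke] : exists k, k.+1%:R^-1 < e.
  exists (Num.bound e^-1); rewrite invf_plt ?posrE ?ltr0n//.
  by apply: lt_trans (archi_boundP _) _; rewrite ?invr_ge0 ?ltW// ltr_nat.
by apply/ltW/(lt_trans (H k Logic.I i)); rewrite ltrD2l.
Qed.

End loeb_variables.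

Section loeb_law.
Context d (X : measurableType d) (R : realType) (P : nat -> probability X R).
Variables (I : finType) (f : I -> nat -> X -> R).
Hypothesis mf : forall i N, measurable_fun setT (f i N).
Hypothesis bf : forall i, {ae loeb P, forall w, hbounded (f i) w}.

(** At almost all indices the prelimit law gives the events with slack the same probabilities as
    [Q]; hence both distribution functions are limits in [k] of one and the same sequence. *)
Lemma loeb_law_cst d' (Y : measurableType d') (Q : probability Y R) (g : I -> Y -> R) :
  (forall i, measurable_fun setT (g i)) ->
  (forall c k, \forall N \near hyper,
     P N (rayset f c k N) = Q [set y | forall i, g i y < c i + k.+1%:R^-1]) ->
  forall A : I -> set R, (forall i, measurable (A i)) ->
  loeb P [set w | forall i, A i (hlim (f i) w)] = Q [set y | forall i, A i (g i y)].
Proof.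
move=> mg PQ; apply: law_rays => [i|//|c]; first exact: measurable_hlim.
have h := loeb_hlim_le mf bf (c := c); apply: (cvg_unique _ h).
  exact: ereal_hausdorff.
rewrite (_ : (fun k => _) = fun k => Q [set y | forall i, g i y < c i + k.+1%:R^-1]).
  exact: proba_le_cvg.
apply/funext => k; have mr N := measurable_rayset mf c k N.
rewrite loeb_istar// -[RHS]fineK ?fin_num_measure//; last first.
  exact: (measurable_rayset (f := fun i _ => g i) (fun i _ => mg i) c k 0).
congr EFin; rewrite -[RHS]ulim_cst; apply: ulim_near_eq.
by apply: filterS (PQ c k) => N ->.
Qed.

Lemma loeb_law_eq (g : I -> nat -> X -> R) :
  (forall i N, measurable_fun setT (g i N)) ->
  (forall i, {ae loeb P, forall w, hbounded (g i) w}) ->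
  (forall c k, \forall N \near hyper, P N (rayset f c k N) = P N (rayset g c k N)) ->
  forall A : I -> set R, (forall i, measurable (A i)) ->
  loeb P [set w | forall i, A i (hlim (f i) w)] =
  loeb P [set w | forall i, A i (hlim (g i) w)].
Proof.
move=> mg bg fg; apply: law_rays => [i|i|c]; [exact: measurable_hlim..|].
have h := loeb_hlim_le mf bf (c := c); apply: (cvg_unique _ h).
  exact: ereal_hausdorff.
rewrite (_ : (fun k => _) = fun k => loeb P (istar (rayset g c k))).
  exact: loeb_hlim_le.
apply/funext => k; rewrite !loeb_istar//; [|exact: measurable_rayset..].
by congr EFin; apply: ulim_near_eq; apply: filterS (fg c k) => N ->.
Qed.

End loeb_law.

(** * Independent identically distributed sequences *)

Section push_proba.
Context d d' (X : measurableType d) (Y : measurableType d') (R : realType).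
Variables (P : probability X R) (f : X -> Y).

(** The proof of measurability is an argument, so that a probability instance can be attached to the
    term. *)
Definition push_proba (mf : measurable_fun setT f) : set Y -> \bar R :=
  pushforward P f.

Variable mf : measurable_fun setT f.

Let push0 : push_proba mf set0 = 0%E. Proof. exact: measure0. Qed.

Let push_ge0 A : (0 <= push_proba mf A)%E. Proof. exact: measure_ge0. Qed.

Let push_sigma_additive : semi_sigma_additive (push_proba mf).
Proof.
move=> F mF tF mUF; rewrite /push_proba /pushforward preimage_bigcup.
apply: measure_semi_sigma_additive.
- by move=> n; rewrite -[X in measurable X]setTI; exact: mf.
- apply/trivIsetP => /= i j _ _ ij; rewrite -preimage_setI.
  by move/trivIsetP : tF => /(_ _ _ _ _ ij) ->//; rewrite preimage_set0.
- by rewrite -preimage_bigcup -[X in measurable X]setTI; exact: mf.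
Qed.

HB.instance Definition _ := isMeasure.Build _ _ _ (push_proba mf)
  push0 push_ge0 push_sigma_additive.

Let pushT : push_proba mf setT = 1%E. Proof. exact: probability_setT. Qed.

HB.instance Definition _ := Measure_isProbability.Build _ _ _ (push_proba mf) pushT.

End push_proba.

Section rseq.
Context {R : realType}.

Definition cylset (D : nat) (A : nat -> set R) : set (nat -> R) :=
  [set x | forall n, (n < D)%N -> A n (x n)].

Definition cylinders : set (set (nat -> R)) :=
  [set C | exists D, exists2 A, (forall n, measurable (A n)) & C = cylset D A].

Lemma cylindersI : setI_closed cylinders.
Proof.
move=> _ _ [D [A mA ->]] [E [B mB ->]]; exists (maxn D E).
exists (fun n => (if (n < D)%N then A n else setT) `&` (if (n < E)%N then B n else setT)).
  by move=> n; apply: measurableI; case: ifP.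
apply/seteqP; split=> x.
  by move=> [Ax Bx] n _; split; case: ifP => // h; [exact: Ax|exact: Bx].
move=> h; split=> n nD; have := h n; rewrite leq_max nD ?orbT => /(_ isT) [] //.
Qed.

Definition rseq := g_sigma_algebraType cylinders.

Lemma measurable_cylset D A : (forall n, measurable (A n)) ->
  measurable (cylset D A : set rseq).
Proof. by move=> mA; apply: sub_sigma_algebra; exists D, A. Qed.

Lemma measurable_coord n : measurable_fun setT (fun x : rseq => x n).
Proof.
move=> _ A mA; rewrite setTI.
rewrite (_ : _ @^-1` A = cylset n.+1 (fun k => if k == n then A else setT)).
  by apply: measurable_cylset => k; case: ifP.
apply/seteqP; split=> x /=.
  by move=> Ax k kn; case: eqP => // ->.
by move=> /(_ n (ltnSn n)); rewrite eqxx.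
Qed.

Lemma measurable_rseq d (Y : measurableType d) (f : Y -> rseq) :
  (forall n, measurable_fun setT (fun y => f y n)) -> measurable_fun setT f.
Proof.
move=> mf; refine (@measurability _ _ Y rseq setT f cylinders erefl _).
move=> _ [_ [D [A mA ->]] <-]; rewrite setTI.
rewrite (_ : _ @^-1` _ = \bigcap_(n in `I_D) ((fun y => f y n) @^-1` A n)).
  apply: fin_bigcap_measurable; first exact: finite_II.
  by move=> n _; rewrite -[X in measurable X]setTI; exact: mf.
by apply/seteqP; split=> y h n; exact: h.
Qed.

Lemma rseq_proba_unique (P Q : probability rseq R) :
  (forall D A, (forall n, measurable (A n)) -> P (cylset D A) = Q (cylset D A)) ->
  forall E, measurable E -> P E = Q E.
Proof.
move=> PQ E mE.
apply: (@measure_unique _ R rseq cylinders (fun=> setT) erefl cylindersI _ _ P Q) => //.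
- move=> _; exists 0%N, (fun=> setT) => //.
  by apply/seteqP; split.
- by apply/seteqP; split=> // x _; exists 0%N.
- by move=> _ [D [A mA ->]]; exact: PQ.
- by move=> k; apply: le_lt_trans (probability_le1 _ measurableT) _; rewrite ltry.
Qed.

Definition iid_upto (g : probability R R) (D : nat) (P : probability rseq R) :=
  forall A, (forall n, measurable (A n)) ->
    P (cylset D A) = (\prod_(n < D) g (A n))%E.

Definition iid (g : probability R R) (P : probability rseq R) :=
  forall D, iid_upto g D P.

Definition upd (x : nat -> R) (i : nat) (r : R) : nat -> R :=
  fun n => if n == i then r else x n.

Lemma measurable_upd i :
  measurable_fun [set: rseq * R] (fun z : rseq * R => upd z.1 i z.2 : rseq).
Proof.
apply: measurable_rseq => n; rewrite /upd; case: eqP => _; first exact: measurable_snd.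
exact: (measurableT_comp (measurable_coord n) measurable_fst).
Qed.

Variable g : probability R R.

(** The law of [N] independent coordinates followed by zeros. *)
Fixpoint plaw (N : nat) : probability rseq R :=
  if N is N'.+1 then push_proba (plaw N' \x g)%E (measurable_upd N')
  else \d_((fun=> 0) : rseq).

Lemma iid_upto_le D D' P : (D <= D')%N -> iid_upto g D' P -> iid_upto g D P.
Proof.
move=> DD' h A mA.
have mA' n : measurable (if (n < D)%N then A n else setT) by case: ifP.
have := h _ mA'; rewrite (_ : cylset D' _ = cylset D A).
  move=> ->; rewrite -(big_mkord xpredT (fun n => g (A n))).
  rewrite -(big_mkord xpredT (fun n => g (if (n < D)%N then A n else setT))).
  rewrite (big_cat_nat (n := D))//= [X in (_ * X)%E]big1_seq ?mule1.
    by apply: eq_big_nat => n /andP[_ ->].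
  by move=> n /=; rewrite mem_index_iota => /andP[Dn _]; rewrite ltnNge Dn/= probability_setT.
apply/seteqP; split=> x hx n nD.
  by have := hx n (leq_trans nD DD'); rewrite nD.
by case: ifP => // nD'; exact: hx.
Qed.

Lemma plaw_iid N : iid_upto g N (plaw N).
Proof.
elim: N => [|N IH] A mA.
  by rewrite big_ord0/= (_ : cylset 0 A = setT) ?probability_setT//; apply/seteqP; split.
rewrite big_ord_recr/= -IH//= /push_proba /pushforward.
rewrite -product_measure1E//; last exact: measurable_cylset.
congr (_ _); apply/seteqP; split=> -[x y]/=; rewrite /upd.
  move=> h; split=> [n nN|]; last by have := h N (ltnSn N); rewrite eqxx.
  by have := h n (ltnW nN); rewrite ltn_eqF.
by move=> [/= h1 h2] n; rewrite ltnS leq_eqVlt; case: eqP => [->//|_] /=; exact: h1.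
Qed.

Lemma iid_upto_coord D (P : probability rseq R) n B : iid_upto g D P -> (n < D)%N ->
  measurable B -> P [set x | B (x n)] = g B.
Proof.
move=> h nD mB; have {}h := iid_upto_le nD h.
have mA k : measurable (if k == n then B else setT) by case: ifP.
have := h _ mA; rewrite big_ord_recr/= eqxx big1 ?mul1e => [<-|i _]; last first.
  by rewrite ltn_eqF// probability_setT.
congr (P _); apply/seteqP; split=> x /=.
  by move=> Bx k kn; case: eqP => // ->.
by move=> /(_ n (ltnSn n)); rewrite eqxx.
Qed.

Lemma iid_upto_integral D (P : probability rseq R) n (f : R -> \bar R) :
  iid_upto g D P -> (n < D)%N -> measurable_fun setT f -> (forall x, (0 <= f x)%E) ->
  (\int[P]_x f (x n) = \int[g]_y f y)%E.
Proof.
move=> h nD mf f0; have mc := measurable_coord n.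
transitivity (\int[push_proba P mc]_y f y)%E.
  transitivity (\int[pushforward P (fun x : rseq => x n)]_y f y)%E.
    by rewrite ge0_integral_pushforward.
  by apply: eq_measure_integral.
by apply: eq_measure_integral => A mA _; exact: (iid_upto_coord h nD).
Qed.

Section iid_exists.
Hypothesis mom : exists C : R, (\int[g]_x `|x|%:E <= C%:E)%E.

Let f (i N : nat) (x : rseq) : R := x i.

Let mf i N : measurable_fun setT (f i N). Proof. exact: measurable_coord. Qed.

Let bf i : {ae loeb plaw, forall w, hbounded (f i) w}.
Proof.
have [C gC] := mom.
have : {ae loeb plaw, forall w, hbounded (fun N (x : rseq) => `|x i|) w}.
  apply: (@loeb_markov _ _ _ _ _ C) => //.
    by move=> N; apply: measurableT_comp => //; exact: measurable_coord.
  apply: filterS (hyper_gt i) => N iN.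
  rewrite (iid_upto_integral (f := fun y => `|y|%:E) (@plaw_iid N) iN)//.
  by apply/measurable_EFinP; exact: normr_measurable.
apply: filterS => w [K HK]; exists K; apply: filterS HK => N.
by rewrite normr_id.
Qed.

Let lim_seq (w : loeb_space rseq) : rseq := fun i => hlim (f i) w.

Let mlim_seq : measurable_fun setT lim_seq.
Proof. by apply: measurable_rseq => n; exact: measurable_hlim. Qed.

(** The infinite product is the law of the coordinatewise ultralimit on the Loeb space of the laws
    [plaw N]: for [N >= D] the law of the first [D] coordinates no longer depends on [N]. The moment
    of [g] keeps each coordinate almost surely bounded along [hyper]. *)
Lemma iid_exists : exists P, iid g P.
Proof.
exists (push_proba (loeb plaw) mlim_seq) => D A mA.
rewrite -(@plaw_iid D A mA) /push_proba/= /pushforward.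
transitivity (loeb plaw [set w | forall i : 'I_D, A i (hlim (f i) w)]).
  congr (loeb plaw _); apply/seteqP; split=> w /=.
    by move=> h i; exact: h.
  by move=> h n nD; exact: (h (Ordinal nD)).
transitivity (plaw D [set x | forall i : 'I_D, A i (x i)]); last first.
  congr (plaw D _); apply/seteqP; split=> w /=; last by move=> h i; exact: h.
  by move=> h n nD; exact: (h (Ordinal nD)).
have mfD (i : 'I_D) N : measurable_fun setT (f i N) by exact: mf.
apply: (@loeb_law_cst _ _ _ plaw _ _ mfD (fun i => bf i) _ _ (plaw D)
  (fun (i : 'I_D) (x : rseq) => x i) _ _ (fun i : 'I_D => A i)) => // [i|c k].
  exact: measurable_coord.
apply: filterS (hyper_gt D) => N DN.
have E N' : (D <= N')%N -> plaw N' (rayset (fun i : 'I_D => f i) c k N') =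
    (\prod_(i < D) g `]-oo, (c i + k.+1%:R^-1)%R[%classic)%E.
  move=> DN'; have h := iid_upto_le DN' (@plaw_iid N').
  pose B n : set R := if insub n is Some i then `]-oo, c i + k.+1%:R^-1[%classic else setT.
  have mB n : measurable (B n) by rewrite /B; case: insub => // i; exact: measurable_itv.
  rewrite (_ : rayset _ _ _ _ = (cylset D B : set rseq)).
    by rewrite h//; apply: eq_bigr => i _; rewrite /B valK.
  apply/seteqP; split=> x hx.
    move=> n nD; rewrite /B; case: insubP => // i _ <-; rewrite /= in_itv/=; exact: hx.
  by move=> i; have := hx i (ltn_ord i); rewrite /B valK/= in_itv.
by rewrite (E N (ltnW DN)) -(E D).
Qed.

End iid_exists.

End rseq.

(** * The planar Gaussian measure *)

(* The rotation by the angle [- theta], where [tau = tan (theta / 2)]. *)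
Definition cayley {R : realType} (tau : R) (z : R * R) : R * R :=
  (((1 - tau ^+ 2) * z.1 + 2 * tau * z.2) / (1 + tau ^+ 2),
   ((1 - tau ^+ 2) * z.2 - 2 * tau * z.1) / (1 + tau ^+ 2)).

Section lebesgue_shear.
Context {R : realType}.
Local Notation M := (measurableTypeR R).
Local Notation leb := (@lebesgue_measure R).

(** [M] is the copy of [R] that carries [lebesgue_measure]; measurability into either is the same by
    conversion. *)
Lemma measurable_to_M d (T : measurableType d) (f : T -> R) :
  measurable_fun setT f -> measurable_fun setT (f : T -> M).
Proof. by []. Qed.

Lemma lebesgue_measure_shift (c : R) (A : set M) : measurable A ->
  pushforward leb (fun x : M => (x + c : M)) A = leb A.
Proof.
have mc : measurable_fun [set: M] (fun x : M => (x + c : M)).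
  by apply: measurable_to_M; apply: measurable_funD.
move=> mA; apply/esym/(lebesgue_measure_unique
  (mu := pushforward leb (fun x : M => (x + c : M)))) => //.
move=> _ [[a b]] _ <-.
rewrite /= /pushforward (_ : _ @^-1` _ = `]a - c, b - c]%classic).
  rewrite !lebesgue_measure_itv/= !lte_fin ltrD2r; case: ifP => // _.
  by rewrite -!EFinB; congr EFin; ring.
by apply/seteqP; split=> x /=; rewrite !in_itv/= ltrBlDr lerBrDr.
Unshelve. all: exact: mc. Qed.

Lemma ge0_integral_shift (c : R) (f : M -> \bar R) : measurable_fun setT f ->
  (forall x, 0 <= f x)%E -> (\int[leb]_x f (x + c)%R = \int[leb]_x f x)%E.
Proof.
move=> mf f0.
have mc : measurable_fun [set: M] (fun x : M => (x + c : M)).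
  by apply: measurable_to_M; apply: measurable_funD.
pose h (x : M) : M := x + c.
transitivity (\int[pushforward leb h]_x f x)%E.
  by rewrite ge0_integral_pushforward//.
by apply: eq_measure_integral => A mA _; exact: lebesgue_measure_shift.
Qed.

(** With the second coordinate fixed to [y], the shear is the translation by [t * y]. *)
Lemma integral_shear1 (t : R) (g : M * M -> \bar R) : measurable_fun setT g ->
  (forall x, 0 <= g x)%E ->
  (\int[leb \x leb]_z g (z.1 + t * z.2, z.2)%R = \int[leb \x leb]_z g z)%E.
Proof.
move=> mg g0.
have ms : measurable_fun [set: M * M] (fun z : M * M => (z.1 + t * z.2, z.2) : M * M).
  apply: measurable_fun_pair => //; apply: measurable_to_M.
  by apply: measurable_funD => //; exact: measurable_funM.
rewrite fubini_tonelli2//; last exact: (measurableT_comp mg ms).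
rewrite [RHS]fubini_tonelli2//.
apply: eq_integral => y _; rewrite /fubini_G/=.
apply: (ge0_integral_shift (t * y) (f := fun x => g (x, y))) => //.
by apply: measurableT_comp => //; exact: measurable_pair2.
Qed.

Lemma integral_shear2 (t : R) (g : M * M -> \bar R) : measurable_fun setT g ->
  (forall x, 0 <= g x)%E ->
  (\int[leb \x leb]_z g (z.1, z.2 + t * z.1)%R = \int[leb \x leb]_z g z)%E.
Proof.
move=> mg g0.
have ms : measurable_fun [set: M * M] (fun z : M * M => (z.1, z.2 + t * z.1) : M * M).
  apply: measurable_fun_pair => //; apply: measurable_to_M.
  by apply: measurable_funD => //; exact: measurable_funM.
rewrite fubini_tonelli1//; last exact: (measurableT_comp mg ms).
rewrite [RHS]fubini_tonelli1//.
apply: eq_integral => y _; rewrite /fubini_F/=.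
apply: (ge0_integral_shift (t * y) (f := fun x => g (y, x))) => //.
by apply: measurableT_comp => //; exact: measurable_pair1.
Qed.

(** A rotation is a product of three shears, with coefficients tan (theta / 2), - sin theta and tan
    (theta / 2), where sin theta = 2 tau / (1 + tau^2). This reduces rotation invariance of Lebesgue
    measure to translation invariance. *)
Lemma cayley_shears (tau : R) (z : R * R) :
  cayley tau z =
  let s := - (2 * tau / (1 + tau ^+ 2)) in
  let z1 := (z.1 + tau * z.2, z.2) in
  let z2 := (z1.1, z1.2 + s * z1.1) in (z2.1 + tau * z2.2, z2.2).
Proof.
have h : 1 + tau ^+ 2 != 0 by rewrite gt_eqF// ltr_pwDl// sqr_ge0.
by rewrite /cayley/=; congr pair; field.
Qed.

Lemma measurable_cayley (tau : R) :
  measurable_fun [set: M * M] (cayley tau : M * M -> M * M).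
Proof.
apply: measurable_fun_pair; apply: measurable_to_M; apply: measurable_funM => //.
  by apply: measurable_funD; apply: measurable_funM.
by apply: measurable_funB; apply: measurable_funM.
Qed.

Lemma integral_cayley (tau : R) (g : M * M -> \bar R) : measurable_fun setT g ->
  (forall x, 0 <= g x)%E ->
  (\int[leb \x leb]_z g (cayley tau z) = \int[leb \x leb]_z g z)%E.
Proof.
move=> mg g0; set s := - (2 * tau / (1 + tau ^+ 2)).
have m1 t : measurable_fun [set: M * M] (fun z : M * M => (z.1 + t * z.2, z.2) : M * M).
  apply: measurable_fun_pair => //; apply: measurable_to_M.
  by apply: measurable_funD => //; exact: measurable_funM.
have m2 t : measurable_fun [set: M * M] (fun z : M * M => (z.1, z.2 + t * z.1) : M * M).
  apply: measurable_fun_pair => //; apply: measurable_to_M.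
  by apply: measurable_funD => //; exact: measurable_funM.
rewrite -[RHS](integral_shear1 tau mg g0).
pose g1 z := g (z.1 + tau * z.2, z.2).
have mg1 : measurable_fun [set: M * M] g1 by exact: (measurableT_comp mg (m1 tau)).
have g10 z : (0 <= g1 z)%E by exact: g0.
rewrite -[RHS](integral_shear2 s mg1 g10).
pose g2 z := g1 (z.1, z.2 + s * z.1).
have mg2 : measurable_fun [set: M * M] g2 by exact: (measurableT_comp mg1 (m2 s)).
have g20 z : (0 <= g2 z)%E by exact: g10.
rewrite -[RHS](integral_shear1 tau mg2 g20).
by apply: eq_integral => z _; rewrite cayley_shears.
Qed.

End lebesgue_shear.

Section gaussian.
Context {R : realType}.
Variable nu : R.
Hypothesis nu0 : 0 < nu.
Local Notation M := (measurableTypeR R).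
Local Notation leb := (@lebesgue_measure R).
Let s := Num.sqrt nu^-1.

Lemma gauss_density_ge0 (z : R * R) : 0 <= gauss_density nu z.
Proof. by rewrite /gauss_density mulr_ge0 ?expR_ge0// divr_ge0 ?ltW// mulr_gt0// pi_gt0. Qed.

Lemma gauss_densityE (x y : R) :
  gauss_density nu (x, y) = normal_pdf 0 s x * normal_pdf 0 s y.
Proof.
have s2 : s ^+ 2 = nu^-1 by rewrite sqr_sqrtr// invr_ge0 ltW.
have s0 : s != 0 by rewrite gt_eqF// sqrtr_gt0 invr_gt0.
rewrite !normal_pdfE// /normal_fun/= mulrACA -expRD /gauss_density; congr (_ * expR _).
  rewrite /normal_peak -invfM -expr2 sqr_sqrtr ?s2.
    have pi0 : (pi : R) != 0 by rewrite gt_eqF// pi_gt0.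
    have nu1 : nu != 0 by rewrite gt_eqF.
    by move: (pi : R) pi0 => p p0; rewrite mulr2n; field; rewrite nu1 p0.
  by rewrite mulrn_wge0// mulr_ge0 ?pi_ge0// invr_ge0 ltW.
by rewrite /cnorm2/= !subr0 s2; field; rewrite gt_eqF.
Qed.

Lemma measurable_gauss_density : measurable_fun [set: M * M] (gauss_density nu).
Proof.
rewrite (_ : gauss_density nu = fun z => normal_pdf 0 s z.1 * normal_pdf 0 s z.2).
  by apply: measurable_funM; apply: measurableT_comp => //; exact: measurable_normal_pdf.
by apply/funext => -[x y]; exact: gauss_densityE.
Qed.

Lemma cnorm2_cayley (tau : R) z : cnorm2 (cayley tau z) = cnorm2 z.
Proof.
have h : 1 + tau ^+ 2 != 0 by rewrite gt_eqF// ltr_pwDl// sqr_ge0.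
by rewrite /cnorm2/cayley/=; field.
Qed.

Definition gauss2M : set (M * M) -> \bar R := gauss2 nu.

Lemma gauss2_0 : gauss2M set0 = 0%E.
Proof. by rewrite /gauss2M /gauss2 integral_set0. Qed.

Lemma gauss2_ge0 A : (0 <= gauss2M A)%E.
Proof. by apply: integral_ge0 => z _; rewrite lee_fin gauss_density_ge0. Qed.

Lemma gauss2_semi_sigma_additive : semi_sigma_additive gauss2M.
Proof.
move=> F mF tF mUF; rewrite /gauss2M /gauss2 ge0_integral_bigcup//.
- apply: is_cvg_ereal_nneg_natsum_cond => n _ _.
  by apply: integral_ge0 => z _; rewrite lee_fin gauss_density_ge0.
- by apply: measurable_funTS; apply/measurable_EFinP; exact: measurable_gauss_density.
- by move=> z _; rewrite lee_fin gauss_density_ge0.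
Qed.

HB.instance Definition _ := isMeasure.Build _ _ _ gauss2M
  gauss2_0 gauss2_ge0 gauss2_semi_sigma_additive.

Lemma gauss2_rect (A B : set M) : measurable A -> measurable B ->
  gauss2M (A `*` B) = (normal_prob 0 s A * normal_prob 0 s B)%E.
Proof.
move=> mA mB; rewrite /gauss2M /gauss2 integral_mkcond fubini_tonelli1.
- rewrite /fubini_F /normal_prob.
  have pB : (0 <= \int[leb]_(x in B) (normal_pdf 0 s x)%:E)%E.
    by apply: integral_ge0 => x _; rewrite lee_fin normal_pdf_ge0.
  rewrite [in RHS]integral_mkcond -ge0_integralZr//; last 2 first.
  + apply/(measurable_restrictT _ mA); apply: measurable_funTS; apply/measurable_EFinP.
    exact: measurable_normal_pdf.
  + by move=> x _; rewrite erestrict_ge0// => y _; rewrite lee_fin normal_pdf_ge0.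
  apply: eq_integral => x _; rewrite [in RHS]/patch; case: ifPn => xA; last first.
    rewrite mul0e integral0_eq// => y _.
    by rewrite /patch/= ifF//; apply: contraNF xA; rewrite !inE => -[].
  rewrite [in RHS]integral_mkcond -ge0_integralZl//; last 3 first.
  + apply/(measurable_restrictT _ mB); apply: measurable_funTS; apply/measurable_EFinP.
    exact: measurable_normal_pdf.
  + by move=> y _; rewrite erestrict_ge0// => z _; rewrite lee_fin normal_pdf_ge0.
  + by rewrite lee_fin normal_pdf_ge0.
  apply: eq_integral => y _; rewrite /patch/=; case: ifPn => xy; last first.
    case: ifPn => yB; last by rewrite mule0.
    by move: xy; rewrite notin_setE => /= -[]; rewrite !inE in xA yB.
  rewrite ifT; first by rewrite gauss_densityE EFinM.
  by move: xy; rewrite !inE => -[].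
- have mAB : measurable (A `*` B) by exact: measurableX.
  apply/(measurable_restrictT _ mAB); apply: measurable_funTS.
  by apply/measurable_EFinP; exact: measurable_gauss_density.
- by move=> z; rewrite erestrict_ge0// => y _; rewrite lee_fin gauss_density_ge0.
Qed.

(** The density depends on [cnorm2] alone, which the rotation preserves, as it does Lebesgue
    measure. *)
Lemma gauss2_cayley tau (E : set (M * M)) : measurable E ->
  gauss2M (cayley tau @^-1` E) = gauss2M E.
Proof.
move=> mE; rewrite /gauss2M /gauss2 integral_mkcond [in RHS]integral_mkcond.
rewrite -[RHS](@integral_cayley _ tau).
- apply: eq_integral => z _; rewrite /patch/=.
  have -> : (z \in cayley tau @^-1` E) = (cayley tau z \in E) by [].
  by case: ifP => // _; rewrite /gauss_density cnorm2_cayley.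
- apply/(measurable_restrictT _ mE); apply: measurable_funTS.
  by apply/measurable_EFinP; exact: measurable_gauss_density.
- by move=> z; rewrite erestrict_ge0// => y _; rewrite lee_fin gauss_density_ge0.
Qed.

End gaussian.

(** * Integration against a measure given by a density *)

Section density.
Context d (T : measurableType d) (R : realType).
Variables (mu nu : {measure set T -> \bar R}) (phi : T -> R).
Hypotheses (mphi : measurable_fun setT phi) (phi0 : forall x, 0 <= phi x)
  (nuE : forall A, measurable A -> nu A = (\int[mu]_(x in A) (phi x)%:E)%E).
Local Open Scope ereal_scope.

Import HBNNSimple.

Lemma integral_density_nnsfun (h : {nnsfun T >-> R}) :
  \int[nu]_x (h x)%:E = \int[mu]_x ((h x)%:E * (phi x)%:E).
Proof.
transitivity (\sum_(y \in range h)
    (\int[mu]_x (y%:E * ((\1_(h @^-1` [set y]) x)%:E * (phi x)%:E)))).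
  rewrite integralT_nnsfun sintegralE; apply: eq_fsbigr => y.
  rewrite inE => -[z _ <-].
  have mz : measurable (h @^-1` [set h z]) by exact: measurable_funPTI.
  rewrite ge0_integralZl//.
  - congr (_ * _); rewrite nuE// integral_mkcond; apply: eq_integral => x _.
    by rewrite /patch indicE; case: ifPn; rewrite ?mul1e ?mul0e.
  - apply: emeasurable_funM; last exact/measurable_EFinP.
    by apply/measurable_EFinP; exact: measurable_indic.
  - by move=> x _; rewrite mule_ge0// lee_fin.
  - by rewrite lee_fin.
rewrite -ge0_integral_fsum//.
- apply: eq_integral => x _; rewrite [in RHS]fimfunE -fsumEFin// ge0_mule_fsuml.
    by apply: eq_fsbigr => y _; rewrite EFinM muleA.
  by move=> y; rewrite EFinM; exact: nnfun_muleindic_ge0.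
- move=> y; apply: emeasurable_funM => //; apply: emeasurable_funM; last exact/measurable_EFinP.
  by apply/measurable_EFinP; exact: measurable_indic.
- move=> y x _; rewrite muleA mule_ge0 ?lee_fin//.
  exact: nnfun_muleindic_ge0.
Qed.

Lemma integral_density (f : T -> \bar R) : measurable_fun setT f ->
  (forall x, 0 <= f x) -> \int[nu]_x f x = \int[mu]_x (f x * (phi x)%:E).
Proof.
move=> mf f0; pose f_ := nnsfun_approx measurableT mf.
have f_cvg x : EFin \o f_^~x @ \oo --> f x by exact: cvg_nnsfun_approx.
transitivity (limn (fun n => \int[nu]_x (f_ n x)%:E)).
  rewrite -monotone_convergence//.
  - by apply: eq_integral => /= x _; apply/esym/cvg_lim => //; exact: f_cvg.
  - by move=> n; exact/measurable_EFinP/measurable_funTS.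
  - by move=> *; rewrite lee_fin.
  - by move=> x _ m n mn; rewrite lee_fin; exact/lefP/nd_nnsfun_approx.
under eq_fun do rewrite integral_density_nnsfun.
rewrite -monotone_convergence//.
- apply: eq_integral => /= x _; apply/cvg_lim => //.
  by apply: cvgeZr => //; exact: f_cvg.
- move=> n; apply: emeasurable_funM; last exact/measurable_EFinP.
  exact/measurable_EFinP/measurable_funTS.
- by move=> n x _; rewrite mule_ge0// lee_fin.
- move=> x _ m n mn; apply: lee_wpmul2r; rewrite ?lee_fin//.
  exact/lefP/nd_nnsfun_approx.
Qed.

End density.

(** * The one-dimensional Gaussian law and its moments *)

Section gauss1.
Context {R : realType}.
Local Notation M := (measurableTypeR R).
Local Notation leb := (@lebesgue_measure R).

(** The centred normal law of variance [nu^-1], retyped as a measure on [R] itself. *)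
Definition gauss1 (nu : R) : set R -> \bar R :=
  fun A => normal_prob 0 (Num.sqrt nu^-1) A.

Section instances.
Variable nu : R.

Let gauss1_0 : gauss1 nu set0 = 0%E. Proof. exact: measure0. Qed.

Let gauss1_ge0 A : (0 <= gauss1 nu A)%E. Proof. exact: measure_ge0. Qed.

Let gauss1_semi_sigma_additive : semi_sigma_additive (gauss1 nu).
Proof. exact: (@measure_semi_sigma_additive _ _ _ (normal_prob 0 (Num.sqrt nu^-1))). Qed.

HB.instance Definition _ := isMeasure.Build _ _ _ (gauss1 nu)
  gauss1_0 gauss1_ge0 gauss1_semi_sigma_additive.

Let gauss1T : gauss1 nu setT = 1%E.
Proof. exact: (@probability_setT _ _ _ (normal_prob 0 (Num.sqrt nu^-1))). Qed.

HB.instance Definition _ := Measure_isProbability.Build _ _ _ (gauss1 nu) gauss1T.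

End instances.

Lemma ge0_integral_gauss1 (nu : R) (f : R -> \bar R) : measurable_fun setT f ->
  (forall x, (0 <= f x)%E) ->
  (\int[gauss1 nu]_x f x =
   \int[leb]_x (f x * (normal_pdf 0 (Num.sqrt nu^-1) x)%:E))%E.
Proof.
move=> mf f0; pose h (x : M) : R := x.
have mh : measurable_fun setT h by exact: measurable_id.
transitivity (\int[pushforward (normal_prob 0 (Num.sqrt nu^-1)) h]_x f x)%E.
  by apply: eq_measure_integral => A mA _.
rewrite ge0_integral_pushforward//=.
have mf' : measurable_fun [set: M] (f : M -> \bar R) by exact: mf.
apply: (@integral_density _ M R leb (normal_prob 0 (Num.sqrt nu^-1))
  (normal_pdf 0 (Num.sqrt nu^-1)) _ _ _ f mf' f0) => //.
- exact: measurable_normal_pdf.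
- by move=> x; exact: normal_pdf_ge0.
Unshelve. all: exact: mh. Qed.

Lemma expX_le_fact_expR (u : R) m : 0 <= u -> u ^+ m <= m`!%:R * expR u.
Proof.
move=> u0; case: m => [|m].
  rewrite fact0 mul1r expr0; apply: le_trans (expR_ge1Dx u).
  by rewrite lerDl.
have := expR_ge1Dxn m u0; have f0 : 0 < m.+1`!%:R :> R by rewrite ltr0n fact_gt0.
move=> h; rewrite mulrC -ler_pdivrMr//; apply: le_trans h.
by rewrite lerDr ler01.
Qed.

Lemma absX_le_expR (m : nat) (e : R) : 0 < e ->
  exists2 K, 0 < K & forall x : R, `|x| ^+ m <= K * expR (e * x ^+ 2).
Proof.
(* From |x|^m <= 1 + x^(2m) and u^m <= m! exp u at u = e x^2. *)
move=> e0; exists (1 + e^-1 ^+ m * m`!%:R).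
  by rewrite ltr_pwDl// mulr_ge0// exprn_ge0// invr_ge0 ltW.
move=> x; have u0 : 0 <= e * x ^+ 2 by rewrite mulr_ge0 ?sqr_ge0// ltW.
have h1 : `|x| ^+ m <= 1 + (x ^+ 2) ^+ m.
  rewrite -real_normK ?num_real//; have [x1|/ltW x1] := leP `|x| 1.
    apply: (@le_trans _ _ 1); first exact: exprn_ile1.
    by rewrite lerDl exprn_ge0// exprn_ge0.
  rewrite -exprM mul2n -addnn exprD -[leLHS]add0r lerD//.
  by rewrite ler_peMr ?exprn_ge0// exprn_ege1.
apply: (le_trans h1); rewrite mulrDl lerD//.
  by rewrite mul1r (le_trans _ (expR_ge1Dx _))// lerDl.
rewrite -mulrA; apply: le_trans (ler_wpM2l _ (expX_le_fact_expR m u0)).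
  by rewrite -exprMn mulrA mulVf ?gt_eqF// mul1r.
by rewrite exprn_ge0// invr_ge0 ltW.
Qed.

(** The gap between the exponents of the centred normal densities of deviations 2 s and s, since 1/2
    - 1/8 = 3/8. *)
Lemma gauss_exponent_aux (s x : R) : s != 0 ->
  3 / (8 * s ^+ 2) * x ^+ 2 =
  - x ^+ 2 / ((2 * s) ^+ 2 *+ 2) - - x ^+ 2 / (s ^+ 2 *+ 2).
Proof.
move=> s0; have -> : (2 * s) ^+ 2 *+ 2 = 8 * s ^+ 2 by ring.
by rewrite -mulr_natl; field.
Qed.

(** The density of deviation [s], multiplied by [|x| ^+ m], is dominated by a constant times the
    density of deviation [2 * s], whose total mass is 1. *)
Lemma gauss1_moment (nu : R) (m : nat) : 0 < nu ->
  exists C : R, (\int[gauss1 nu]_x (`|x| ^+ m)%:E <= C%:E)%E.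
Proof.
move=> nu0; set s := Num.sqrt nu^-1.
have s_gt0 : 0 < s by rewrite sqrtr_gt0 invr_gt0.
have s0 : s != 0 by rewrite gt_eqF.
have s20 : 2 * s != 0 by rewrite mulf_neq0.
have e0 : 0 < 3 / (8 * s ^+ 2) by rewrite divr_gt0// mulr_gt0// exprn_gt0.
have [K K0 HK] := absX_le_expR m e0.
pose C := K * (normal_peak s / normal_peak (2 * s)).
have C0 : 0 <= C by rewrite mulr_ge0 ?ltW// divr_gt0// normal_peak_gt0.
have mX : measurable_fun setT (fun x : R => (`|x| ^+ m)%:E).
  by apply/measurable_EFinP; apply: measurable_funX; exact: normr_measurable.
exists C; rewrite ge0_integral_gauss1//.
rewrite -/s -[leRHS]mule1 -(integral_normal_pdf 0 (2 * s)) -ge0_integralZl//.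
- apply: ge0_le_integral => //.
  + by move=> x _; rewrite mule_ge0// lee_fin ?exprn_ge0 ?normal_pdf_ge0.
  + by apply: emeasurable_funM; [exact: mX|apply/measurable_EFinP; exact: measurable_normal_pdf].
  + by apply: emeasurable_funM => //; apply/measurable_EFinP; exact: measurable_normal_pdf.
  move=> x _; rewrite -!EFinM lee_fin !normal_pdfE// /normal_fun !subr0 /C.
  have p0 : normal_peak (2 * s) != 0 by rewrite gt_eqF// normal_peak_gt0.
  have -> : forall E : R, K * (normal_peak s / normal_peak (2 * s)) *
      (normal_peak (2 * s) * E) = normal_peak s * (K * E) by move=> E; field.
  rewrite mulrCA ler_wpM2l ?normal_peak_ge0// -ler_pdivlMr ?expR_gt0//.
  rewrite -expRN -mulrA -expRD; apply: le_trans (HK x) _.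
  rewrite ler_wpM2l ?(ltW K0)// ler_expR le_eqVlt; apply/orP; left; apply/eqP.
  exact: gauss_exponent_aux.
- by apply/measurable_EFinP; exact: measurable_normal_pdf.
- by move=> x _; rewrite lee_fin normal_pdf_ge0.
Qed.
End gauss1.

Section gauss_prod.
Context {R : realType}.
Local Notation M := (measurableTypeR R).
Local Notation leb := (@lebesgue_measure R).

Lemma gauss1_prodE (nu : R) (E : set (R * R)) : 0 < nu -> measurable E ->
  (gauss1 nu \x gauss1 nu)%E E = gauss2 nu E.
Proof.
move=> nu0 mE; pose h (x : M * M) : R * R := x.
have mh : measurable_fun setT h by exact: measurable_id.
pose m' : {measure set (R * R) -> \bar R} := pushforward (gauss2M nu) h.
rewrite (@product_measure_unique _ _ R R _ (gauss1 nu) (gauss1 nu) (m' nu0 mh))//.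
by move=> A B mA mB; apply: gauss2_rect.
Qed.

Lemma gauss1_prod_cayley (nu : R) tau (E : set (R * R)) : 0 < nu -> measurable E ->
  (gauss1 nu \x gauss1 nu)%E (cayley tau @^-1` E) = (gauss1 nu \x gauss1 nu)%E E.
Proof.
move=> nu0 mE; rewrite !gauss1_prodE//; first exact: gauss2_cayley.
rewrite -[X in measurable X]setTI.
exact: (@measurable_cayley R tau measurableT E mE).
Qed.

End gauss_prod.

(** * Rotations of two coordinates *)

(* A triad [x_i' = c x_k x_j], [x_j' = - c x_k x_i] of the vector field, with [x_k]
   frozen: its flow rotates the plane of coordinates [i] and [j]. *)
Record rot (R : realType) := Rot { ri : nat; rj : nat; rk : nat; rc : R }.

Definition rotwf R (r : rot R) :=
  [&& ri r != rj r, rk r != ri r & rk r != rj r].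

Section rotate.
Context {R : realType}.

Definition rtau (h : R) (r : rot R) (x : nat -> R) := h * rc r * x (rk r) / 2.

Definition rotate (h : R) (r : rot R) (x : nat -> R) : nat -> R :=
  let z := cayley (rtau h r x) (x (ri r), x (rj r)) in
  upd (upd x (ri r) z.1) (rj r) z.2.

Lemma measurable_rotate h r :
  measurable_fun setT (rotate h r : rseq -> rseq).
Proof.
apply: measurable_rseq => n.
have mt : measurable_fun setT (fun x : rseq => rtau h r x).
  rewrite /rtau; apply: measurable_funM => //; apply: measurable_funM => //.
  exact: measurable_coord.
have md : measurable_fun setT (fun x : rseq => (1 + rtau h r x ^+ 2)^-1).
  have ci : continuous (fun y : R => (1 + y ^+ 2)^-1).
    move=> y; apply: cvgV; first by rewrite gt_eqF// ltr_pwDl// sqr_ge0.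
    by apply: cvgD; [exact: cvg_cst|exact: sqr_continuous].
  exact: (measurableT_comp (continuous_measurable_fun ci) mt).
have m2 : measurable_fun setT (fun x : rseq => rtau h r x ^+ 2) by exact: measurable_funX.
rewrite /rotate /cayley /upd/=; case: eqP => _.
  apply: measurable_funM => //; apply: measurable_funB.
    by apply: measurable_funM; [exact: measurable_funB|exact: measurable_coord].
  by apply: measurable_funM; [exact: measurable_funM|exact: measurable_coord].
case: eqP => _; last exact: measurable_coord.
apply: measurable_funM => //; apply: measurable_funD.
  by apply: measurable_funM; [exact: measurable_funB|exact: measurable_coord].
by apply: measurable_funM; [exact: measurable_funM|exact: measurable_coord].
Qed.

Lemma rotate_upd h r x y z : rotwf r ->
  rotate h r (upd (upd x (ri r) y) (rj r) z) =
  let w := cayley (rtau h r x) (y, z) in upd (upd x (ri r) w.1) (rj r) w.2.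
Proof.
move=> /and3P[/negbTE ij /negbTE ki /negbTE kj].
apply/funext => n; rewrite /rotate /rtau /upd !eqxx ki kj ij.
by case: eqP => // _; case: eqP.
Qed.

Section invariance.
Variable (g : probability R R) (P : probability (@rseq R) R).
Hypothesis iidP : iid g P.
Variable gg : probability (R * R)%type R.
Hypothesis ggE : forall A B, measurable A -> measurable B ->
  gg (A `*` B) = (g A * g B)%E.
Variables i j : nat.
Hypothesis ij : i != j.

Let res (w : rseq * (R * R)) : rseq := upd (upd w.1 i w.2.1) j w.2.2.

Lemma measurable_resample : measurable_fun setT res.
Proof.
apply: measurable_rseq => n; rewrite /res /upd; case: eqP => _.
  exact: (measurableT_comp measurable_snd measurable_snd).
case: eqP => _.
  exact: (measurableT_comp measurable_fst measurable_snd).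
exact: (measurableT_comp (measurable_coord n) measurable_fst).
Qed.

(** Drawing the coordinates [i] and [j] anew, independently of the rest, leaves the law of an i.i.d.
    sequence unchanged. This disintegrates [P] along the plane of these two coordinates. *)
Lemma resample E : measurable E ->
  P E = (\int[P]_x gg [set yz | E (upd (upd x i yz.1) j yz.2)])%E.
Proof.
move=> mE.
transitivity (push_proba (P \x gg)%E measurable_resample E); last first.
  transitivity (product_measure1 P gg (res @^-1` E)); first by [].
  apply: eq_integral => x _; rewrite /comp.
  rewrite (_ : xsection _ x = [set yz | E (upd (upd x i yz.1) j yz.2)])//.
  by apply/seteqP; split=> yz /=; rewrite /xsection/= inE.
apply: rseq_proba_unique => // D A mA.
pose A1 n := if (n < D)%N then A n else setT.
have mA1 n : measurable (A1 n) by rewrite /A1; case: ifP.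
(* The cylinder is lengthened so that [i] and [j] are among its coordinates. *)
pose D' := (D + (i + j).+1)%N.
have -> : cylset D A = cylset D' A1.
  apply/seteqP; split=> x hx n nD; last first.
    by have := hx n (leq_trans nD (leq_addr _ _)); rewrite /A1 nD.
  by rewrite /A1; case: ifP => // nD'; exact: hx.
have iD : (i < D')%N by rewrite /D'; lia.
have jD : (j < D')%N by rewrite /D'; lia.
pose A2 n := if (n == i) || (n == j) then setT else A1 n.
have mA2 n : measurable (A2 n) by rewrite /A2; case: ifP.
have resE : res @^-1` (cylset D' A1) = cylset D' A2 `*` (A1 i `*` A1 j).
  apply/seteqP; split=> -[x [y z]]; rewrite /res/=.
    move=> h; split; [|split] => /=.
    - move=> n nD; rewrite /A2; case: ifPn => //; rewrite negb_or => /andP[ni nj].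
      by have := h n nD; rewrite /upd (negbTE ni) (negbTE nj).
    - by have := h i iD; rewrite /upd eqxx (negbTE ij).
    - by have := h j jD; rewrite /upd eqxx.
  move=> [/= h [/= hy hz]] n nD; rewrite /upd.
  case: eqP => [->//|/eqP nj]; case: eqP => [->//|/eqP ni].
  by have := h n nD; rewrite /A2 (negbTE ni) (negbTE nj).
have mc : measurable (cylset D' A2 : set rseq) by exact: measurable_cylset.
have mX : measurable (A1 i `*` A1 j) by exact: measurableX.
have E1 : ((P \x gg) (cylset D' A2 `*` (A1 i `*` A1 j)) =
    P (cylset D' A2) * gg (A1 i `*` A1 j))%E by exact: product_measure1E.
transitivity (P (cylset D' A2) * (g (A1 i) * g (A1 j)))%E; last first.
  by rewrite -ggE// -[LHS]E1 -resE.
rewrite !iidP//.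
have ji : Ordinal jD != Ordinal iD by rewrite -val_eqE/= eq_sym.
rewrite (bigD1 (Ordinal iD))//= (bigD1 (Ordinal jD))//=.
rewrite [in RHS](bigD1 (Ordinal iD))//= [in RHS](bigD1 (Ordinal jD))//=.
rewrite {1 2}/A2 !eqxx orbT/= !probability_setT !mul1e muleA [RHS]muleC; congr (_ * _)%E.
apply: eq_bigr => n /andP[ni nj]; rewrite /A2.
by rewrite -!val_eqE/= in ni nj; rewrite (negbTE ni) (negbTE nj).
Qed.

End invariance.

(** After resampling, the angle is constant in the inner integral, where the planar Gaussian is
    invariant under rotations. *)
Lemma rotate_invariant (nu h : R) (r : rot R) (P : probability rseq R) (E : set rseq) :
  0 < nu -> iid (gauss1 nu) P -> rotwf r -> measurable E ->
  P (rotate h r @^-1` E) = P E.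
Proof.
move=> nu0 iidP wf mE; have /and3P[ij ki kj] := wf.
have mrE : measurable (rotate h r @^-1` E : set rseq).
  by rewrite -[X in measurable X]setTI; exact: (measurable_rotate h r measurableT).
pose gg : probability (R * R)%type R := (gauss1 nu \x gauss1 nu)%E.
have ggE A B : measurable A -> measurable B ->
    gg (A `*` B) = (gauss1 nu A * gauss1 nu B)%E by exact: product_measure1E.
rewrite (resample iidP ggE ij mrE) (resample iidP ggE ij mE).
apply: eq_integral => x _.
have mu : measurable_fun setT (fun yz : R * R => upd (upd x (ri r) yz.1) (rj r) yz.2 : rseq).
  apply: measurable_rseq => n; rewrite /upd; case: eqP => _; first exact: measurable_snd.
  by case: eqP => _ //; exact: measurable_fst.
have mEx : measurable [set yz | E (upd (upd x (ri r) yz.1) (rj r) yz.2)].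
  by rewrite -[X in measurable X]setTI; exact: (mu measurableT).
rewrite -[RHS](gauss1_prod_cayley (rtau h r x) nu0 mEx).
by congr (product_measure1 _ _ _); apply/seteqP; split=> -[y z] /=; rewrite rotate_upd.
Qed.

End rotate.

(** * Estimates for a single rotation *)

Section cayley_bounds.
Context {R : realType}.
Implicit Types t a b : R.

(** The first component of [cayley]; the second one is the same expression with [- t] for [t] and
    the coordinates exchanged. *)
Let cay t a b := ((1 - t ^+ 2) * a + 2 * t * b) / (1 + t ^+ 2).

Let den_gt0 t : 0 < 1 + t ^+ 2. Proof. by rewrite ltr_pwDl// sqr_ge0. Qed.

Lemma cay_bound t a b : `|cay t a b| <= `|a| + `|b|.
Proof.
rewrite /cay normrM normfV (gtr0_norm (den_gt0 t)) ler_pdivrMr//.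
apply: (le_trans (ler_normD _ _)); rewrite [leRHS]mulrDl; apply: lerD; rewrite !normrM.
  rewrite mulrC ler_wpM2l//; apply: (le_trans (ler_normB _ _)).
  by rewrite normr1 normrX real_normK ?num_real.
rewrite mulrC ler_wpM2l// (@ger0_norm _ 2)//.
rewrite -real_normK ?num_real//; have := sqr_ge0 (`|t| - 1); nra.
Qed.

Lemma cay_diff t a b : `|cay t a b - a| <= 2 * `|t| * (`|a| + `|b|).
Proof.
have -> : cay t a b - a = (2 * t * b - 2 * t ^+ 2 * a) / (1 + t ^+ 2).
  by rewrite /cay; field; rewrite gt_eqF.
rewrite normrM normfV (gtr0_norm (den_gt0 t)) ler_pdivrMr//.
apply: (le_trans (ler_normB _ _)); rewrite !normrM (@ger0_norm _ 2)//.
rewrite -[t ^+ 2 in leRHS]real_normK ?num_real//.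
have := normr_ge0 t; have := normr_ge0 a; have := normr_ge0 b.
move: `|t| `|a| `|b| => T A B B0 A0 T0.
have h1 : 0 <= T * A * (T - 1) ^+ 2 by apply: mulr_ge0; [exact: mulr_ge0|exact: sqr_ge0].
have h2 : 0 <= T * B * T ^+ 2 by apply: mulr_ge0; [exact: mulr_ge0|exact: sqr_ge0].
have h3 : 0 <= T * A * T ^+ 2 by apply: mulr_ge0; [exact: mulr_ge0|exact: sqr_ge0].
have h4 : 0 <= T * A by rewrite mulr_ge0.
by nra.
Qed.

Lemma cay_consistent t a b : `|cay t a b - a - 2 * t * b| <= 2 * t ^+ 2 * (`|a| + `|b|).
Proof.
have -> : cay t a b - a - 2 * t * b = - (2 * t ^+ 2) * ((a + t * b) / (1 + t ^+ 2)).
  by rewrite /cay; field; rewrite gt_eqF.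
have t2 : 0 <= 2 * t ^+ 2 by apply: mulr_ge0 => //; exact: sqr_ge0.
rewrite normrM normrN (ger0_norm t2) ler_wpM2l// normrM normfV (gtr0_norm (den_gt0 t)).
rewrite ler_pdivrMr//; apply: (le_trans (ler_normD _ _)).
rewrite normrM [leRHS]mulrDl lerD//.
  by rewrite mulrDr mulr1 lerDl; apply: mulr_ge0 => //; exact: sqr_ge0.
rewrite mulrC ler_wpM2l//.
by rewrite -(real_normK (num_real t)); have := sqr_ge0 (`|t| - 1); nra.
Qed.

End cayley_bounds.

Lemma normX_diff (R : realType) (x y W : R) m : `|x| <= W -> `|y| <= W ->
  `| `|y| ^+ m.+1 - `|x| ^+ m.+1 | <= m.+1%:R * `|y - x| * W ^+ m.
Proof.
move=> xW yW; rewrite subrXX normrM.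
apply: (@le_trans _ _ (`|y - x| * \sum_(i < m.+1) W ^+ m)).
  apply: ler_pM => //; first by rewrite ler_dist_dist.
  apply: (le_trans (ler_norm_sum _ _ _)); apply: ler_sum => i _.
  rewrite normrM !normrX !normr_id.
  have -> : W ^+ m = W ^+ (m - i) * W ^+ i by rewrite -exprD subnK// -ltnS.
  have W0 : 0 <= W by apply: le_trans xW.
  by rewrite /= ler_pM ?exprn_ge0// lerXn2r ?nnegrE.
by rewrite sumr_const card_ord mulrnAr -mulr_natl mulrA.
Qed.

Section step.
Context {R : realType}.
Implicit Types (r : rot R) (x z : nat -> R) (h : R).

Definition aff r n := (n == ri r) || (n == rj r).

(** The [n]-th component of the vector field of the triad [r] at [z]. *)
Definition contr r n z : R :=
  if n == ri r then rc r * z (rk r) * z (rj r)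
  else if n == rj r then - (rc r * z (rk r) * z (ri r)) else 0.

Definition rotW r x := `|x (ri r)| + `|x (rj r)| + `|x (rk r)|.

Lemma rotate_naff h r x n : ~~ aff r n -> rotate h r x n = x n.
Proof.
by rewrite /aff negb_or => /andP[/negbTE ni /negbTE nj]; rewrite /rotate/= /upd nj ni.
Qed.

Lemma contr_naff r z n : ~~ aff r n -> contr r n z = 0.
Proof.
by rewrite /aff negb_or => /andP[/negbTE ni /negbTE nj]; rewrite /contr ni nj.
Qed.

Lemma rotate_ri h r x : rotwf r -> rotate h r x (ri r) =
  ((1 - rtau h r x ^+ 2) * x (ri r) + 2 * rtau h r x * x (rj r)) / (1 + rtau h r x ^+ 2).
Proof. by move=> /and3P[/negbTE ij _ _]; rewrite /rotate/= /upd ij eqxx. Qed.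

Lemma rotate_rj h r x : rotate h r x (rj r) =
  ((1 - (- rtau h r x) ^+ 2) * x (rj r) + 2 * (- rtau h r x) * x (ri r)) /
    (1 + (- rtau h r x) ^+ 2).
Proof. by rewrite /rotate/= /upd eqxx sqrrN mulrN mulNr. Qed.

Lemma rtau2 h r x : 0 <= h -> 2 * `|rtau h r x| = h * `|rc r| * `|x (rk r)|.
Proof.
move=> h0; rewrite /rtau !normrM (ger0_norm h0) normfV (@ger0_norm _ 2)//.
by rewrite mulrC divfK.
Qed.

Lemma step_diff h r x n : 0 <= h -> rotwf r -> aff r n ->
  `|rotate h r x n - x n| <= h * `|rc r| * `|x (rk r)| * (`|x (ri r)| + `|x (rj r)|).
Proof.
move=> h0 wf; rewrite -rtau2// => /orP[/eqP->|/eqP->].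
  by rewrite rotate_ri//; exact: cay_diff.
rewrite rotate_rj [_ + `|x (rj r)|]addrC -[`|rtau h r x|]normrN.
exact: cay_diff.
Qed.

Lemma step_bound h r x n : rotwf r -> aff r n ->
  `|rotate h r x n| <= `|x (ri r)| + `|x (rj r)|.
Proof.
move=> wf /orP[/eqP->|/eqP->]; first by rewrite rotate_ri//; exact: cay_bound.
by rewrite rotate_rj [leRHS]addrC; exact: cay_bound.
Qed.

Lemma step_consistent h r x n : 0 <= h -> rotwf r -> aff r n ->
  `|rotate h r x n - x n - h * contr r n x| <=
  2 * rtau h r x ^+ 2 * (`|x (ri r)| + `|x (rj r)|).
Proof.
move=> h0 wf; have /and3P[/negbTE ij _ _] := wf.
move=> /orP[/eqP->|/eqP->].
  rewrite rotate_ri// /contr eqxx.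
  have -> : h * (rc r * x (rk r) * x (rj r)) = 2 * rtau h r x * x (rj r).
    by rewrite /rtau; field.
  exact: cay_consistent.
rewrite rotate_rj /contr eq_sym ij eqxx.
have -> : h * - (rc r * x (rk r) * x (ri r)) = 2 * (- rtau h r x) * x (ri r).
  by rewrite /rtau; field.
rewrite -[rtau h r x ^+ 2 in leRHS]sqrrN [_ + `|x (rj r)|]addrC.
exact: cay_consistent.
Qed.

(** With W = [rotW r x], the displacement is at most h |c| W^2 and the slope of the power at most (m
    + 1) W^m. *)
Lemma step_moment h r x n m : 0 <= h -> rotwf r -> aff r n ->
  `| `|rotate h r x n| ^+ m.+1 - `|x n| ^+ m.+1 | <=
  m.+1%:R * (h * `|rc r|) * rotW r x ^+ m.+2.
Proof.
move=> h0 wf an.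
have sW : `|x (ri r)| + `|x (rj r)| <= rotW r x by rewrite /rotW lerDl.
have W0 : 0 <= rotW r x by rewrite !addr_ge0.
apply: (le_trans (normX_diff (W := rotW r x) m _ _)).
- apply: le_trans sW; case/orP : an => /eqP->; [by rewrite lerDl|by rewrite lerDr].
- exact: le_trans (step_bound h x wf an) sW.
rewrite -!mulrA ler_wpM2l// exprSr exprSr -[in leRHS]mulrA.
rewrite [_ ^+ m * _]mulrC !mulrA ler_wpM2r ?exprn_ge0//.
apply: (le_trans (step_diff x h0 wf an)).
rewrite -[leLHS]mulrA -[leRHS]mulrA ler_wpM2l ?mulr_ge0// ler_pM ?addr_ge0//.
by rewrite /rotW lerDr addr_ge0.
Qed.

End step.

(** * Sequences of rotations *)

Lemma block_sum (R : realType) (f : nat -> R) (ell k0 k1 : nat) (B : R) :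
  (forall k, \sum_(ell * k <= l < ell * k.+1) f l = B) -> (k0 <= k1)%N ->
  \sum_(ell * k0 <= l < ell * k1) f l = (k1 - k0)%:R * B.
Proof.
move=> fB; elim: k1 => [|k1 IH]; first by rewrite leqn0 => /eqP ->; rewrite big_geq// subnn mul0r.
rewrite leq_eqVlt => /orP[/eqP->|]; first by rewrite big_geq// subnn mul0r.
rewrite ltnS => kk; rewrite (big_cat_nat (n := (ell * k1)%N)) ?leq_mul2l ?kk ?leqnSn ?orbT//=.
by rewrite IH// fB subSn// -natr1 mulrDl mul1r.
Qed.

Section window.
Context {R : realType}.
Variables (h : R) (rr : nat -> rot R) (s : nat -> nat -> R).
Hypotheses (h0 : 0 <= h) (wf : forall l, rotwf (rr l))
  (sE : forall q, s q.+1 = rotate h (rr q) (s q)).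
Variable n : nat.

Local Notation indic l := ((aff (rr l) n)%:R : R).

Lemma step_moment_indic l m :
  `| `|s l.+1 n| ^+ m.+1 - `|s l n| ^+ m.+1 | <=
  indic l * (m.+1%:R * (h * `|rc (rr l)|) * rotW (rr l) (s l) ^+ m.+2).
Proof.
rewrite sE; have [an|nan] := boolP (aff (rr l) n); first by rewrite mul1r step_moment.
by rewrite rotate_naff// subrr normr0 mul0r.
Qed.

(** Initial value plus total variation: the right side is the same for all [q] in the window, and
    each of its terms involves the state at a single index [l], so that its mean can be read off
    from the invariant law. *)
Lemma sup_moment m q0 q1 q : (q0 <= q <= q1)%N ->
  `|s q n| ^+ m.+1 <= `|s q0 n| ^+ m.+1 +
    \sum_(q0 <= l < q1) indic l * (m.+1%:R * (h * `|rc (rr l)|) * rotW (rr l) (s l) ^+ m.+2).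
Proof.
move=> /andP[q0q qq1].
have t0 l : 0 <= indic l * (m.+1%:R * (h * `|rc (rr l)|) * rotW (rr l) (s l) ^+ m.+2).
  apply: mulr_ge0 => //; apply: mulr_ge0; first by rewrite !mulr_ge0.
  by apply: exprn_ge0; rewrite !addr_ge0.
apply: (@le_trans _ _ (`|s q0 n| ^+ m.+1 +
    \sum_(q0 <= l < q) indic l * (m.+1%:R * (h * `|rc (rr l)|) * rotW (rr l) (s l) ^+ m.+2))).
  rewrite -lerBlDl -(telescope_sumr (fun l => `|s l n| ^+ m.+1))//.
  apply: ler_sum => l _; apply: le_trans (step_moment_indic l m).
  exact: ler_norm.
by rewrite lerD2l (big_cat_nat (n := q) (m := q0) (p := q1))//= lerDl sumr_ge0.
Qed.

(** [ell] rotations form one time step, [kappa] bounds the total rate with which one time step acts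
    on coordinate [n], and [A] bounds the coordinates involved. *)
Variables (ell k0 k1 : nat) (kappa A : R).
Hypotheses (k01 : (k0 <= k1)%N) (kappaE : forall k,
  \sum_(ell * k <= l < ell * k.+1) indic l * `|rc (rr l)| <= kappa).
Hypothesis sA : forall l, (ell * k0 <= l <= ell * k1)%N -> aff (rr l) n ->
  [/\ `|s l (ri (rr l))| <= A, `|s l (rj (rr l))| <= A & `|s l (rk (rr l))| <= A].

Let window_ind l := (ell * k0 <= l <= ell * k1)%N.

Lemma block_sum_kappa :
  \sum_(ell * k0 <= l < ell * k1) indic l * `|rc (rr l)| <= (k1 - k0)%:R * kappa.
Proof.
elim: (k1) k01 => [|k IH]; first by rewrite leqn0 => /eqP ->; rewrite big_geq// subnn mul0r.
rewrite leq_eqVlt => /orP[/eqP->|]; first by rewrite big_geq// subnn mul0r.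
rewrite ltnS => kk; rewrite (big_cat_nat (n := (ell * k)%N)) ?leq_mul2l ?kk ?leqnSn ?orbT//=.
by rewrite subSn// -natr1 mulrDl mul1r lerD// IH.
Qed.

Lemma window_step l : window_ind l ->
  `|s l.+1 n - s l n| <= indic l * `|rc (rr l)| * (h * (2 * A ^+ 2)).
Proof.
move=> wl; rewrite sE; have [an|nan] := boolP (aff (rr l) n); last first.
  by rewrite rotate_naff// subrr normr0 !mul0r.
have [iA jA kA] := sA wl an; rewrite mul1r.
apply: (le_trans (step_diff _ h0 (wf l) an)).
rewrite [h * _]mulrC -!mulrA ler_wpM2l// ler_wpM2l//.
have A0 : 0 <= A by exact: le_trans iA.
apply: (@le_trans _ _ (A * (A + A))).
  by rewrite ler_pM ?addr_ge0// lerD.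
by rewrite le_eqVlt; apply/orP; left; apply/eqP; ring.
Qed.

Lemma window_diff_le q q' : (ell * k0 <= q)%N -> (q <= q')%N -> (q' <= ell * k1)%N ->
  `|s q' n - s q n| <= (k1 - k0)%:R * kappa * (h * (2 * A ^+ 2)).
Proof.
move=> kq qq qk; rewrite -(telescope_sumr (fun l => s l n))//.
apply: (le_trans (ler_norm_sum _ _ _)).
apply: (@le_trans _ _ (\sum_(ell * k0 <= l < ell * k1)
    indic l * `|rc (rr l)| * (h * (2 * A ^+ 2)))); last first.
  rewrite -mulr_suml ler_wpM2r ?block_sum_kappa//.
  by apply: mulr_ge0 => //; apply: mulr_ge0 => //; exact: sqr_ge0.
have t0 l : 0 <= indic l * `|rc (rr l)| * (h * (2 * A ^+ 2)).
  by apply: mulr_ge0; apply: mulr_ge0 => //; apply: mulr_ge0 => //; exact: sqr_ge0.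
rewrite (big_cat_nat (leq_trans kq qq) qk)/= (big_cat_nat kq qq)/=.
rewrite -[leLHS]addr0 -[leLHS]add0r addrA.
rewrite lerD// ?sumr_ge0// lerD// ?sumr_ge0//.
apply: ler_sum_nat => l /andP[ql lq]; apply: window_step; rewrite /window_ind.
by rewrite (leq_trans kq ql) (leq_trans (ltnW lq) qk).
Qed.

Lemma window_diff q q' : (ell * k0 <= q <= ell * k1)%N -> (ell * k0 <= q' <= ell * k1)%N ->
  `|s q' n - s q n| <= (k1 - k0)%:R * kappa * (h * (2 * A ^+ 2)).
Proof.
move=> /andP[h1 h2] /andP[h3 h4]; have [qq|/ltnW qq] := leqP q q'; last rewrite distrC.
  exact: window_diff_le.
exact: window_diff_le.
Qed.

Variables (z : nat -> R) (delta F : R).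
Hypothesis FE : forall k, \sum_(ell * k <= l < ell * k.+1) contr (rr l) n z = F.
Hypothesis zA : forall l, (ell * k0 <= l <= ell * k1)%N -> aff (rr l) n ->
  [/\ `|z (ri (rr l))| <= A, `|z (rj (rr l))| <= A & `|z (rk (rr l))| <= A].
Hypothesis sz : forall l, (ell * k0 <= l <= ell * k1)%N -> aff (rr l) n ->
  [/\ `|s l (ri (rr l)) - z (ri (rr l))| <= delta,
      `|s l (rj (rr l)) - z (rj (rr l))| <= delta &
      `|s l (rk (rr l)) - z (rk (rr l))| <= delta].
Hypothesis ck : forall l, aff (rr l) n -> `|rc (rr l)| <= kappa.

Let prod_diff (a b c d : R) : `|a| <= A -> `|b| <= A -> `|c| <= A -> `|d| <= A ->
  `|a - c| <= delta -> `|b - d| <= delta -> `|a * b - c * d| <= 2 * A * delta.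
Proof.
move=> aA bA cA dA ac bd.
have -> : a * b - c * d = (a - c) * b + c * (b - d) by ring.
apply: (le_trans (ler_normD _ _)); rewrite !normrM.
have -> : 2 * A * delta = delta * A + A * delta by ring.
by rewrite lerD// ler_pM.
Qed.

Lemma contr_diff l : window_ind l -> aff (rr l) n ->
  `|contr (rr l) n (s l) - contr (rr l) n z| <= `|rc (rr l)| * (2 * A * delta).
Proof.
move=> wl an; have [iA jA kA] := sA wl an; have [iz jz kz] := zA wl an.
have [id jd kd] := sz wl an; rewrite /contr.
move: an; rewrite /aff; case: eqP => [_ _|_ /= ->].
  by rewrite -[rc _ * s l _ * _]mulrA -[rc _ * z _ * _]mulrA -mulrBr normrM ler_wpM2l// prod_diff.
rewrite -opprD normrN -[rc _ * s l _ * _]mulrA -[rc _ * z _ * _]mulrA -mulrBr normrM.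
by rewrite ler_wpM2l// prod_diff.
Qed.

(** Two errors: replacing the current state by the reference point [z] costs 2 A delta, and the
    rotation differs from the Euler step of its triad by h kappa A^3, both times h |c|. *)
Lemma window_step_consistent l : window_ind l ->
  `|s l.+1 n - s l n - h * contr (rr l) n z| <=
  indic l * `|rc (rr l)| * (h * (2 * A * delta + h * kappa * A ^+ 3)).
Proof.
move=> wl; rewrite sE; have [an|nan] := boolP (aff (rr l) n); last first.
  by rewrite rotate_naff// contr_naff// subrr mulr0 subr0 normr0 !mul0r.
have [iA jA kA] := sA wl an; rewrite mul1r.
have A0 : 0 <= A by exact: le_trans iA.
have c0 : 0 <= `|rc (rr l)| by [].
have h1 := step_consistent (s l) h0 (wf l) an.
have h2 := contr_diff wl an.
have -> : rotate h (rr l) (s l) n - s l n - h * contr (rr l) n z =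
  (rotate h (rr l) (s l) n - s l n - h * contr (rr l) n (s l)) +
   h * (contr (rr l) n (s l) - contr (rr l) n z) by ring.
apply: (le_trans (ler_normD _ _)).
have -> : `|rc (rr l)| * (h * (2 * A * delta + h * kappa * A ^+ 3)) =
  h * (`|rc (rr l)| * (h * kappa * A ^+ 3)) + h * (`|rc (rr l)| * (2 * A * delta)).
  by ring.
apply: lerD; last by rewrite normrM (ger0_norm h0) ler_wpM2l.
apply: (le_trans h1).
have t2 : 2 * `|rtau h (rr l) (s l)| <= h * `|rc (rr l)| * A.
  by rewrite rtau2// ler_wpM2l// mulr_ge0.
apply: (@le_trans _ _ (2 * rtau h (rr l) (s l) ^+ 2 * (A + A))).
  by rewrite ler_wpM2l ?lerD//; apply: mulr_ge0 => //; exact: sqr_ge0.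
rewrite -(real_normK (num_real (rtau _ _ _))).
set t := `|_| in t2 *; have t0 : 0 <= t by exact: normr_ge0.
have tt : (2 * t) ^+ 2 <= (h * `|rc (rr l)| * A) ^+ 2.
  by apply: lerXn2r => //; rewrite nnegrE !mulr_ge0.
have -> : 2 * t ^+ 2 * (A + A) = (2 * t) ^+ 2 * A by ring.
apply: (@le_trans _ _ ((h * `|rc (rr l)| * A) ^+ 2 * A)); first by rewrite ler_wpM2r.
have -> : (h * `|rc (rr l)| * A) ^+ 2 * A = h ^+ 2 * `|rc (rr l)| * A ^+ 3 * `|rc (rr l)|.
  by ring.
have -> : h * (`|rc (rr l)| * (h * kappa * A ^+ 3)) = h ^+ 2 * `|rc (rr l)| * A ^+ 3 * kappa.
  by ring.
rewrite ler_wpM2l ?ck//; apply: mulr_ge0; last exact: exprn_ge0.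
by apply: mulr_ge0 => //; exact: sqr_ge0.
Qed.

(** [F] is the full vector field at [z], summed over one block: although the triads act one after
    the other, the scheme stays close to the Euler step of their sum. *)
Lemma window_consistent :
  0 <= delta -> 0 <= kappa -> 0 <= A ->
  `|s (ell * k1)%N n - s (ell * k0)%N n - (k1 - k0)%:R * h * F| <=
  (k1 - k0)%:R * kappa * (h * (2 * A * delta + h * kappa * A ^+ 3)).
Proof.
move=> d0 kap0 A0.
have kk : (ell * k0 <= ell * k1)%N by rewrite leq_mul2l k01 orbT.
rewrite -(telescope_sumr (fun l => s l n))// mulrAC -(block_sum FE k01) mulr_suml.
rewrite -sumrB; apply: (le_trans (ler_norm_sum _ _ _)).
apply: (@le_trans _ _ (\sum_(ell * k0 <= l < ell * k1)
    indic l * `|rc (rr l)| * (h * (2 * A * delta + h * kappa * A ^+ 3)))).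
  apply: ler_sum_nat => l /andP[l1 l2]; rewrite [contr _ _ _ * h]mulrC.
  by apply: window_step_consistent; rewrite /window_ind l1 ltnW.
rewrite -mulr_suml ler_wpM2r ?block_sum_kappa//.
apply: mulr_ge0 => //; apply: addr_ge0; first by rewrite !mulr_ge0.
by apply: mulr_ge0; [exact: mulr_ge0|exact: exprn_ge0].
Qed.

End window.

(** * Triads of the SABRA model *)

Section sabra.
Context {R : realType}.
Variables (k0 lam a b : R).

(* [p], [q], [r] are the real (1) and imaginary (2) parts of the complex coordinates
   [mu], [mu + 1], [mu + 2] (counted from 0); the triads are the terms of [- B]
   in which exactly these three coordinates interact. *)
Definition triad (mu e : nat) : rot R :=
  let K := kn k0 lam mu.+2 in
  let p1 := mu.*2 in let p2 := mu.*2.+1 in let q1 := mu.*2.+2 in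
  let q2 := mu.*2.+3 in let r1 := mu.*2.+4 in let r2 := mu.*2.+4.+1 in
  match e with
  | 0 => Rot p1 r1 q2 (a * K)
  | 1 => Rot p1 r2 q1 (- (a * K))
  | 2 => Rot p2 r1 q1 (a * K)
  | 3 => Rot p2 r2 q2 (a * K)
  | 4 => Rot q1 r1 p2 (b * K)
  | 5 => Rot q1 r2 p1 (- (b * K))
  | 6 => Rot q2 r1 p1 (b * K)
  | _ => Rot q2 r2 p2 (b * K)
  end.

Lemma triad_wf mu e : rotwf (triad mu e).
Proof. by case: e => [|[|[|[|[|[|[|e]]]]]]]; rewrite /rotwf/=; lia. Qed.

(** A triad occupies the six consecutive real coordinates from [2 mu] to [2 mu + 5], so it reaches
    at most five beyond any coordinate that it moves. *)
Lemma triad_range mu e n : aff (triad mu e) n ->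
  [/\ (mu <= n./2)%N, (ri (triad mu e) <= n + 5)%N, (rj (triad mu e) <= n + 5)%N
    & (rk (triad mu e) <= n + 5)%N].
Proof.
case: e => [|[|[|[|[|[|[|e]]]]]]]; rewrite /aff/= => /orP[/eqP->|/eqP->];
  split; lia.
Qed.

(* One time step runs through the triads with [mu < N]: it takes [8 * N] rotations. *)
Definition sched (N l : nat) : rot R := triad ((l %% (8 * N)) %/ 8) (l %% 8).

Lemma sched_wf N l : rotwf (sched N l). Proof. exact: triad_wf. Qed.

Lemma sched_block (f : rot R -> R) N k :
  \sum_(8 * N * k <= l < 8 * N * k.+1) f (sched N l) =
  \sum_(mu < N) \sum_(e < 8) f (triad mu e).
Proof.
have -> : (8 * N * k.+1 = 8 * N + 8 * N * k)%N by lia.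
rewrite -{1}[(8 * N * k)%N]add0n big_addn addnK.
transitivity (\sum_(0 <= l < 8 * N) f (triad (l %/ 8) (l %% 8))).
  apply: eq_big_nat => l /andP[_ lN]; rewrite /sched; congr (f (triad _ _)).
    by rewrite addnC [(8 * N * k)%N]mulnC modnMDl modn_small.
  by rewrite -mulnA addnC [(8 * (N * k))%N]mulnC modnMDl.
elim: N => [|N IH]; first by rewrite muln0 big_geq// big_ord0.
rewrite (big_cat_nat (n := (8 * N)%N))//=; last by lia.
rewrite big_ord_recr/= IH; congr (_ + _).
have -> : (8 * N.+1 = 8 + 8 * N)%N by lia.
rewrite -{1}[(8 * N)%N]add0n big_addn addnK big_mkord.
apply: eq_bigr => e _; congr (f (triad _ _)).
  by rewrite mulnC divnDMl// divn_small.
by rewrite mulnC addnC modnMDl modn_small.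
Qed.

(** The terms with [mu > n./2] vanish; with [mu <= n] all terms belong to a block as soon as
    [n < N]. *)
Definition drift (n : nat) (z : nat -> R) : R :=
  \sum_(mu < n.+1) \sum_(e < 8) contr (triad mu e) n z.

Lemma contr_triad_far mu e n z : (n./2 < mu)%N -> contr (triad mu e) n z = 0.
Proof.
move=> nmu; apply: contr_naff; apply/negP => /triad_range[].
by rewrite leqNgt nmu.
Qed.

Lemma drift_sum n N k z : (n < N)%N ->
  \sum_(8 * N * k <= l < 8 * N * k.+1) contr (sched N l) n z = drift n z.
Proof.
move=> nN; rewrite (sched_block (fun r => contr r n z)) /drift.
rewrite -(big_mkord xpredT (fun mu => \sum_(e < 8) contr (triad mu e) n z)).
rewrite (big_cat_nat (n := n.+1))//= big_mkord [X in _ + X]big_nat_cond.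
rewrite [X in _ + X]big1 ?addr0// => mu /andP[/andP[nmu _] _].
by apply: big1 => e _; apply: contr_triad_far; lia.
Qed.

Definition shells (z : nat -> R) : nat -> cplx R := fun m => (z m.*2, z m.*2.+1).

Lemma contr_triad_past mu e n z : (mu.*2 + 5 < n)%N -> contr (triad mu e) n z = 0.
Proof.
move=> nmu; apply: contr_naff; apply/negP.
by case: e => [|[|[|[|[|[|[|e]]]]]]]; rewrite /aff/=; lia.
Qed.

Let S8 (mu n : nat) z := \sum_(e < 8) contr (triad mu e) n z.

(** Shell [m] takes part only in the triads that start at the shells [m - 2], [m - 1] and [m], as
    far as these exist. *)
Lemma drift_cut n m z : (m = n./2)%N ->
  drift n z = (if m is m'.+2 then S8 m' n z else 0) +
              (if m is m'.+1 then S8 m' n z else 0) + S8 m n z.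
Proof.
move=> mE; rewrite /drift -(big_mkord xpredT (fun mu => S8 mu n z)).
rewrite (big_cat_nat (n := m.+1))//=; last by rewrite mE; lia.
rewrite [X in _ + X]big_nat_cond [X in _ + X]big1 ?addr0; last first.
  by move=> mu /andP[/andP[nmu _] _]; apply: big1 => e _; apply: contr_triad_far; lia.
rewrite big_nat_recr//=; congr (_ + _).
case: m mE => [|m] mE; first by rewrite big_geq// addr0.
rewrite big_nat_recr//=; congr (_ + _).
case: m mE => [|m] mE; first by rewrite big_geq.
rewrite big_nat_recr//= big_nat_cond big1 ?add0r// => mu /andP[/andP[_ mum] _].
by apply: big1 => e _; apply: contr_triad_past; lia.
Qed.

Ltac decide_ifs := repeat match goal with |- context [if ?c then _ else _] =>
  first [have -> : c = true by lia | have -> : c = false by lia] end.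

Lemma drift_re m z : drift m.*2 z = - (Defs.Bseq k0 lam a b (shells z) (shells z) m).1.
Proof.
rewrite (@drift_cut _ m) ?doubleK// /S8.
case: m => [|[|m]]; rewrite !big_ord_recr !big_ord0/= /contr/= /Defs.Bseq /Bn /shells /=;
  rewrite /cmulmI /cadd /cscale /cmul /cconj /c0 /= ?subn1 ?subn2 /= ?doubleS.
- by ring.
- by ring.
- by decide_ifs; ring.
Qed.

Lemma drift_im m z : drift m.*2.+1 z = - (Defs.Bseq k0 lam a b (shells z) (shells z) m).2.
Proof.
rewrite (@drift_cut _ m); last by lia.
rewrite /S8.
case: m => [|[|m]]; rewrite !big_ord_recr !big_ord0/= /contr/= /Defs.Bseq /Bn /shells /=;
  rewrite /cmulmI /cadd /cscale /cmul /cconj /c0 /= ?subn1 ?subn2 /= ?doubleS.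
- by ring.
- by ring.
- by decide_ifs; ring.
Qed.

(** Eight triads for each [mu], with rates at most (|a| + |b|) k_(mu+2), summed over [mu <= n./2];
    the factor [lam / (lam - 1)] comes from the geometric series. As [n./2] is the shell of
    coordinate [n], this grows like its wave number. *)
Definition kap (n : nat) : R :=
  8 * (`|a| + `|b|) * k0 * lam ^+ 2 * (lam / (lam - 1)) * lam ^+ n./2.

Lemma kapE n : kap n = kap 0 * lam ^+ n./2.
Proof. by rewrite /kap expr0 mulr1. Qed.

Hypotheses (hk0 : 0 < k0) (hlam : 1 < lam).

Lemma kn_gt0 j : 0 < kn k0 lam j.
Proof. by rewrite mulr_gt0// exprn_gt0// (lt_trans ltr01). Qed.

Lemma triad_rc mu e : `|rc (triad mu e)| <= (`|a| + `|b|) * kn k0 lam mu.+2.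
Proof.
have K0 := ltW (kn_gt0 mu.+2).
case: e => [|[|[|[|[|[|[|e]]]]]]]; rewrite ?normrN /rc normrM (ger0_norm K0) ler_wpM2r//;
  by rewrite ?lerDl ?lerDr.
Qed.

Let lam0 : 0 < lam. Proof. by rewrite (lt_trans ltr01). Qed.
Let lam1 : 0 < lam - 1. Proof. by rewrite subr_gt0. Qed.

Lemma kap_ge0 n : 0 <= kap n.
Proof.
have l0 := ltW lam0; have k00 := ltW hk0; have l1 : 0 <= lam / (lam - 1).
  by rewrite divr_ge0// ltW.
by rewrite /kap; apply: mulr_ge0; [apply: mulr_ge0 => //; apply: mulr_ge0;
  [rewrite !mulr_ge0//; exact: addr_ge0|exact: exprn_ge0]|exact: exprn_ge0].
Qed.

Lemma geo_sum_le (N m : nat) :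
  \sum_(mu < N) ((mu <= m)%N)%:R * lam ^+ mu <= lam / (lam - 1) * lam ^+ m.
Proof.
have t0 mu : 0 <= ((mu <= m)%N)%:R * lam ^+ mu.
  by rewrite mulr_ge0// exprn_ge0// ltW.
rewrite -(big_mkord xpredT (fun mu => ((mu <= m)%N)%:R * lam ^+ mu)).
apply: (@le_trans _ _ (\sum_(0 <= mu < m.+1 + N) ((mu <= m)%N)%:R * lam ^+ mu)).
  by rewrite [leRHS](big_cat_nat (n := N))//= ?leq_addl// lerDl sumr_ge0.
rewrite (big_cat_nat (n := m.+1))//= ?leq_addr//.
rewrite [X in _ + X]big_nat_cond [X in _ + X]big1 ?addr0; last first.
  by move=> mu /andP[/andP[mmu _] _]; rewrite leqNgt mmu mul0r.
rewrite (eq_big_nat _ _ (F2 := fun mu => lam ^+ mu)); last first.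
  by move=> mu /andP[_]; rewrite ltnS => ->; rewrite mul1r.
rewrite big_mkord mulrAC ler_pdivlMr//.
have := subrX1 lam m.+1; rewrite mulrC => <-; rewrite -exprS.
by rewrite gerDl oppr_le0.
Qed.

Lemma kappa_sum n N k :
  \sum_(8 * N * k <= l < 8 * N * k.+1) (aff (sched N l) n)%:R * `|rc (sched N l)| <= kap n.
Proof.
rewrite (sched_block (fun r => (aff r n)%:R * `|rc r|)).
apply: (@le_trans _ _ (\sum_(mu < N) (8 * (`|a| + `|b|) * k0 * lam ^+ 2) *
    (((mu <= n./2)%N)%:R * lam ^+ mu))); last first.
  rewrite -mulr_sumr /kap -[leRHS]mulrA ler_wpM2l ?geo_sum_le//.
  have k00 := ltW hk0.
  by apply: mulr_ge0; [rewrite !mulr_ge0//; exact: addr_ge0|exact: sqr_ge0].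
apply: ler_sum => mu _.
apply: (@le_trans _ _ (\sum_(e < 8) ((mu <= n./2)%N)%:R * ((`|a| + `|b|) * kn k0 lam mu.+2))).
  apply: ler_sum => e _; have [an|_] := boolP (aff _ _).
    by have [-> _ _ _] := triad_range an; rewrite !mul1r triad_rc.
  by rewrite mul0r; apply: mulr_ge0 => //; apply: mulr_ge0; [exact: addr_ge0|exact/ltW/kn_gt0].
rewrite sumr_const card_ord -mulr_natl /kn !exprS.
by rewrite le_eqVlt; apply/orP; left; apply/eqP; ring.
Qed.

Lemma sched_rc_le n N l : aff (sched N l) n -> `|rc (sched N l)| <= kap n.
Proof.
move=> an; have [mn _ _ _] := triad_range an.
apply: (le_trans (triad_rc _ _)); set mu := (_ %/ _)%N in mn *.
rewrite /kap /kn -addn2 exprD.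
have h1 : lam ^+ mu <= lam ^+ n./2 by rewrite ler_weXn2l// ltW.
have h2 : 1 <= lam / (lam - 1) by rewrite ler_pdivlMr// mul1r gerDl oppr_le0.
have ab : 0 <= `|a| + `|b| by rewrite addr_ge0.
have k00 := ltW hk0; have l2 : 0 <= lam ^+ 2 by exact: sqr_ge0.
have ln : 0 <= lam ^+ n./2 by rewrite exprn_ge0// ltW.
set X := (`|a| + `|b|) in ab *; set L := lam / _ in h2 *.
set Y := lam ^+ n./2 in h1 ln *; set Z := lam ^+ 2 in l2 *.
have XZ : 0 <= X * k0 * Z by apply: mulr_ge0 => //; apply: mulr_ge0.
apply: (@le_trans _ _ (X * k0 * Z * Y)).
  have -> : X * (k0 * (lam ^+ mu * Z)) = X * k0 * Z * lam ^+ mu by ring.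
  exact: ler_wpM2l.
have -> : 8 * X * k0 * Z * L * Y = (X * k0 * Z * Y) * (8 * L) by ring.
rewrite ler_peMr; first by [].
  exact: mulr_ge0.
by lra.
Qed.

End sabra.

(** * The splitting scheme in equilibrium *)

Section mean_le.
Context d (T : measurableType d) (R : realType) (P : probability T R).
Implicit Types (f g : T -> R) (C D : R).

(** Measurability and sign are carried along, so that bounds on means can be composed. *)
Definition mean_le f C :=
  [/\ measurable_fun setT f, (forall x, 0 <= f x) & (\int[P]_x (f x)%:E <= C%:E)%E].

Lemma mean_leD f g C D : mean_le f C -> mean_le g D ->
  mean_le (fun x => f x + g x) (C + D).
Proof.
move=> [mf f0 fC] [mg g0 gD]; split; first exact: measurable_funD.
  by move=> x; rewrite addr_ge0.
under eq_integral do rewrite EFinD.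
rewrite ge0_integralD//; first by rewrite EFinD leeD.
- by move=> x _; rewrite lee_fin.
- exact/measurable_EFinP.
- by move=> x _; rewrite lee_fin.
- exact/measurable_EFinP.
Qed.

Lemma mean_leZ (c : R) f C : 0 <= c -> mean_le f C -> mean_le (fun x => c * f x) (c * C).
Proof.
move=> c0 [mf f0 fC]; split; first exact: measurable_funM.
  by move=> x; rewrite mulr_ge0.
under eq_integral do rewrite EFinM.
rewrite ge0_integralZl_EFin//; first by rewrite EFinM lee_wpmul2l// lee_fin.
- by move=> x _; rewrite lee_fin.
- exact/measurable_EFinP.
Qed.

Lemma mean_le0 : mean_le (fun=> 0) 0.
Proof. by split=> //; rewrite integral0. Qed.

Lemma mean_le_sum I (r : seq I) (f : I -> T -> R) (C : I -> R) :
  (forall i, mean_le (f i) (C i)) ->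
  mean_le (fun x => \sum_(i <- r) f i x) (\sum_(i <- r) C i).
Proof.
move=> fC; elim: r => [|i r IH].
  under eq_fun do rewrite big_nil; rewrite big_nil; exact: mean_le0.
by under eq_fun do rewrite big_cons; rewrite big_cons; exact: mean_leD.
Qed.

Lemma mean_le_trans f g C : measurable_fun setT f -> (forall x, 0 <= f x <= g x) ->
  mean_le g C -> mean_le f C.
Proof.
move=> mf fg [mg g0 gC]; have f0 x : 0 <= f x by have /andP[] := fg x.
split => //; apply: le_trans gC; apply: ge0_le_integral => //.
- by move=> x _; rewrite lee_fin.
- exact/measurable_EFinP.
- exact/measurable_EFinP.
- by move=> x _; rewrite lee_fin; have /andP[] := fg x.
Qed.

Lemma mean_leW f C D : C <= D -> mean_le f C -> mean_le f D.
Proof. by move=> CD [mf f0 fC]; split=> //; rewrite (le_trans fC)// lee_fin. Qed.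

Lemma mean_le_comp f C (phi : T -> T) : measurable_fun setT phi ->
  (forall E, measurable E -> P (phi @^-1` E) = P E) ->
  mean_le f C -> mean_le (f \o phi) C.
Proof.
move=> mphi inv [mf f0 fC]; split; first exact: measurableT_comp.
  by move=> x; exact: f0.
apply: le_trans fC; rewrite le_eqVlt; apply/orP; left; apply/eqP.
transitivity (\int[push_proba P mphi]_y (f y)%:E)%E.
  transitivity (\int[pushforward P phi]_y (f y)%:E)%E.
    rewrite ge0_integral_pushforward//; first exact/measurable_EFinP.
    by move=> x _; rewrite lee_fin.
  by apply: eq_measure_integral.
by apply: eq_measure_integral => A mA _; exact: inv.
Unshelve. all: exact: mphi. Qed.

End mean_le.

(** * Invariance and uniform moment bounds for the scheme *)

Section traj.
Context {R : realType}.
Variables (k0 lam a b : R).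
Hypotheses (hk0 : 0 < k0) (hlam : 1 < lam).

Definition hstep (N : nat) : R := N.+1%:R^-1.

Fixpoint traj (N : nat) (x : nat -> R) (q : nat) : nat -> R :=
  if q is q'.+1 then rotate (hstep N) (sched k0 lam a b N q') (traj N x q') else x.

Lemma measurable_traj N q : measurable_fun setT ((fun x => traj N x q) : rseq -> rseq).
Proof.
elim: q => [|q IH] /=; first exact: measurable_id.
exact: (measurableT_comp (measurable_rotate _ _) IH).
Qed.

Lemma measurable_traj_coord N q n : measurable_fun setT (fun x : rseq => traj N x q n).
Proof. exact: (measurableT_comp (measurable_coord n) (measurable_traj N q)). Qed.

Lemma sched_period N k q : sched k0 lam a b N (8 * N * k + q) = sched k0 lam a b N q.
Proof.
rewrite /sched; congr (triad _ _ _ _ (_ %/ 8) _); first by rewrite mulnC modnMDl.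
by rewrite -mulnA mulnC modnMDl.
Qed.

(** The schedule repeats after each time step, so [k] whole time steps amount to a new initial
    state; with [traj_invariant] this is the stationarity of the scheme. *)
Lemma traj_shift N x k q :
  traj N x (8 * N * k + q) = traj N (traj N x (8 * N * k)) q.
Proof.
elim: q => [|q IH]; first by rewrite addn0.
by rewrite addnS /= sched_period IH.
Qed.

Variables (nu : R) (P : probability (@rseq R) R).
Hypotheses (nu0 : 0 < nu) (iidP : iid (gauss1 nu) P).

Lemma traj_invariant N q (E : set rseq) : measurable E ->
  P ((fun x => traj N x q) @^-1` E) = P E.
Proof.
elim: q E => [|q IH] E mE //=.
rewrite -(rotate_invariant (hstep N) nu0 iidP (sched_wf k0 lam a b N q) mE) -IH//.
rewrite -[X in measurable X]setTI.
exact: (measurable_rotate (hstep N) (sched k0 lam a b N q) measurableT).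
Qed.

Lemma coord_moment m : exists C, 0 <= C /\
  forall N q n, mean_le P (fun x => `|traj N x q n| ^+ m) C.
Proof.
have [C HC] := gauss1_moment m nu0.
have mX : measurable_fun setT (fun x : R => `|x| ^+ m).
  by apply: measurable_funX; exact: normr_measurable.
have C0 : 0 <= C.
  by rewrite -lee_fin; apply: le_trans HC; apply: integral_ge0 => x _; rewrite lee_fin exprn_ge0.
exists C; split => // N q n.
have h : mean_le P (fun x : rseq => `|x n| ^+ m) C.
  split; first exact: (measurableT_comp mX (measurable_coord n)).
    by move=> x; exact: exprn_ge0.
  have ub : iid_upto (gauss1 nu) n.+1 P by exact: iidP.
  rewrite (iid_upto_integral (f := fun y => (`|y| ^+ m)%:E) ub)//.
  exact/measurable_EFinP.
exact: (mean_le_comp (measurable_traj N q) (@traj_invariant N q) h).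
Qed.

Lemma rotW_moment m : exists C, 0 <= C /\
  forall N q r, mean_le P (fun x => rotW r (traj N x q) ^+ m) C.
Proof.
have [C [C0 HC]] := coord_moment m.
(* The power of a sum of three terms is at most 3^m times that of the largest, which is one of the
   three powers. *)
exists (3%:R ^+ m * (C + C + C)); split; first by rewrite mulr_ge0 ?exprn_ge0// !addr_ge0.
move=> N q r.
have mc n := measurable_traj_coord N q n.
have mW : measurable_fun setT (fun x : rseq => rotW r (traj N x q) ^+ m).
  apply: measurable_funX; rewrite /rotW.
  by apply: measurable_funD; [apply: measurable_funD|]; apply: measurableT_comp => //; exact: mc.
have H : mean_le P (fun x => 3%:R ^+ m * (`|traj N x q (ri r)| ^+ m +
    `|traj N x q (rj r)| ^+ m + `|traj N x q (rk r)| ^+ m)) (3%:R ^+ m * (C + C + C)).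
  by apply: mean_leZ; [exact: exprn_ge0|apply: mean_leD => //; exact: mean_leD].
refine (mean_le_trans mW _ H).
move=> x; rewrite /rotW; move: (traj N x q) => y.
rewrite exprn_ge0 ?addr_ge0//=.
set A := `|y (ri r)|; set B := `|y (rj r)|; set D := `|y (rk r)|.
have A0 : 0 <= A by exact: normr_ge0.
have B0 : 0 <= B by exact: normr_ge0.
have D0 : 0 <= D by exact: normr_ge0.
have bnd (M : R) : A <= M -> B <= M -> D <= M -> (A + B + D) ^+ m <= 3%:R ^+ m * M ^+ m.
  move=> AM BM DM; rewrite -exprMn; apply: lerXn2r.
  - by rewrite nnegrE !addr_ge0.
  - by rewrite nnegrE mulr_ge0// (le_trans A0).
  have -> : 3%:R * M = M + M + M by ring.
  by apply: lerD => //; apply: lerD.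
have Am := exprn_ge0 m A0; have Bm := exprn_ge0 m B0; have Dm := exprn_ge0 m D0.
have [AB|/ltW AB] := leP A B.
  have [BD|/ltW BD] := leP B D.
    apply: (le_trans (bnd D _ _ _)) => //; first exact: le_trans BD.
    by rewrite ler_wpM2l ?exprn_ge0// lerDr addr_ge0.
  apply: (le_trans (bnd B _ _ _)) => //.
  by rewrite ler_wpM2l ?exprn_ge0// addrAC lerDr addr_ge0.
have [AD|/ltW AD] := leP A D.
  apply: (le_trans (bnd D _ _ _)) => //; first exact: le_trans AD.
  by rewrite ler_wpM2l ?exprn_ge0// lerDr addr_ge0.
apply: (le_trans (bnd A _ _ _)) => //.
by rewrite ler_wpM2l ?exprn_ge0// -addrA lerDl addr_ge0.
Qed.

(* The [N]-th scheme starts at time [- N] and has time steps of length [1 / (N + 1)]; these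
   are the numbers of time steps up to the times [- T] and [T]. *)
Definition wlo (T N : nat) : nat := ((N - T) * N.+1)%N.
Definition whi (T N : nat) : nat := ((N + T) * N.+1)%N.

Lemma wlohi T N : (wlo T N <= whi T N)%N.
Proof. by rewrite /wlo /whi leq_mul2r; lia. Qed.

Lemma window_length T N : (whi T N - wlo T N)%:R * hstep N <= (2 * T)%:R.
Proof.
rewrite /hstep ler_pdivrMr ?ltr0n// -natrM ler_nat /whi /wlo -mulnBl leq_mul2r.
by lia.
Qed.

Definition supfun (T m N n : nat) (x : nat -> R) : R :=
  `|traj N x (8 * N * wlo T N) n| ^+ m.+1 +
  \sum_(8 * N * wlo T N <= l < 8 * N * whi T N)
    (aff (sched k0 lam a b N l) n)%:R *
    (m.+1%:R * (hstep N * `|rc (sched k0 lam a b N l)|) *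
     rotW (sched k0 lam a b N l) (traj N x l) ^+ m.+2).

(** One variable for all coordinates: the bound on the mean of [supfun] grows like [lam ^+ n./2], so
    that the weights leave a series that converges uniformly in [N]. *)
Definition Gfun (T m N : nat) (x : nat -> R) : R :=
  \sum_(n < N) lam ^- (2 * n) * supfun T m N n x.

Lemma hstep_ge0 N : 0 <= hstep N. Proof. by rewrite invr_ge0. Qed.

Lemma supfunP T m N n x q : (8 * N * wlo T N <= q <= 8 * N * whi T N)%N ->
  `|traj N x q n| ^+ m.+1 <= supfun T m N n x.
Proof.
move=> qw; have := @sup_moment R (hstep N) (sched k0 lam a b N) (traj N x)
  (hstep_ge0 N) (sched_wf k0 lam a b N) (fun=> erefl) n m _ _ _ qw.
exact.
Qed.

Lemma Gfun_mean T m : exists C, forall N, mean_le P (Gfun T m N) C.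
Proof.
have [C [C0 HC]] := coord_moment m.+1.
have [D [D0 HD]] := rotW_moment m.+2.
have lam0 : 0 < lam by rewrite (lt_trans ltr01).
have [K K0 kapE] : exists2 K, 0 <= K & forall n, kap k0 lam a b n = K * lam ^+ n./2.
  exists (kap k0 lam a b 0); first exact: kap_ge0.
  by move=> n; exact: kapE.
pose B := C + m.+1%:R * (2 * T)%:R * K * D.
have B0 : 0 <= B by apply: addr_ge0 => //; rewrite !mulr_ge0.
exists (B * (lam / (lam - 1))) => N.
have hsup n : mean_le P (supfun T m N n) (C + m.+1%:R * (2 * T)%:R * kap k0 lam a b n * D).
  apply: mean_leD; first exact: HC.
  pose w l := (aff (sched k0 lam a b N l) n)%:R * `|rc (sched k0 lam a b N l)|.
  have hs : mean_le P (fun x => \sum_(8 * N * wlo T N <= l < 8 * N * whi T N)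
    (aff (sched k0 lam a b N l) n)%:R *
    (m.+1%:R * (hstep N * `|rc (sched k0 lam a b N l)|) *
     rotW (sched k0 lam a b N l) (traj N x l) ^+ m.+2))
    (\sum_(8 * N * wlo T N <= l < 8 * N * whi T N)
    (aff (sched k0 lam a b N l) n)%:R *
    (m.+1%:R * (hstep N * `|rc (sched k0 lam a b N l)|) * D)).
    apply: mean_le_sum => l; apply: mean_leZ => //; apply: mean_leZ; last exact: HD.
    by rewrite !mulr_ge0// hstep_ge0.
  apply: mean_leW hs.
  rewrite (eq_bigr (fun l => w l * (m.+1%:R * hstep N * D))); last first.
    by move=> l _; rewrite /w; ring.
  rewrite -mulr_suml.
  (* Each time step contributes at most [kap n], and the number of time steps times [hstep N] is at
     most [2 * T]. *)
  apply: (@le_trans _ _ ((whi T N - wlo T N)%:R * kap k0 lam a b n * (m.+1%:R * hstep N * D))).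
    rewrite ler_wpM2r//; first by rewrite !mulr_ge0// hstep_ge0.
    apply: block_sum_kappa; first exact: wlohi.
    by move=> k; exact: kappa_sum.
  have -> : (whi T N - wlo T N)%:R * kap k0 lam a b n * (m.+1%:R * hstep N * D) =
    ((whi T N - wlo T N)%:R * hstep N) * (m.+1%:R * kap k0 lam a b n * D) by ring.
  have -> : m.+1%:R * (2 * T)%:R * kap k0 lam a b n * D =
    (2 * T)%:R * (m.+1%:R * kap k0 lam a b n * D) by ring.
  have kn0 : 0 <= kap k0 lam a b n by exact: kap_ge0.
  rewrite ler_wpM2r ?window_length//; apply: mulr_ge0 => //; exact: mulr_ge0.
have l0 n : 0 <= lam ^- (2 * n) by rewrite invr_ge0 exprn_ge0// ltW.
have := mean_le_sum (index_enum 'I_N) (fun n : 'I_N => mean_leZ (l0 n) (hsup n)).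
apply: mean_leW.
(* Bounding [lam ^+ n./2] by [lam ^+ n] cancels half of the weight and leaves a geometric series. *)
apply: (@le_trans _ _ (\sum_(n < N) B * lam^-1 ^+ n)).
  apply: ler_sum => n _; rewrite kapE.
  have ln : 1 <= lam ^+ n by rewrite exprn_ege1// ltW.
  have lh : lam ^+ n./2 <= lam ^+ n by rewrite ler_weXn2l ?ltW//; lia.
  have -> : B * lam^-1 ^+ n = lam ^- (2 * n) * (B * lam ^+ n).
    rewrite mul2n -addnn exprD exprVn invfM.
    by rewrite mulrCA -[_ * lam ^+ n]mulrA mulVf ?mulr1// gt_eqF// exprn_gt0.
  rewrite ler_wpM2l// /B mulrDl lerD//; first by rewrite ler_peMr.
  have -> : m.+1%:R * (2 * T)%:R * (K * lam ^+ n./2) * D =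
    (m.+1%:R * (2 * T)%:R * K * D) * lam ^+ n./2 by ring.
  by rewrite ler_wpM2l// !mulr_ge0.
rewrite -mulr_sumr ler_wpM2l//.
have q1 : lam^-1 != 1 by rewrite lt_eqF// invf_lt1.
have := subrX1 lam^-1 N.
have q0 : 1 - lam^-1 > 0 by rewrite subr_gt0 invf_lt1.
have -> : lam / (lam - 1) = (1 - lam^-1)^-1.
  by field; rewrite !gt_eqF ?subr_gt0.
move=> h; rewrite -[leRHS]mul1r ler_pdivlMr//.
have -> : (\sum_(i < N) lam^-1 ^+ i) * (1 - lam^-1) = 1 - lam^-1 ^+ N.
  by rewrite -opprB mulrN mulrC -h opprB.
by rewrite gerDl oppr_le0 exprn_ge0// invr_ge0 ltW.
Qed.

End traj.

(** * Limit paths *)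

Section path.
Context {R : realType}.
Variables (k0 lam a b : R).
Hypotheses (hk0 : 0 < k0) (hlam : 1 < lam).
Variable w : nat -> nat -> R.

Local Notation traj := (traj k0 lam a b).
Local Notation kap := (kap k0 lam a b).
Local Notation drift := (drift k0 lam a b).

(** Countably many conditions, which therefore hold together almost surely; convergence, the
    equation and the regularity are deterministic consequences. *)
Definition good :=
  forall T m, ubounded (fun N => Gfun k0 lam a b T m N (w N)).

Hypothesis gw : good.

(** The number of whole time steps from the start at [- N] up to [t]; the truncation at 0 concerns
    only the finitely many [N] below [- t]. *)
Definition tidx (t : R) (N : nat) : nat := Num.truncn ((t + N%:R) * N.+1%:R).
Definition upath (t : R) (N n : nat) : R := traj N (w N) (8 * N * tidx t N) n.
Definition vpath (t : R) (n : nat) : R := ulim (fun N => upath t N n).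

Definition inwin (T N q : nat) := (8 * N * wlo T N <= q <= 8 * N * whi T N)%N.

Let lam0 : 0 < lam. Proof. by rewrite (lt_trans ltr01). Qed.

Lemma supfun_ge0 T m N n x : 0 <= supfun k0 lam a b T m N n x.
Proof.
apply: addr_ge0; first exact: exprn_ge0.
apply: sumr_ge0 => l _; apply: mulr_ge0 => //; apply: mulr_ge0.
  by rewrite !mulr_ge0// hstep_ge0.
by apply: exprn_ge0; rewrite /rotW !addr_ge0.
Qed.

(** Each coordinate is a single term of [Gfun], and undoing its weight costs [lam ^+ (2 * n)]. After
    taking roots, coordinate [n] grows at most like [lam] to the power 2n / (m + 1). *)
Lemma moment_window T m : exists K, 0 < K /\ \forall N \near hyper,
  forall q n, inwin T N q -> (n < N)%N -> `|traj N (w N) q n| ^+ m.+1 <= K * lam ^+ (2 * n).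
Proof.
have [K HK] := gw T m; exists (`|K| + 1); split; first by rewrite ltr_wpDl.
apply: filterS HK => N HK q n wq nN.
apply: (le_trans (supfunP _ _ _ _ _ _ _ wq)).
rewrite -ler_pdivrMr ?exprn_gt0// mulrC.
apply: (@le_trans _ _ (Gfun k0 lam a b T m N (w N))).
  rewrite /Gfun (bigD1 (Ordinal nN))//= lerDl sumr_ge0// => i _.
  by rewrite mulr_ge0 ?supfun_ge0// invr_ge0 exprn_ge0// ltW.
apply: (le_trans (ler_norm _)); apply: (le_trans HK).
by apply: (le_trans (ler_norm _)); rewrite lerDl.
Qed.

Definition bounded_by (T D : nat) (A : R) := \forall N \near hyper,
  forall q n, inwin T N q -> (n <= D)%N -> `|traj N (w N) q n| <= A.

Lemma exists_bound T D : exists A, 0 < A /\ bounded_by T D A.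
Proof.
have [K [K0 HK]] := moment_window T 0; exists (K * lam ^+ (2 * D)); split.
  by rewrite mulr_gt0// exprn_gt0.
apply: filterS2 (hyper_gt D) HK => N DN HK q n wq nD.
have := HK q n wq (leq_ltn_trans nD DN); rewrite expr1 => /le_trans; apply.
by rewrite ler_wpM2l ?(ltW K0)// ler_weXn2l ?(ltW hlam)//; lia.
Qed.

Lemma tidx_win T N (t : R) : - T%:R <= t <= T%:R -> (T < N)%N ->
  (wlo T N <= tidx t N <= whi T N)%N.
Proof.
move=> /andP[t1 t2] TN; rewrite /tidx /wlo /whi.
have tN : 0 <= t + N%:R.
  rewrite -lerBlDr sub0r (le_trans _ t1)// lerN2 ler_nat; exact: ltnW.
have tNN : 0 <= (t + N%:R) * N.+1%:R by rewrite mulr_ge0.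
apply/andP; split.
  by rewrite (truncn_ge_nat _ tNN) natrM ler_wpM2r// natrB ?(ltnW TN)// addrC lerD2r.
rewrite -ltnS (truncn_lt_nat _ tNN) -[_.+1%:R in ltRHS]natr1 natrM natrD.
apply: (@le_lt_trans _ _ ((N%:R + T%:R) * N.+1%:R)); last by rewrite ltrDl.
by rewrite ler_wpM2r// addrC lerD2l.
Qed.

Lemma tidx_inwin T N (t : R) : - T%:R <= t <= T%:R -> (T < N)%N ->
  inwin T N (8 * N * tidx t N).
Proof.
move=> tT TN; rewrite /inwin !leq_mul2l.
by have /andP[-> ->] := tidx_win tT TN; rewrite !orbT.
Qed.

Lemma upath_bound T D A t : - T%:R <= t <= T%:R -> bounded_by T D A ->
  \forall N \near hyper, forall n, (n <= D)%N -> `|upath t N n| <= A.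
Proof.
move=> tT bA; apply: filterS2 (hyper_gt T) bA => N TN bA n nD.
by apply: bA => //; exact: tidx_inwin.
Qed.

Lemma exists_T (t : R) : exists T : nat, - T%:R <= t <= T%:R.
Proof.
exists (Num.bound `|t|); rewrite -ler_norml.
by rewrite ltW// archi_boundP.
Qed.

Lemma upath_cvg t n : (fun N => upath t N n) @ hyper --> vpath t n.
Proof.
apply: ulimP; have [T tT] := exists_T t; have [A [_ bA]] := exists_bound T n.
by exists A; apply: filterS (upath_bound tT bA) => N; apply.
Qed.

Lemma vpath_bound T D A t n : - T%:R <= t <= T%:R -> bounded_by T D A -> (n <= D)%N ->
  `|vpath t n| <= A.
Proof.
move=> tT bA nD; apply: (ulim_le (cvg_norm (@upath_cvg t n)) (cvg_cst A)).
by apply: filterS (upath_bound tT bA) => N; apply.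
Qed.

Lemma hstep_cvg0 : (@hstep R) @ hyper --> (0 : R).
Proof.
apply: cvg_trans (@cvg_harmonic R); apply: cvg_app; exact: hyper_ge.
Qed.

Definition elapsed (s t : R) (N : nat) : R := (tidx t N - tidx s N)%:R * hstep N.

Lemma tidx_le N (s t : R) : s <= t -> (tidx s N <= tidx t N)%N.
Proof. by move=> st; apply: le_truncn; rewrite ler_wpM2r// lerD2r. Qed.

Lemma elapsed_close T N (s t : R) : - T%:R <= s -> s <= t -> (T < N)%N ->
  `|elapsed s t N - (t - s)| <= hstep N.
Proof.
move=> sT st TN.
have sN : 0 <= s + N%:R.
  rewrite -lerBlDr sub0r (le_trans _ sT)// lerN2 ler_nat; exact: ltnW.
have tN : 0 <= t + N%:R by rewrite (le_trans sN)// lerD2r.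
have n0 : (0 : R) < N.+1%:R by rewrite ltr0n.
have n1 : N.+1%:R != 0 :> R by rewrite gt_eqF.
have := truncn_itv (mulr_ge0 sN (ltW n0)); have := truncn_itv (mulr_ge0 tN (ltW n0)).
rewrite -/(tidx s N) -/(tidx t N) -[(tidx t N).+1%:R]natr1 -[(tidx s N).+1%:R]natr1.
move=> /andP[t1 t2] /andP[s1 s2].
rewrite /elapsed natrB ?tidx_le// /hstep.
have -> : ((tidx t N)%:R - (tidx s N)%:R) * N.+1%:R^-1 - (t - s) =
  ((tidx t N)%:R - (tidx s N)%:R - (t - s) * N.+1%:R) * N.+1%:R^-1 :> R.
  by rewrite [in RHS]mulrBl mulfK.
rewrite normrM [`|_^-1|]ger0_norm ?invr_ge0// ler_piMl ?invr_ge0//.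
by rewrite ler_norml; apply/andP; split; lra.
Qed.

Lemma elapsed_cvg (s t : R) : s <= t -> elapsed s t @ hyper --> t - s.
Proof.
move=> st; have [T /andP[sT _]] := exists_T s.
apply/cvgrPdist_le => e e0; have := hstep_cvg0 => /cvgrPdist_le/(_ e e0) h.
apply: filterS2 (hyper_gt T) h => N TN hN.
rewrite distrC (le_trans (elapsed_close sT st TN))//.
by rewrite sub0r normrN in hN; rewrite (le_trans (ler_norm _)).
Qed.

Section lipschitz.
Variables (T n : nat) (A : R).
Hypotheses (A0 : 0 < A) (bA : bounded_by T (n + 5) A).
Variables s t : R.
Hypotheses (sT : - T%:R <= s) (st : s <= t) (tT : t <= T%:R).

Let sw : - T%:R <= s <= T%:R. Proof. by rewrite sT (le_trans st). Qed.
Let tw : - T%:R <= t <= T%:R. Proof. by rewrite tT (le_trans sT). Qed.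

Lemma window_bound : \forall N \near hyper,
  (T < N)%N /\
  forall l, (8 * N * tidx s N <= l <= 8 * N * tidx t N)%N ->
    forall i, (i <= n + 5)%N -> `|traj N (w N) l i| <= A.
Proof.
apply: filterS2 (hyper_gt T) bA => N TN HA; split => // l /andP[l1 l2] i iD.
apply: HA => //; have /andP[h1 _] := tidx_win sw TN; have /andP[_ h2] := tidx_win tw TN.
by rewrite /inwin (leq_trans _ l1) ?(leq_trans l2)// leq_mul2l ?h1 ?h2 orbT.
Qed.

(** Stated for all rotations in the window, as the consistency estimate also compares states inside
    a time step. *)
Lemma upath_window_diff : \forall N \near hyper, forall q q',
  (8 * N * tidx s N <= q <= 8 * N * tidx t N)%N ->
  (8 * N * tidx s N <= q' <= 8 * N * tidx t N)%N ->
  `|traj N (w N) q' n - traj N (w N) q n| <= elapsed s t N * kap n * (2 * A ^+ 2).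
Proof.
apply: filterS window_bound => N [TN HA] q q' wq wq'.
have := @window_diff R (hstep N) (sched k0 lam a b N) (traj N (w N))
  (hstep_ge0 N) (sched_wf k0 lam a b N) (fun=> erefl) n (8 * N)%N (tidx s N) (tidx t N)
  (kap n) A (tidx_le N st) (kappa_sum a b hk0 hlam n N) _ q q' wq wq'.
move=> H; have {H} : `|traj N (w N) q' n - traj N (w N) q n| <=
   (tidx t N - tidx s N)%:R * kap n * (hstep N * (2 * A ^+ 2)).
  apply: H => l wl an; have [_ r1 r2 r3] := triad_range an.
  by split; apply: HA.
by move/le_trans; apply; rewrite /elapsed le_eqVlt; apply/orP; left; apply/eqP; ring.
Qed.

Lemma vpath_lipschitz : `|vpath t n - vpath s n| <= (t - s) * kap n * (2 * A ^+ 2).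
Proof.
have c1 : (fun N => `|upath t N n - upath s N n|) @ hyper --> `|vpath t n - vpath s n|.
  by apply: cvg_norm; apply: cvgB; exact: upath_cvg.
have c2 : (fun N => elapsed s t N * kap n * (2 * A ^+ 2)) @ hyper -->
    (t - s) * kap n * (2 * A ^+ 2).
  by apply: cvgMl; apply: cvgMl; exact: elapsed_cvg.
apply: (ulim_le c1 c2); apply: filterS upath_window_diff => N; apply.
  by rewrite leqnn/= leq_mul2l tidx_le// orbT.
by rewrite leqnn/= leq_mul2l tidx_le// orbT.
Qed.

End lipschitz.

Lemma kap_le i j : (i <= j)%N -> kap i <= kap j.
Proof.
move=> ij; rewrite kapE [leRHS]kapE ler_wpM2l ?kap_ge0// ler_weXn2l ?(ltW hlam)//; lia.
Qed.

Lemma cvg_sum_seq (I T' : Type) (F : set_system T') (FF : Filter F) (r : seq I)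
    (f : I -> T' -> R) (l : I -> R) :
  (forall i, f i x @[x --> F] --> l i) ->
  \sum_(i <- r) f i x @[x --> F] --> \sum_(i <- r) l i.
Proof.
move=> fl; elim: r => [|i r IH].
  by under eq_fun do rewrite big_nil; rewrite big_nil; exact: cvg_cst.
by under eq_fun do rewrite big_cons; rewrite big_cons; apply: cvgD.
Qed.

Lemma drift_cvg (T' : Type) (F : set_system T') (FF : Filter F) n
    (f : T' -> nat -> R) (l : nat -> R) :
  (forall i, f x i @[x --> F] --> l i) -> drift n (f x) @[x --> F] --> drift n l.
Proof.
move=> fl; apply: cvg_sum_seq => mu; apply: cvg_sum_seq => e; rewrite /contr.
case: ifP => _; first by apply: cvgM => //; apply: cvgM => //; exact: cvg_cst.
case: ifP => _; last exact: cvg_cst.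
by apply: cvgN; apply: cvgM => //; apply: cvgM => //; exact: cvg_cst.
Qed.

Section consistent.
Variables (T n : nat) (A : R).
Hypotheses (A0 : 0 < A) (bA : bounded_by T (n + 10) A).
Variables s t r : R.
Hypotheses (sT : - T%:R <= s) (st : s <= t) (tT : t <= T%:R) (rst : s <= r <= t).

Let bA5 i : (i <= n + 5)%N -> bounded_by T (i + 5) A.
Proof. by move=> ni; apply: filterS bA => N HA q j wq jn; apply: HA => //; lia. Qed.

Let bAn : bounded_by T (n + 5) A. Proof. by apply: bA5; lia. Qed.

Let dN N := elapsed s t N * kap (n + 5) * (2 * A ^+ 2).

(** The reach [n + 10] arises because the field at [n] involves coordinates up to [n + 5], whose
    increments are controlled by bounds on five more. [dN] bounds these increments and is itself of
    first order in the elapsed time, so the error is of second order up to the term with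
    [hstep N]. *)
Lemma upath_consistent : \forall N \near hyper,
  `|upath t N n - upath s N n - elapsed s t N * drift n (upath r N)| <=
  elapsed s t N * kap n * (2 * A * dN N + hstep N * kap n * A ^+ 3).
Proof.
have Hd : \forall N \near hyper, forall i : 'I_(n + 6), forall q q',
  (8 * N * tidx s N <= q <= 8 * N * tidx t N)%N ->
  (8 * N * tidx s N <= q' <= 8 * N * tidx t N)%N ->
  `|traj N (w N) q' i - traj N (w N) q i| <= elapsed s t N * kap i * (2 * A ^+ 2).
  apply: filter_forall => i.
  by apply: (upath_window_diff (T := T)) => //; apply: bA5; have := ltn_ord i; lia.
apply: filterS3 (hyper_gt n) Hd (window_bound bAn sT st tT) => N nN Hd [TN HA].
have wr : (8 * N * tidx s N <= 8 * N * tidx r N <= 8 * N * tidx t N)%N.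
  by have /andP[sr rt] := rst; rewrite !leq_mul2l !tidx_le ?orbT.
have e0 : 0 <= elapsed s t N by rewrite mulr_ge0// hstep_ge0.
have k50 : 0 <= kap (n + 5) by exact: kap_ge0.
have kn0 : 0 <= kap n by exact: kap_ge0.
have A20 : 0 <= 2 * A ^+ 2 by apply: mulr_ge0 => //; exact: sqr_ge0.
have d0 : 0 <= dN N by rewrite /dN; apply: mulr_ge0 => //; exact: mulr_ge0.
have sz l i : (8 * N * tidx s N <= l <= 8 * N * tidx t N)%N -> (i <= n + 5)%N ->
    `|traj N (w N) l i - upath r N i| <= dN N.
  move=> wl ni; have ni' : (i < n + 6)%N by rewrite addnS.
  apply: (le_trans (Hd (Ordinal ni') _ _ wr wl)).
  by rewrite /dN ler_wpM2r// ler_wpM2l// kap_le.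
have H := @window_consistent R (hstep N) (sched k0 lam a b N) (traj N (w N))
  (hstep_ge0 N) (sched_wf k0 lam a b N) (fun=> erefl) n (8 * N)%N (tidx s N) (tidx t N)
  (kap n) A (tidx_le N st) (kappa_sum a b hk0 hlam n N) _
  (upath r N) (dN N) (drift n (upath r N))
  (fun k => drift_sum k0 lam a b k _ nN) _ _ _ d0 kn0 (ltW A0).
have -> : elapsed s t N * kap n * (2 * A * dN N + hstep N * kap n * A ^+ 3) =
  (tidx t N - tidx s N)%:R * kap n *
    (hstep N * (2 * A * dN N + hstep N * kap n * A ^+ 3)).
  by rewrite /elapsed; ring.
apply: H.
- by move=> l wl an; have [_ r1 r2 r3] := triad_range an; split; apply: HA.
- by move=> l wl an; have [_ r1 r2 r3] := triad_range an; split; apply: HA.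
- by move=> l wl an; have [_ r1 r2 r3] := triad_range an; split; apply: sz.
- by move=> l an; exact: sched_rc_le.
Qed.

Lemma vpath_consistent :
  `|vpath t n - vpath s n - (t - s) * drift n (vpath r)| <=
  kap n * (4 * A ^+ 3 * kap (n + 5)) * (t - s) ^+ 2.
Proof.
have c1 : (fun N => `|upath t N n - upath s N n - elapsed s t N * drift n (upath r N)|)
    @ hyper --> `|vpath t n - vpath s n - (t - s) * drift n (vpath r)|.
  apply: cvg_norm; apply: cvgB; first by apply: cvgB; exact: upath_cvg.
  apply: cvgM; first exact: elapsed_cvg.
  by apply: drift_cvg => i; exact: upath_cvg.
have ce := elapsed_cvg st.
have c2 : (fun N => elapsed s t N * kap n * (2 * A * dN N + hstep N * kap n * A ^+ 3))
    @ hyper --> (t - s) * kap n * (2 * A * ((t - s) * kap (n + 5) * (2 * A ^+ 2)) +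
      0 * kap n * A ^+ 3).
  apply: cvgM; first exact: cvgMl.
  apply: cvgD; first by apply: cvgMr; apply: cvgMl; exact: cvgMl.
  by apply: cvgMl; apply: cvgMl; exact: hstep_cvg0.
apply: (le_trans (ulim_le c1 c2 upath_consistent)).
by rewrite le_eqVlt; apply/orP; left; apply/eqP; ring.
Qed.

End consistent.

End path.

(** * The limit paths solve the shell model *)

Lemma is_derive_quadratic (R : realType) (f : R -> R) (x D C e : R) : 0 < e ->
  (forall h, `|h| <= e -> `|f (h + x) - f x - h * D| <= C * h ^+ 2) ->
  is_derive x 1 f D.
Proof.
move=> e0 H.
have C0 : 0 <= C.
  have := H e; rewrite gtr0_norm// => /(_ (lexx _)) /(le_trans (normr_ge0 _)).
  by rewrite pmulr_lge0// exprn_gt0.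
suff L : h^-1 *: ((f \o shift x) (h *: 1) - f x) @[h --> 0^'] --> D.
  by apply: DeriveDef; [exact: cvgP L|exact: cvg_lim L].
apply/cvgrPdist_le => d d0.
near=> h.
have h0 : h != 0 by near: h; exact: nbhs_dnbhs_neq.
have hp : 0 < `|h| by rewrite normr_gt0.
have he : `|h| <= e by near: h; exact: dnbhs0_le.
have hd : `|h| <= d / (C + 1).
  by near: h; apply: dnbhs0_le; rewrite divr_gt0// ltr_wpDl.
rewrite /= !scaler1 distrC /GRing.scale/=.
have -> : h^-1 * (f (h + x) - f x) - D = h^-1 * (f (h + x) - f x - h * D).
  by rewrite [in RHS]mulrBr mulKf.
rewrite normrM normfV ler_pdivrMl//; apply: (le_trans (H h he)).
rewrite -(real_normK (num_real h)) expr2 mulrCA ler_wpM2l//.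
apply: (@le_trans _ _ ((C + 1) * `|h|)); first by rewrite ler_wpM2r// lerDl.
by rewrite mulrC -ler_pdivlMr// ltr_wpDl.
Unshelve. all: by end_near. Qed.

Section solution.
Context {R : realType}.
Variables (k0 lam a b : R).
Hypotheses (hk0 : 0 < k0) (hlam : 1 < lam).
Variable w : nat -> nat -> R.
Hypothesis gw : good k0 lam a b w.

Local Notation vpath := (vpath k0 lam a b w).
Local Notation drift := (drift k0 lam a b).
Local Notation kap := (kap k0 lam a b).

(** For [y < x] the base point [x] is the right endpoint of the interval; this is why
    [vpath_consistent] leaves the time [r] free. *)
Lemma vpath_taylor T n : exists C, forall x y, - T%:R <= x <= T%:R -> - T%:R <= y <= T%:R ->
  `|vpath y n - vpath x n - (y - x) * drift n (vpath x)| <= C * (y - x) ^+ 2.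
Proof.
have [A [A0 bA]] := exists_bound hk0 hlam gw T (n + 10).
exists (kap n * (4 * A ^+ 3 * kap (n + 5))) => x y /andP[xT Tx] /andP[yT Ty].
have [xy|/ltW yx] := leP x y.
  by apply: (vpath_consistent hk0 hlam gw A0 bA xT xy Ty); rewrite lexx xy.
rewrite -normrN.
have -> : - (vpath y n - vpath x n - (y - x) * drift n (vpath x)) =
   vpath x n - vpath y n - (x - y) * drift n (vpath x) by ring.
have -> : (y - x) ^+ 2 = (x - y) ^+ 2 by ring.
by apply: (vpath_consistent hk0 hlam gw A0 bA yT yx Tx); rewrite lexx yx.
Qed.

Lemma vpath_is_derive n (x : R) : is_derive x 1 (fun t : R => vpath t n) (drift n (vpath x)).
Proof.
have [T /andP[xT Tx]] := exists_T x.
have [C HC] := vpath_taylor T.+1 n.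
have TS : T.+1%:R = T%:R + 1 :> R by rewrite -natr1.
apply: (@is_derive_quadratic _ _ _ _ C 1) => // h; rewrite ler_norml => /andP[h1 h2].
have := HC x (h + x); rewrite TS addrK; apply; apply/andP; split; lra.
Qed.

Lemma vpath_continuous n : continuous (fun t => vpath t n).
Proof.
move=> x; have [d _] := vpath_is_derive n x.
by apply: differentiable_continuous; apply/derivable1_diffP.
Qed.

Lemma drift_continuous n : continuous (fun t => drift n (vpath t)).
Proof. by move=> x; apply: drift_cvg => i; exact: vpath_continuous. Qed.

Lemma vpath_integral n s t : s < t ->
  vpath t n - vpath s n = \int[lebesgue_measure]_(r in `[s, t]) drift n (vpath r).
Proof.
move=> st; rewrite /Rintegral (@continuous_FTC2 _ _ (fun r => vpath r n))//.
- apply: continuous_subspaceT; exact: drift_continuous.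
- split.
  + by move=> x _; have [] := vpath_is_derive n x.
  + by apply: cvg_at_right_filter; exact: vpath_continuous.
  + by apply: cvg_at_left_filter; exact: vpath_continuous.
- move=> x _; rewrite derive1E; have := vpath_is_derive n x => dx.
  exact: derive_val.
Qed.

Lemma vpath_integral_opp n (f : R -> R) s t : s < t ->
  (forall r, drift n (vpath r) = - f r) ->
  vpath t n - vpath s n = - \int[lebesgue_measure]_(r in `[s, t]) f r.
Proof.
move=> st df; rewrite vpath_integral//.
have -> : f = fun r => -1 * drift n (vpath r).
  by apply/funext => r; rewrite df mulN1r opprK.
rewrite RintegralZl//; first by rewrite mulN1r opprK.
apply: continuous_compact_integrable; first exact: segment_compact.
by apply: continuous_subspaceT; exact: drift_continuous.
Qed.

Lemma vpath_solves : solves_inviscid k0 lam a b (fun t => shells (vpath t)).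
Proof.
move=> s t st m; split; rewrite /=; apply: vpath_integral_opp => // r.
  exact: drift_re.
exact: drift_im.
Qed.

End solution.

(** * Regularity *)

Lemma nneseries_geometric_le (R : realType) (f : nat -> R) (C eta : R) :
  0 <= C -> 0 <= eta < 1 -> (forall m, 0 <= f m <= C * eta ^+ m) ->
  (\sum_(0 <= m <oo) (f m)%:E <= (C / (1 - eta))%:E)%E.
Proof.
move=> C0 /andP[eta0 eta1] fC.
apply: lime_le.
  by apply: is_cvg_nneseries => m _ _; rewrite lee_fin; have /andP[] := fC m.
near=> n; rewrite sumEFin lee_fin.
apply: (@le_trans _ _ (\sum_(0 <= m < n) C * eta ^+ m)).
  by apply: ler_sum => m _; have /andP[] := fC m.
rewrite -mulr_sumr ler_wpM2l// big_mkord.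
have e1 : 0 < 1 - eta by rewrite subr_gt0.
rewrite -[leRHS]mul1r ler_pdivlMr//.
have -> : (\sum_(i < n) eta ^+ i) * (1 - eta) = 1 - eta ^+ n.
  by rewrite mulrC -opprB mulNr -subrX1 opprB.
by rewrite gerDl oppr_le0 exprn_ge0.
Unshelve. all: by end_near. Qed.

Section holder.
Context {R : realType}.
Variables (k0 lam a b : R).
Hypotheses (hk0 : 0 < k0) (hlam : 1 < lam).

Let lam0 : 0 < lam. Proof. by rewrite (lt_trans ltr01). Qed.

(** Per shell the weight contributes lambda^(-2 - 2 alpha) and the terms at most lambda^(2 + alpha),
    which leaves ratio lambda^(-alpha). The power 8 is 2 * 2 * 2: shell [m] sits at the coordinates
    [2 m] and [2 m + 1], the field is quadratic, and the norm is squared. *)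
Lemma Hnorm2_le (alpha rho C : R) (u : nat -> cplx R) : 0 < alpha -> 0 <= C ->
  0 <= rho -> rho ^+ 8 <= lam `^ alpha ->
  (forall m, cnorm2 (u m) <= C * (lam ^+ 2 * rho ^+ 8) ^+ m) ->
  (Hnorm2 k0 lam (-1 - alpha) u <=
   (C * (k0 `^ (2 * (-1 - alpha)) / (1 - lam `^ (- alpha))))%:E)%E.
Proof.
move=> al0 C0 rho0 rl uC.
have e1 : lam `^ (- alpha) < 1.
  rewrite powRN invf_lt1 ?powR_gt0//.
  have := gt0_ltr_powR al0 _ _ hlam; rewrite powR1; apply; rewrite nnegrE//.
  exact: ltW.
set W := k0 `^ _; have W0 : 0 <= W by exact: powR_ge0.
rewrite mulrA; apply: nneseries_geometric_le.
- exact: mulr_ge0.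
- by rewrite powR_ge0 e1.
move=> m; apply/andP; split.
  by rewrite mulr_ge0 ?powR_ge0// addr_ge0// sqr_ge0.
apply: (@le_trans _ _ (kn k0 lam m.+1 `^ (2 * (-1 - alpha)) *
    (C * (lam ^+ 2 * lam `^ alpha) ^+ m))).
  rewrite ler_wpM2l ?powR_ge0//; apply: (le_trans (uC m)).
  rewrite ler_wpM2l// lerXn2r ?nnegrE ?mulr_ge0 ?exprn_ge0 ?powR_ge0 ?(ltW lam0)//.
  by rewrite ler_wpM2l// exprn_ge0// ltW.
rewrite /kn powRM ?exprn_ge0 ?(ltW hk0) ?(ltW lam0)// -/W.
have -> : W * (lam ^+ m.+1) `^ (2 * (-1 - alpha)) * (C * (lam ^+ 2 * lam `^ alpha) ^+ m) =
   C * W * ((lam ^+ m.+1) `^ (2 * (-1 - alpha)) * (lam ^+ 2 * lam `^ alpha) ^+ m) by ring.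
rewrite ler_wpM2l ?mulr_ge0//.
rewrite -![lam ^+ _]powR_mulrn ?(ltW lam0)// -powRrM -powRD; last by rewrite (gt_eqF lam0) implybT.
rewrite -powR_mulrn ?powR_ge0// -powRrM -powRD; last by rewrite (gt_eqF lam0) implybT.
rewrite -powR_mulrn ?powR_ge0// -powRrM ler_powR ?(ltW hlam)//.
rewrite -natr1; have m0 : (0 : R) <= m%:R by []; nra.
Qed.

Variable w : nat -> nat -> R.
Hypothesis gw : good k0 lam a b w.

Local Notation vpath := (vpath k0 lam a b w).
Local Notation kap := (kap k0 lam a b).
Local Notation bounded_by := (bounded_by k0 lam a b w).

Lemma bounded_by_geometric T (alpha : R) : 0 < alpha -> exists K rho,
  [/\ 0 < K, 1 <= rho, rho ^+ 8 <= lam `^ alpha & forall D, bounded_by T D (K * rho ^+ D)].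
Proof.
(* With p + 1 > 16 / alpha and rho = lambda^(2/(p+1)), the eighth power of rho is lambda^(16/(p+1))
   <= lambda^alpha. *)
move=> al0; pose p := Num.bound (16 / alpha).
have pal : 16 / alpha < p.+1%:R.
  by apply: lt_trans (archi_boundP _) _; rewrite ?divr_ge0 ?ltW ?ltr_nat.
have p0 : (0 : R) < p.+1%:R by rewrite ltr0n.
have [K [K0 HK]] := moment_window hlam gw T p.
pose rho := lam `^ (2 / p.+1%:R); pose K1 := K `^ p.+1%:R^-1.
have rho1 : 1 <= rho by rewrite -[1](powRr0 lam) ler_powR ?(ltW hlam)// divr_ge0.
have rho0 : 0 <= rho by exact: powR_ge0.
have rhoE : rho ^+ p.+1 = lam ^+ 2.
  by rewrite -powR_mulrn// -powRrM divfK ?gt_eqF// powR_mulrn// ltW.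
have K1E : K1 ^+ p.+1 = K.
  by rewrite -powR_mulrn ?powR_ge0// -powRrM mulVf ?gt_eqF// powRr1// ltW.
exists K1, rho; split => //; first exact: powR_gt0.
  rewrite -powR_mulrn// -powRrM ler_powR ?(ltW hlam)//.
  rewrite mulrAC ler_pdivrMr// -ler_pdivrMl// mulrC.
  by apply: le_trans (ltW pal); rewrite ler_wpM2r ?invr_ge0 ?(ltW al0)//; lra.
move=> D; apply: filterS2 (hyper_gt D) HK => N DN HK q n wq nD.
rewrite -(@ler_pXn2r _ p.+1)// ?nnegrE//; last first.
  by rewrite mulr_ge0 ?exprn_ge0// powR_ge0.
apply: (le_trans (HK q n wq (leq_ltn_trans nD DN))).
rewrite exprMn K1E ler_wpM2l ?(ltW K0)// exprM -rhoE -!exprM mulnC.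
rewrite ler_weXn2l//; nia.
Qed.

Lemma shells_cnorm2 (f : nat -> R) (B : R) m : 0 <= B ->
  `|f m.*2| <= B -> `|f m.*2.+1| <= B -> cnorm2 (shells f m) <= 2 * B ^+ 2.
Proof.
move=> B0 h1 h2; rewrite /cnorm2/= mulr_natl mulr2n lerD//.
  by rewrite -(real_normK (num_real (f m.*2))) lerXn2r.
by rewrite -(real_normK (num_real (f m.*2.+1))) lerXn2r.
Qed.

Let aux1 n m : (n <= m.*2.+1)%N -> (n./2 <= m)%N && (n + 5 <= 6 + m.*2)%N.
Proof. lia. Qed.

Let aux2 m : (4 * m = m.*2 + m.*2)%N. Proof. lia. Qed.

Lemma vpath_holder (gamma alpha : R) : 0 <= gamma -> gamma < 1 -> 0 < alpha ->
  holder_loc k0 lam (-1 - alpha) gamma (fun t => shells (vpath t)).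
Proof.
move=> g0 g1 al0; split.
  move=> t; have [T tT] := exists_T t.
  have [K [rho [K0 rho1 rl bK]]] := bounded_by_geometric T al0.
  have rho0 : 0 <= rho by rewrite (le_trans ler01).
  apply: le_lt_trans (Hnorm2_le (C := 2 * (K * rho) ^+ 2) al0 _ rho0 rl _) _.
  - by apply: mulr_ge0 => //; exact: sqr_ge0.
  - move=> m; apply: (@le_trans _ _ (2 * (K * rho ^+ m.*2.+1) ^+ 2)).
      apply: shells_cnorm2; first by apply: mulr_ge0; [exact: ltW|exact: exprn_ge0].
        exact: (vpath_bound hk0 hlam gw tT (bK _) (leqnSn _)).
      by apply: (vpath_bound hk0 hlam gw tT (bK _)).
    have -> : 2 * (K * rho ^+ m.*2.+1) ^+ 2 = 2 * (K * rho) ^+ 2 * (rho ^+ 4) ^+ m.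
      rewrite -exprM aux2.
      by rewrite exprD [rho ^+ _.+1]exprS; move: (rho ^+ m.*2) => X; ring.
    apply: ler_wpM2l; first by apply: mulr_ge0 => //; exact: sqr_ge0.
    apply: lerXn2r; rewrite ?nnegrE.
    - exact: exprn_ge0.
    - by apply: mulr_ge0; apply: exprn_ge0 => //; exact: ltW.
    rewrite -[leLHS]mul1r; apply: ler_pM => //; first exact: exprn_ge0.
      by rewrite exprn_ege1// ltW.
    by rewrite ler_weXn2l.
  - exact: ltry.
move=> T T0; have [Tn /andP[_ TTn]] := exists_T T.
have [K [rho [K0 rho1 rl bK]]] := bounded_by_geometric Tn al0.
have rho0 : 0 <= rho by rewrite (le_trans ler01).
(* The exponent 6: for [n <= 2 m + 1] the Lipschitz bound of coordinate [n] uses coordinates up to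
   [n + 5 <= 2 m + 6]. *)
pose L := kap 0 * (2 * (K * rho ^+ 6) ^+ 2).
have L0 : 0 <= L.
  by apply: mulr_ge0; [exact: kap_ge0|apply: mulr_ge0 => //; exact: sqr_ge0].
set W := k0 `^ (2 * (-1 - alpha)) / (1 - lam `^ (- alpha)).
pose S := 2 * L ^+ 2 * W.
(* On the window the path is Lipschitz with constant [Num.sqrt S], and d <= (2T)^(1 - gamma) d^gamma
   for 0 < d <= 2T. *)
exists (Num.sqrt S * (2 * T) `^ (1 - gamma)); split.
  by rewrite mulr_ge0 ?sqrtr_ge0 ?powR_ge0.
move=> t1 t2 Tt1 t12 t2T.
have d0 : 0 < t2 - t1 by rewrite subr_gt0.
have n1 : - Tn%:R <= t1 by rewrite (le_trans _ Tt1)// lerN2.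
have n2 : t2 <= Tn%:R by rewrite (le_trans t2T).
have lip n m : (n <= m.*2.+1)%N -> `|vpath t2 n - vpath t1 n| <=
    (t2 - t1) * L * (lam * rho ^+ 4) ^+ m.
  move=> /aux1/andP[nm nm6].
  apply: (le_trans (vpath_lipschitz hk0 hlam gw (bK (n + 5)%N) n1 (ltW t12) n2)).
  rewrite -[leLHS]mulrA -[leRHS]mulrA; apply: ler_wpM2l; first exact: ltW.
  have h1 : lam ^+ n./2 <= lam ^+ m by rewrite ler_weXn2l// ltW.
  have h2 : rho ^+ (n + 5) <= rho ^+ 6 * rho ^+ m.*2.
    by rewrite -exprD ler_weXn2l.
  have kap00 : 0 <= kap 0 by exact: kap_ge0.
  have r6 : 0 <= rho ^+ (n + 5) by exact: exprn_ge0.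
  have h3 : (K * rho ^+ (n + 5)) ^+ 2 <= (K * rho ^+ 6) ^+ 2 * (rho ^+ 4) ^+ m.
    have -> : (K * rho ^+ 6) ^+ 2 * (rho ^+ 4) ^+ m = (K * (rho ^+ 6 * rho ^+ m.*2)) ^+ 2.
      rewrite -exprM aux2.
      by rewrite exprD; ring.
    have K00 := ltW K0; apply: lerXn2r; rewrite ?nnegrE.
    - exact: mulr_ge0.
    - by apply: mulr_ge0 => //; apply: mulr_ge0; exact: exprn_ge0.
    exact: ler_wpM2l.
  have -> : L * (lam * rho ^+ 4) ^+ m = kap 0 * lam ^+ m *
      (2 * ((K * rho ^+ 6) ^+ 2 * (rho ^+ 4) ^+ m)).
    rewrite /L [(lam * _) ^+ m]exprMn.
    by move: (kap 0) ((rho ^+ 4) ^+ m) (lam ^+ m) (rho ^+ 6) => c X Y Z; ring.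
  rewrite kapE; apply: ler_pM.
  - by apply: mulr_ge0 => //; apply: exprn_ge0; exact: ltW.
  - by apply: mulr_ge0 => //; exact: sqr_ge0.
  - exact: ler_wpM2l.
  - exact: ler_wpM2l.
apply: (le_trans (Hnorm2_le (C := 2 * ((t2 - t1) * L) ^+ 2) al0 _ rho0 rl _)).
- by apply: mulr_ge0 => //; exact: sqr_ge0.
- move=> m.
  have B0 : 0 <= (t2 - t1) * L * (lam * rho ^+ 4) ^+ m.
    by apply: le_trans (lip _ _ (leqnn m.*2.+1)).
  have := @shells_cnorm2 (fun n => vpath t2 n - vpath t1 n) _ m B0
    (lip _ _ (leqnSn _)) (lip _ _ (leqnn _)).
  move=> /le_trans; apply; rewrite le_eqVlt; apply/orP; left; apply/eqP.
  have -> : (lam ^+ 2 * rho ^+ 8) ^+ m = ((lam * rho ^+ 4) ^+ m) ^+ 2.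
    by rewrite [RHS]exprAC; congr (_ ^+ m); ring.
  by move: ((lam * rho ^+ 4) ^+ m) => X; ring.
rewrite lee_fin -/W.
have W0 : 0 <= W.
  rewrite /W divr_ge0 ?powR_ge0// subr_ge0 powRN invf_le1 ?powR_gt0//.
  by rewrite -[1](powRr0 lam) ler_powR ?(ltW hlam)// ltW.
have S0 : 0 <= S.
  by apply: mulr_ge0 => //; apply: mulr_ge0 => //; exact: sqr_ge0.
have T20 : 0 < 2 * T by rewrite mulr_gt0.
have dT : t2 - t1 <= 2 * T by rewrite mulr_natl mulr2n; lra.
rewrite -[Num.sqrt S * _ * _]mulrA; set X := (2 * T) `^ _ * _.
rewrite [leRHS]exprMn sqr_sqrtr//; move: S0; rewrite /S => S0.
have -> : 2 * ((t2 - t1) * L) ^+ 2 * W = 2 * L ^+ 2 * W * (t2 - t1) ^+ 2.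
  by move: {S0} (L) (W) => l v; ring.
apply: ler_wpM2l => //.
apply: lerXn2r; rewrite ?nnegrE ?(ltW d0)//.
  by rewrite mulr_ge0 ?powR_ge0.
rewrite /X.
have dE : t2 - t1 = (t2 - t1) `^ (1 - gamma) * (t2 - t1) `^ gamma.
  rewrite -powRD ?subrK ?powRr1 ?(ltW d0)//.
  by rewrite (gt_eqF d0) implybT.
rewrite [leLHS]dE ler_wpM2r ?powR_ge0// ge0_ler_powR ?nnegrE ?(ltW d0) ?(ltW T20)//.
by rewrite subr_ge0 ltW.
Qed.

End holder.

(** * Stationarity *)

Section stationary.
Context {R : realType}.
Variables (k0 lam a b : R).
Hypotheses (hk0 : 0 < k0) (hlam : 1 < lam).

Local Notation traj := (traj k0 lam a b).

Lemma truncnD (x y : R) : 0 <= x -> 0 <= y ->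
  (Num.truncn x + Num.truncn y <= Num.truncn (x + y) <=
   (Num.truncn x + Num.truncn y).+1)%N.
Proof.
move=> x0 y0; have xy0 := addr_ge0 x0 y0.
have /andP[x1 x2] := truncn_itv x0; have /andP[y1 y2] := truncn_itv y0.
apply/andP; split; first by rewrite truncn_ge_nat// natrD lerD.
rewrite -ltnS truncn_lt_nat// (lt_le_trans (ltrD x2 y2))//.
by rewrite -natrD ler_nat addSn addnS.
Qed.

Definition shift_idx (h : R) (N : nat) : nat := Num.truncn (h * N.+1%:R).

(** Shifting by [shift_idx h N] whole time steps misses the index of [t + h] by at most one time
    step, by [truncnD]; during it a coordinate moves by O([hstep N]). *)
Lemma shift_path_cvg (w : nat -> nat -> R) t h n : good k0 lam a b w -> 0 <= h ->
  (fun N => traj N (w N) (8 * N * (shift_idx h N + tidx t N)) n) @ hyper -->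
  vpath k0 lam a b w (t + h) n.
Proof.
move=> gw h0.
have [T1 /andP[t1 _]] := exists_T t; have [T2 /andP[_ t2]] := exists_T (t + h).
pose T := maxn T1 T2; have tT : - T%:R <= t.
  by apply: le_trans t1; rewrite lerN2 ler_nat leq_maxl.
have thT : t + h <= T%:R by apply: (le_trans t2); rewrite ler_nat leq_maxr.
have [A [A0 bA]] := exists_bound hk0 hlam gw T (n + 5).
set f := (fun N => _).
have fu : (fun N => f N - upath k0 lam a b w (t + h) N n) @ hyper --> (0 : R).
  apply/cvgrPdist_le => e e0.
  have hc : (fun N => kap k0 lam a b n * (hstep N * (2 * A ^+ 2))) @ hyper --> (0 : R).
    rewrite -(mulr0 (kap k0 lam a b n)) -(mul0r (2 * A ^+ 2)).
    by apply: cvgMr; apply: cvgMl; exact: hstep_cvg0.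
  move/cvgrPdist_le : hc => /(_ e e0) hc.
  apply: filterS3 (hyper_gt T) bA hc => N TN HA hc.
  rewrite sub0r normrN.
  have tN : 0 <= t + N%:R.
    by rewrite -lerBlDr sub0r (le_trans _ tT)// lerN2 ler_nat ltnW.
  have := @truncnD ((t + N%:R) * N.+1%:R) (h * N.+1%:R); rewrite -mulrDl addrAC.
  rewrite -/(shift_idx h N) -/(tidx t N) -/(tidx (t + h) N) addnC.
  move=> /(_ (mulr_ge0 tN (ler0n _ _)) (mulr_ge0 h0 (ler0n _ _))) /andP[l1 l2].
  have wt : (wlo T N <= tidx t N)%N.
    have tT' : - T%:R <= t <= T%:R by rewrite tT (le_trans _ thT)// lerDl.
    by have /andP[] := tidx_win tT' TN.
  have wth : (tidx (t + h) N <= whi T N)%N.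
    have tT' : - T%:R <= t + h <= T%:R by rewrite thT (le_trans tT)// lerDl.
    by have /andP[] := tidx_win tT' TN.
  rewrite distrC /f /upath.
  have := @window_diff R (hstep N) (sched k0 lam a b N) (traj N (w N))
    (hstep_ge0 N) (sched_wf k0 lam a b N) (fun=> erefl) n (8 * N)%N
    (shift_idx h N + tidx t N) (tidx (t + h) N)
    (kap k0 lam a b n) A l1 (kappa_sum a b hk0 hlam n N) _
    (8 * N * (shift_idx h N + tidx t N))%N (8 * N * tidx (t + h) N)%N.
  rewrite !leqnn !leq_mul2l l1 !orbT => /(_ _ isT isT) H.
  have {H} : `|traj N (w N) (8 * N * tidx (t + h) N) n -
      traj N (w N) (8 * N * (shift_idx h N + tidx t N)) n| <=
      (tidx (t + h) N - (shift_idx h N + tidx t N))%:R * kap k0 lam a b n *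
      (hstep N * (2 * A ^+ 2)).
    apply: H => l /andP[wl1 wl2] an; have [_ r1 r2 r3] := triad_range an.
    have wl : inwin T N l.
      rewrite /inwin (leq_trans _ wl1) ?(leq_trans _ (leq_mul (leqnn _) wth)) ?wl2//.
      by rewrite leq_mul2l (leq_trans wt) ?orbT// leq_addl.
    by split; apply: HA.
  move=> /le_trans; apply; apply: le_trans (le_trans (ler_norm _) _); last first.
    by rewrite sub0r normrN in hc; exact: hc.
  rewrite -[leRHS]mul1r -mulrA ler_wpM2r//.
    rewrite mulr_ge0 ?kap_ge0// mulr_ge0 ?hstep_ge0//.
    by apply: mulr_ge0 => //; exact: sqr_ge0.
  by rewrite lern1 leq_subLR addn1.
rewrite (_ : f = (fun N => (f N - upath k0 lam a b w (t + h) N n) +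
    upath k0 lam a b w (t + h) N n)); last by apply/funext => N; rewrite subrK.
by rewrite -[X in _ --> X]add0r; apply: cvgD => //; exact: upath_cvg.
Qed.

Variables (nu : R) (P : probability (@rseq R) R).
Hypotheses (nu0 : 0 < nu) (iidP : iid (gauss1 nu) P).

Local Notation LP := (loeb (fun _ : nat => P)).
Local Notation vpath := (vpath k0 lam a b).

Lemma ae_good : {ae LP, forall w, good k0 lam a b w}.
Proof.
apply: ae_forall_countable => T; apply: ae_forall_countable => m.
have [C HC] := Gfun_mean a b hk0 hlam nu0 iidP T m.
apply: (@loeb_markov _ _ _ _ _ C) => [N|N|]; [by have [] := HC N|by have [] := HC N|].
by apply: nearW => N; have [] := HC N.
Qed.

Lemma measurable_vpath t n :
  measurable_fun setT (fun w : loeb_space rseq => vpath w t n).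
Proof.
apply: (@measurable_hlim _ _ _ (fun N (x : rseq) => traj N x (8 * N * tidx t N) n)) => N.
exact: measurable_traj_coord.
Qed.

(** For each [N] a shift by whole time steps preserves the joint laws exactly; in the limit it
    becomes the shift by [h]. *)
Let shift_stationary (I : finType) (n : I -> nat) (t : I -> R) h (A : I -> set R) :
  0 <= h -> (forall i, measurable (A i)) ->
  LP [set w | forall i, A i (vpath w (t i + h) (n i))] =
  LP [set w | forall i, A i (vpath w (t i) (n i))].
Proof.
move=> h0 mA.
pose f i N (x : rseq) := traj N x (8 * N * (shift_idx h N + tidx (t i) N)) (n i).
pose g i N (x : rseq) := traj N x (8 * N * tidx (t i) N) (n i).
have mf i N : measurable_fun setT (f i N) by exact: measurable_traj_coord.
have mg i N : measurable_fun setT (g i N) by exact: measurable_traj_coord.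
transitivity (LP [set w | forall i, A i (hlim (f i) w)]).
  apply: (ae_eq_measure _ _ ae_good).
  - by apply: measurable_forall mA => i; exact: measurable_vpath.
  - by apply: measurable_forall mA => i; exact: measurable_hlim.
  move=> w gw; have E i : hlim (f i) w = vpath w (t i + h) (n i).
    exact/ulim_eq/shift_path_cvg.
  by split=> H i; have := H i; rewrite E.
apply: (@loeb_law_eq _ _ _ _ _ f mf _ g mg) => // [i|i|c j].
- apply: ae_sub ae_good => w gw; exact: (cvg_ubounded (@shift_path_cvg w (t i) h (n i) gw h0)).
- apply: ae_sub ae_good => w gw.
  exact: (cvg_ubounded (@upath_cvg _ _ _ a b hk0 hlam w gw (t i) (n i))).
apply: nearW => N.
rewrite -(traj_invariant k0 lam a b nu0 iidP N (8 * N * shift_idx h N)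
  (measurable_rayset mg c j N)).
congr (P _); apply/seteqP; split=> x /= H i; have := H i;
  by rewrite /f /g mulnDr traj_shift.
Qed.

(** For negative [h], apply the shift by [- h] to the already shifted times. *)
Lemma vpath_stationary (I : finType) (n : I -> nat) (t : I -> R) h (A : I -> set R) :
  (forall i, measurable (A i)) ->
  LP [set w | forall i, A i (vpath w (t i + h) (n i))] =
  LP [set w | forall i, A i (vpath w (t i) (n i))].
Proof.
move=> mA; have [h0|h0] := leP 0 h; first exact: shift_stationary.
rewrite -(@shift_stationary I n (fun i => t i + h) (- h) A) ?oppr_ge0 ?ltW//.
by congr (LP _); apply/seteqP; split=> w /= H i; have := H i; rewrite addrK.
Qed.

Lemma vpath_law (I : finType) (n : I -> nat) t (A : I -> set R) :
  (forall i, measurable (A i)) ->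
  LP [set w | forall i, A i (vpath w t (n i))] = P [set x | forall i, A i (x (n i))].
Proof.
move=> mA; pose f i N (x : rseq) := traj N x (8 * N * tidx t N) (n i).
have mf i N : measurable_fun setT (f i N) by exact: measurable_traj_coord.
transitivity (LP [set w | forall i, A i (hlim (f i) w)]); first by [].
apply: (@loeb_law_cst _ _ _ (fun=> P) _ f mf _ _ _ P (fun i (x : rseq) => x (n i))) => // [i|i|c k].
- apply: ae_sub ae_good => w gw; exact: (cvg_ubounded (@upath_cvg _ _ _ a b hk0 hlam w gw t (n i))).
- exact: measurable_coord.
apply: nearW => N; pose E := [set x : rseq | forall i, x (n i) < c i + k.+1%:R^-1].
rewrite -(traj_invariant k0 lam a b nu0 iidP N (8 * N * tidx t N) (E := E))//.
exact: (@measurable_rayset _ _ _ _ (fun i _ (x : rseq) => x (n i))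
  (fun i _ => measurable_coord (n i)) c k 0).
Qed.

(** The real coordinate that holds the real part ([true]) or the imaginary part of shell [m]. *)
Definition part (b : bool) (m : nat) := if b then m.*2 else m.*2.+1.

Lemma measurable_shells d (Om : measurableType d) (f : Om -> nat -> R) m :
  (forall n, measurable_fun setT (fun w => f w n)) ->
  measurable_fun setT (fun w => shells (f w) m : R * R).
Proof. by move=> mf; exact: measurable_fun_pair. Qed.

Lemma shells_stationary (I : finType) (m : I -> nat) (t : I -> R) h (A : I -> set (R * R)) :
  (forall i, measurable (A i)) ->
  LP [set w | forall i, A i (shells (vpath w (t i + h)) (m i))] =
  LP [set w | forall i, A i (shells (vpath w (t i)) (m i))].
Proof.
move=> mA; apply: law_rect => // [i|i|c mc].
- by apply: measurable_shells => n; exact: measurable_vpath.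
- by apply: measurable_shells => n; exact: measurable_vpath.
have := @vpath_stationary _ (fun i : I * bool => part i.2 (m i.1)) (fun i => t i.1) h c mc.
congr (_ = _); congr (LP _); apply/seteqP; split=> w H [i []];
  by [exact: (H (i, true))|exact: (H (i, false))].
Qed.

Lemma prod_double (f : nat -> \bar R) N :
  (\prod_(n < N.*2) f n = \prod_(i < N) (f i.*2 * f i.*2.+1))%E.
Proof.
elim: N => [|N IH]; first by rewrite !big_ord0.
by rewrite doubleS !big_ord_recr/= IH muleA.
Qed.

Lemma prod_fin_num (I : finType) (Q : pred I) (f : I -> \bar R) :
  (forall i, f i \is a fin_num) ->
  (\prod_(i | Q i) f i = (\prod_(i | Q i) fine (f i))%:E)%E.
Proof.
move=> ff; elim/big_ind2 : _ => // [x1 x2 y1 y2 -> ->//|i _].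
by rewrite fineK.
Qed.

(** Both sides are finite measures of each [A i] separately, so rectangles are enough, and for these
    the event is a cylinder in the real coordinates. *)
Lemma iid_shells N (A : 'I_N -> set (R * R)) : (forall i, measurable (A i)) ->
  P [set x | forall i : 'I_N, A i (shells x i)] = (\prod_(i < N) gauss2 nu (A i))%E.
Proof.
pose gg : probability (R * R)%type R := (gauss1 nu \x gauss1 nu)%E.
move=> mA.
transitivity (\prod_(i < N) gg (A i))%E; last first.
  by apply: eq_bigr => i _; rewrite -gauss1_prodE.
set G := [set A `*` B | A in @measurable _ R & B in @measurable _ R].
have Gg (k : nat) : G setT by exists setT => //; exists setT => //; rewrite setXTT.
have gT : \bigcup_(k : nat) [set: R * R] = setT.
  by apply/seteqP; split=> // x _; exists 0%N.
have ms (i : 'I_N) : measurable_fun setT (fun x : rseq => shells x i : R * R).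
  by apply: measurable_shells => n; exact: measurable_coord.
have mgg : multimeasure (fun A : 'I_N -> set (R * R) => \prod_(i < N) gg (A i))%E.
  move=> B i mB; have p0 : 0 <= \prod_(j < N | j != i) fine (gg (B j)).
    by apply: prodr_ge0 => j _; exact: fine_ge0.
  exists (mscale (NngNum p0) gg); split.
    have lty : ((NngNum p0)%:num%:E * gg setT < +oo)%E.
      by rewrite probability_setT mule1 ltry.
    exact: lty.
  move=> C mC.
  transitivity ((\prod_(j < N | j != i) fine (gg (B j)))%:E * gg C)%E; last by [].
  rewrite (bigD1 i)//= /updset eqxx muleC -prod_fin_num; last first.
    by move=> j; exact: (fin_num_measure gg _ (mB j)).
  by rewrite (eq_bigr (fun j => gg (B j))) // => j /negbTE ->.
apply: (multimeasure_unique (@measurable_prod_measurableType _ _ R R) (@rect_setI_closed R) Gg gT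
  (multimeasure_law P ms) mgg _ mA).
move=> {mA}A GA.
have /choice[cc cA] i : exists p : set R * set R,
    [/\ measurable p.1, measurable p.2 & A i = p.1 `*` p.2].
  by have [B1 m1 [B2 m2 <-]] := GA i; exists (B1, B2).
(* The sides of the rectangles, unfolded: first sides at even indices, second sides at odd ones. *)
pose C (n : nat) : set R :=
  if insub n./2 is Some i then (if odd n then (cc i).2 else (cc i).1) else setT.
have mC n : measurable (C n).
  by rewrite /C; case: insubP => // i _ _; case: ifP => _; have [] := cA i.
have Ce (i : 'I_N) : C i.*2 = (cc i).1.
  by rewrite /C doubleK valK odd_double.
have Co (i : 'I_N) : C i.*2.+1 = (cc i).2.
  by rewrite /C/= uphalf_double valK odd_double.
transitivity (P (cylset N.*2 C)).
  congr (P _); apply/seteqP; split=> x /= H.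
    move=> n nN; have n2 : (n./2 < N)%N by rewrite ltn_half_double.
    have := H (Ordinal n2); have [_ _ ->] := cA (Ordinal n2) => -[/= h1 h2].
    rewrite -[n]odd_double_half; case: (odd n) => /=.
      by rewrite (Co (Ordinal n2)).
    by rewrite (Ce (Ordinal n2)).
  move=> i; have [_ _ ->] := cA i; split => /=.
    by rewrite -Ce; apply: H; rewrite ltn_double.
  by rewrite -Co; apply: H; rewrite ltn_Sdouble.
rewrite (iidP N.*2 mC) (prod_double (fun n => gauss1 nu (C n))); apply: eq_bigr => i _.
have [m1 m2 ->] := cA i.
by rewrite Ce Co -product_measure1E.
Qed.

Lemma shells_law N t (A : 'I_N -> set (R * R)) : (forall i, measurable (A i)) ->
  LP [set w | forall i : 'I_N, A i (shells (vpath w t) i)] =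
  (\prod_(i < N) gauss2 nu (A i))%E.
Proof.
move=> mA; rewrite -iid_shells//; apply: law_rect => // [i|i|c mc].
- by apply: measurable_shells => n; exact: measurable_vpath.
- by apply: measurable_shells => n; exact: measurable_coord.
have := @vpath_law _ (fun i : 'I_N * bool => part i.2 i.1) t c mc.
congr (_ = _); [congr (LP _)|congr (P _)]; apply/seteqP; split=> w H [i []];
  by [exact: (H (i, true))|exact: (H (i, false))].
Qed.

End stationary.

Theorem theorem4p2 (R : realType) (k0 lam a b : R) (hk0 : 0 < k0) (hlam : 1 < lam)
  (nu : R) (hnu : 0 < nu) :
  exists (d : measure_display) (Omega : measurableType d)
         (P : probability Omega R) (v : R -> Omega -> nat -> cplx R),
    (* each coordinate v_n(t) is a random variable with values in R^2 *)
    (forall (t : R) (m : nat), measurable_fun setT (fun w => v t w m)) /\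
    (* law of v(t) is mu^nu: on all finite-dimensional cylinder sets *)
    (forall (t : R) (N : nat) (A : 'I_N -> set (cplx R)),
        (forall i, measurable (A i)) ->
        P [set w | forall i : 'I_N, A i (v t w i)] =
          (\prod_(i < N) gauss2 nu (A i))%E) /\
    (* stationarity: all finite-dimensional distributions are shift invariant *)
    (forall (M N : nat) (ts : 'I_M -> R) (h : R) (A : 'I_M -> 'I_N -> set (cplx R)),
        (forall j i, measurable (A j i)) ->
        P [set w | forall (j : 'I_M) (i : 'I_N), A j i (v (ts j + h) w i)] =
        P [set w | forall (j : 'I_M) (i : 'I_N), A j i (v (ts j) w i)]) /\
    (* almost surely: paths solve the inviscid unforced shell model and are
       locally gamma-Hoelder with values in H^{-1-alpha} *)
    {ae P, forall w,
      solves_inviscid k0 lam a b (fun t => v t w) /\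
      forall gamma alpha : R, 0 <= gamma -> gamma < 1 -> 0 < alpha ->
        holder_loc k0 lam (-1 - alpha) gamma (fun t => v t w)}.
Proof.
(* The common law of the initial states of all schemes; the exponent 1 gives the moment that
   [iid_exists] asks for. *)
have [P iidP] : exists P, iid (gauss1 nu) P.
  by apply: iid_exists; exact: gauss1_moment 1 hnu.
exists _, (loeb_space rseq), (loeb (fun=> P)), (fun t w => shells (vpath k0 lam a b w t)).
split; [|split; [|split]].
- by move=> t m; apply: measurable_shells => n; exact: measurable_vpath.
- by move=> t N A mA; exact: shells_law.
- move=> M N ts h A mA.
  (* The family over times and shells is treated as a single family over the product of the index
     sets. *)
  have := @shells_stationary _ k0 lam a b hk0 hlam nu P hnu iidP ('I_M * 'I_N)%type
    (fun p => p.2) (fun p => ts p.1) h (fun p => A p.1 p.2) (fun p => mA p.1 p.2).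
  by congr (_ = _); congr (_ _); apply/seteqP; split=> w /= H => [j i|[j i]];
    [exact: (H (j, i))|exact: H|exact: (H (j, i))|exact: H].
apply: ae_sub (ae_good a b hk0 hlam hnu iidP) => w gw; split.
  exact: vpath_solves.
by move=> gamma alpha g0 g1 al0; exact: vpath_holder.
Qed.
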